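(* Let $S$ be a coalgebra, $\mathcal K$ a left $\times_S$-Hopf coalgebra, $T$ a left $\mathcal K$-comodule coalgebra, and $M$ a left-right stable anti-Yetter-Drinfeld (SAYD) module over $\mathcal K$. For $n\ge 0$ set ${}^{\mathcal K}C^n(T,M)=M\,\square_{\mathcal K}\,T^{\square_S(n+1)}$. Then the following operators turn ${}^{\mathcal K}C^{\bullet}(T,M)$ into a cocyclic module (vector space), where $\widetilde t=t_0\otimes\cdots\otimes t_n$: cofaces $d_i:{}^{\mathcal K}C^n(T,M)\to{}^{\mathcal K}C^{n+1}(T,M)$, $$d_i(m\otimes\widetilde t)=m\otimes t_0\otimes\cdots\otimes\Delta(t_i)\otimes\cdots\otimes t_n\quad(0\le i\le n),$$ $$d_{n+1}(m\otimes\widetilde t)=\big(t_0^{(2)}{}_{\langle-1\rangle}\,t_{1\langle-1\rangle}\cdots t_{n\langle-1\rangle}\big)\triangleright m\otimes t_0^{(2)}{}_{\langle0\rangle}\otimes t_{1\langle0\rangle}\otimes\cdots\otimes t_{n\langle0\rangle}\otimes t_0^{(1)};$$ codegeneracies $s_i:{}^{\mathcal K}C^n(T,M)\to{}^{\mathcal K}C^{n-1}(T,M)$, $$s_i(m\otimes\widetilde t)=m\otimes t_0\otimes\cdots\otimes\varepsilon(t_{i+1})\otimes\cdots\otimes t_n\quad(0\le i\le n-1);$$ and cyclic operator $$\mathfrak t_n(m\otimes\widetilde t)=\big(t_{1\langle-1\rangle}\cdots t_{n\langle-1\rangle}\big)\triangleright m\otimes t_{1\langle0\rangle}\otimes\cdots\otimes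 t_{n\langle0\rangle}\otimes t_0,$$ with $\mathfrak t_0=\mathrm{Id}$.
   Context: Conventions. All vector spaces, coalgebras and tensor products are over the field of complex numbers; $\Delta(x)=x^{(1)}\otimes x^{(2)}$ and $\varepsilon$ is the counit; elements of (co)tensor products are written as simple tensors, sums being understood. $S_{\rm cop}$ is the co-opposite coalgebra. For a right comodule $X$ and a left comodule $Y$ over a coalgebra $S$, $X\square_SY\subseteq X\otimes Y$ consists of the elements $x\otimes y$ with $x_{\langle\overline0\rangle}\otimes x_{\langle\overline1\rangle}\otimes y=x\otimes y_{\langle\overline{-1}\rangle}\otimes y_{\langle\overline0\rangle}$. Overlined indices denote coactions of the base coalgebra, $\langle\ \rangle$ coactions of $\mathcal K$. Left $\times_S$-Hopf coalgebra. A left bicoalgebroid $\mathcal K$ over $S$ is a coalgebra with coalgebra maps $\alpha:\mathcal K\to S$, $\beta:\mathcal K\to S_{\rm cop}$ such that $\alpha(h^{(1)})\otimes\beta(h^{(2)})=\alpha(h^{(2)})\otimes\beta(h^{(1)})$; it is an $S$-bicomodule by $h\mapsto\alpha(h^{(1)})\otimes h^{(2)}$ and $h\mapsto h^{(2)}\otimes\beta(h^{(1)})$; and there are $S$-bicomodule maps $\mu:\mathcal K\square_S\mathcal K\to\mathcal K$, $g\otimes h\mapsto gh$ (associative) and $\eta:S\to\mathcal K$ with, for $g\otimes h\in\mathcal K\square_S\mathcal K$, $c\in S$: (1) $gh^{(1)}\otimes\alpha(h^{(2)})=g^{(1)}h\otimes\beta(g^{(2)})$; (2) $\Delta(gh)=g^{(1)}h^{(1)}\otimes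 g^{(2)}h^{(2)}$; (3) $\varepsilon(gh)=\varepsilon(g)\varepsilon(h)$; (4) $\eta(\alpha(h^{(1)}))h^{(2)}=h=h^{(2)}\eta(\beta(h^{(1)}))$; (5) $\Delta(\eta(c))=\eta(c)^{(1)}\otimes\eta(\alpha(\eta(c)^{(2)}))=\eta(c)^{(1)}\otimes\eta(\beta(\eta(c)^{(2)}))$; (6) $\varepsilon(\eta(c))=\varepsilon(c)$. It is a left $\times_S$-Hopf coalgebra if $\nu:\mathcal K\square_S\mathcal K\to\mathcal K\square_{S_{\rm cop}}\mathcal K$, $k\otimes k'\mapsto kk'^{(1)}\otimes k'^{(2)}$, is bijective, the codomain being formed with the coactions $k\mapsto k^{(1)}\otimes\beta(k^{(2)})$ and $k\mapsto\beta(k^{(1)})\otimes k^{(2)}$. Write $\nu^{-1}(k\otimes k')=\nu^-(k,k')\otimes\nu^+(k,k')$. SAYD modules. A left $\mathcal K$-module $M$ is a left $S$-comodule with an associative and unital action $\triangleright:\mathcal K\square_SM\to M$ (unital: $\eta(m_{\langle\overline{-1}\rangle})\triangleright m_{\langle\overline0\rangle}=m$) that is a left $S$-comodule map for $k\otimes m\mapsto\alpha(k^{(1)})\otimes k^{(2)}\otimes m$; it has the canonical right $S$-coaction $m\mapsto\eta(m_{\langle\overline{-1}\rangle})^{(1)}\triangleright m_{\langle\overline0\rangle}\otimes\alpha(\eta(m_{\langle\overline{-1}\rangle})^{(2)})$. A right $\mathcal K$-comodule $M$ is a right comodule $m\mapsto m_{\langle0\rangle}\otimes m_{\langle1\rangle}$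 over the coalgebra $\mathcal K$; it has an induced right coaction $m\mapsto m_{\langle0\rangle}\otimes\beta(m_{\langle1\rangle})$. A left-right anti-Yetter-Drinfeld module is a left $\mathcal K$-module and right $\mathcal K$-comodule $M$ such that (i) the induced right coaction coincides with the canonical one, and (ii) for all $m\otimes k\in M\square_{S_{\rm cop}}\mathcal K$ (formed with $m_{\langle0\rangle}\otimes\beta(m_{\langle1\rangle})$ and $\beta(k^{(1)})\otimes k^{(2)}$), $(k\triangleright m)_{\langle0\rangle}\otimes(k\triangleright m)_{\langle1\rangle}=\nu^+(m_{\langle1\rangle},k^{(1)})\triangleright m_{\langle0\rangle}\otimes k^{(2)}\nu^-(m_{\langle1\rangle},k^{(1)})$. It is stable (SAYD) if $m_{\langle1\rangle}\triangleright m_{\langle0\rangle}=m$. Comodule coalgebras. A left $\mathcal K$-comodule coalgebra $T$ is a coalgebra and a left comodule $t\mapsto t_{\langle-1\rangle}\otimes t_{\langle0\rangle}$ over the coalgebra $\mathcal K$ with: $t_{\langle-1\rangle}\varepsilon(t_{\langle0\rangle})=\eta(\alpha(t_{\langle-1\rangle}))\varepsilon(t_{\langle0\rangle})$; $t_{\langle-1\rangle}\otimes t_{\langle0\rangle}{}^{(1)}\otimes t_{\langle0\rangle}{}^{(2)}=t^{(1)}{}_{\langle-1\rangle}t^{(2)}{}_{\langle-1\rangle}\otimes t^{(1)}{}_{\langle0\rangle}\otimes t^{(2)}{}_{\langle0\rangle}$; $\beta(t^{(1)}{}_{\langle-1\rangle})\otimes t^{(1)}{}_{\langle0\rangle}\otimes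 t^{(2)}=\alpha(t^{(2)}{}_{\langle-1\rangle})\otimes t^{(1)}\otimes t^{(2)}{}_{\langle0\rangle}$. $T$ is an $S$-bicomodule by $t\mapsto\alpha(t_{\langle-1\rangle})\otimes t_{\langle0\rangle}$ and $t\mapsto t_{\langle0\rangle}\otimes\beta(t_{\langle-1\rangle})$. The left $\mathcal K$-coaction on $T^{\square_S(n+1)}$ is $t_0\otimes\cdots\otimes t_n\mapsto t_{0\langle-1\rangle}\cdots t_{n\langle-1\rangle}\otimes t_{0\langle0\rangle}\otimes\cdots\otimes t_{n\langle0\rangle}$. *)

(* Defs.v *)
From HB Require Import structures.
From mathcomp Require Import all_boot all_order all_algebra.
From mathcomp Require Import boolp classical_sets functions.
From mathcomp Require Import reals complex.

Set Implicit Arguments.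
Unset Strict Implicit.
Unset Printing Implicit Defensive.

Import GRing.Theory.
Local Open Scope ring_scope.
Local Open Scope quotient_scope.

Definition bilinear_map (F : fieldType) (U V W : lmodType F)
    (f : U -> V -> W) : Prop :=
  (forall v, linear (f^~ v)) /\ (forall u, linear (f u)).

Section Tensor.
Variables (F : fieldType) (U V : lmodType F).

Definition tens_eval (W : lmodType F) (f : U -> V -> W) (s : seq (U * V)) : W :=
  \sum_(p <- s) f p.1 p.2.

(* A formal sum of pairs is a representative of a tensor; two of them are
   identified when no bilinear map separates them.  *)
Definition tens_rel : rel (seq (U * V)) := fun s t =>
  `[< forall (W : lmodType F) (f : U -> V -> W),
        bilinear_map f -> tens_eval f s = tens_eval f t >].

Fact tens_rel_refl : reflexive tens_rel.
Proof. by move=> s; apply/asboolP. Qed.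

Fact tens_rel_sym : symmetric tens_rel.
Proof. by move=> s t; apply/asboolP/asboolP => st W f hf; rewrite st. Qed.

Fact tens_rel_trans : transitive tens_rel.
Proof.
move=> t s u /asboolP st /asboolP tu; apply/asboolP => W f hf.
by rewrite st // tu.
Qed.

Canonical tens_equiv := EquivRel tens_rel tens_rel_refl tens_rel_sym tens_rel_trans.

Definition tensor : Type := {eq_quot tens_equiv}.
HB.instance Definition _ := Quotient.on tensor.
HB.instance Definition _ := Choice.on tensor.

Definition tlift (W : lmodType F) (f : U -> V -> W) (x : tensor) : W :=
  tens_eval f (repr x).

Lemma tlift_pi (W : lmodType F) (f : U -> V -> W) s :
  bilinear_map f -> tlift f (\pi_tensor s) = tens_eval f s.
Proof.
move=> hf; rewrite /tlift; have : tens_rel (repr (\pi_tensor s)) s.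
  by apply/(@eqmodP _ tens_equiv); rewrite reprK.
by move/asboolP; apply.
Qed.

Lemma tensor_ext (x y : tensor) :
  (forall (W : lmodType F) (f : U -> V -> W),
     bilinear_map f -> tlift f x = tlift f y) -> x = y.
Proof.
move=> h; rewrite -[x]reprK -[y]reprK.
by apply/(@eqmodP _ tens_equiv)/asboolP.
Qed.

Definition tadd (x y : tensor) : tensor := \pi_tensor (repr x ++ repr y).
Definition topp (x : tensor) : tensor :=
  \pi_tensor [seq (- p.1, p.2) | p <- repr x].
Definition tscale (a : F) (x : tensor) : tensor :=
  \pi_tensor [seq (a *: p.1, p.2) | p <- repr x].
Definition tzero : tensor := \pi_tensor [::].

Section Ops.
Variables (W : lmodType F) (f : U -> V -> W).
Hypothesis hf : bilinear_map f.

Let fZ a u v : f (a *: u) v = a *: f u v.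
Proof. exact: (GRing.scalable_linear (proj1 hf v)). Qed.

Fact tlift_add x y : tlift f (tadd x y) = tlift f x + tlift f y.
Proof. by rewrite tlift_pi // /tens_eval big_cat. Qed.

Fact tlift_scale a x : tlift f (tscale a x) = a *: tlift f x.
Proof.
rewrite tlift_pi // /tlift /tens_eval big_map scaler_sumr.
by apply: eq_bigr => p _; rewrite fZ.
Qed.

Fact tlift_opp x : tlift f (topp x) = - tlift f x.
Proof.
rewrite tlift_pi // /tlift /tens_eval big_map -sumrN.
by apply: eq_bigr => p _ /=; rewrite -[- p.1]scaleN1r fZ scaleN1r.
Qed.

Fact tlift_zero : tlift f tzero = 0.
Proof. by rewrite tlift_pi // /tens_eval big_nil. Qed.

End Ops.

Fact taddA : associative tadd.
Proof. by move=> x y z; apply: tensor_ext => W f hf; rewrite !tlift_add // addrA. Qed.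
Fact taddC : commutative tadd.
Proof. by move=> x y; apply: tensor_ext => W f hf; rewrite !tlift_add // addrC. Qed.
Fact tadd0 : left_id tzero tadd.
Proof.
by move=> x; apply: tensor_ext => W f hf; rewrite tlift_add // tlift_zero // add0r.
Qed.
Fact taddN : left_inverse tzero topp tadd.
Proof.
move=> x; apply: tensor_ext => W f hf.
by rewrite tlift_add // tlift_opp // addNr tlift_zero.
Qed.

HB.instance Definition _ := GRing.isZmodule.Build tensor taddA taddC tadd0 taddN.

Fact tscaleA a b x : tscale a (tscale b x) = tscale (a * b) x.
Proof. by apply: tensor_ext => W f hf; rewrite !tlift_scale // scalerA. Qed.
Fact tscale1 : left_id 1 tscale.
Proof. by move=> x; apply: tensor_ext => W f hf; rewrite tlift_scale // scale1r. Qed.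
Fact tscaleDr : right_distributive tscale +%R.
Proof.
move=> a x y; apply: tensor_ext => W f hf.
by rewrite tlift_scale // !tlift_add // !tlift_scale // scalerDr.
Qed.
Fact tscaleDl x : {morph tscale^~ x : a b / a + b}.
Proof.
move=> a b; apply: tensor_ext => W f hf.
by rewrite tlift_scale // !tlift_add // !tlift_scale // scalerDl.
Qed.

HB.instance Definition _ :=
  GRing.Zmodule_isLmodule.Build F tensor tscaleA tscale1 tscaleDr tscaleDl.

Definition tens (u : U) (v : V) : tensor := \pi_tensor [:: (u, v)].

Lemma tlift_tens (W : lmodType F) (f : U -> V -> W) u v :
  bilinear_map f -> tlift f (tens u v) = f u v.
Proof. by move=> hf; rewrite tlift_pi // /tens_eval big_seq1. Qed.

Lemma tlift_linear (W : lmodType F) (f : U -> V -> W) :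
  bilinear_map f -> linear (tlift f).
Proof. by move=> hf a x y; rewrite tlift_add // tlift_scale. Qed.

Lemma tens_bilinear : bilinear_map tens.
Proof.
split=> [v a u u'|u a v v']; apply: tensor_ext => W f hf.
  by rewrite tlift_linear // !tlift_tens // (proj1 hf v).
by rewrite tlift_linear // !tlift_tens // (proj2 hf u).
Qed.

Lemma tensor_sum (x : tensor) : x = \sum_(p <- repr x) tens p.1 p.2.
Proof.
apply: tensor_ext => W f hf.
pose g : {linear tensor -> W} :=
  HB.pack (tlift f) (GRing.isLinear.Build _ _ _ _ (tlift f) (tlift_linear hf)).
rewrite -[RHS]/(g _) linear_sum; apply: eq_bigr => p _.
by rewrite /= tlift_tens.
Qed.

Lemma tlift_param (P W : lmodType F) (f : P -> U -> V -> W) (x : tensor) :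
  (forall u v, linear (fun p => f p u v)) -> linear (fun p => tlift (f p) x).
Proof.
move=> hf a p q; rewrite /tlift /tens_eval scaler_sumr -big_split /=.
by apply: eq_bigr => i _; rewrite hf.
Qed.

Lemma tensor_linear_ext (W : lmodType F) (f g : {linear tensor -> W}) :
  (forall u v, f (tens u v) = g (tens u v)) -> f =1 g.
Proof.
move=> fg x; rewrite [x]tensor_sum !linear_sum.
by apply: eq_bigr => p _.
Qed.

End Tensor.

Arguments tensor {F} U V.
Arguments tens {F U V} u v.
Arguments tlift {F U V W} f x.

Notation "U ⊗ V" := (tensor U V) (at level 40, left associativity).
Notation "u \ox v" := (tens u v) (at level 40, left associativity) : ring_scope.

(* Sweedler notation: E is summed over the simple tensors u \ox v making up x. *)
Reserved Notation "\tsum_ ( u \ox v <- x ) E"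
  (at level 41, E at level 41, u name, v name, x at level 50,
   format "'[' \tsum_ ( u  \ox  v  <-  x ) '/  '  E ']'").
Notation "\tsum_ ( u \ox v <- x ) E" := (tlift (fun u v => E) x) : ring_scope.

Section TensorMaps.
Variable F : fieldType.
Implicit Types U V W X : lmodType F.

Section Tmap.
Variables (U U' V V' : lmodType F) (f : {linear U -> U'}) (g : {linear V -> V'}).
Definition tmap (x : U ⊗ V) : U' ⊗ V' := \tsum_(u \ox v <- x) (f u \ox g v).
Fact tmap_bilinear : bilinear_map (fun u v => f u \ox g v).
Proof.
by split=> [v a u u'|u a v v'] /=; rewrite linearP;
  [rewrite (proj1 (tens_bilinear _ _))|rewrite (proj2 (tens_bilinear _ _))].
Qed.
HB.instance Definition _ :=
  GRing.isLinear.Build F (U ⊗ V) (U' ⊗ V') _ tmap (tlift_linear tmap_bilinear).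
Lemma tmapE u v : tmap (u \ox v) = f u \ox g v.
Proof. by rewrite /tmap tlift_tens //; exact: tmap_bilinear. Qed.
End Tmap.

Section Tswap.
Variables (U V : lmodType F).
Definition tswap (x : U ⊗ V) : V ⊗ U := \tsum_(u \ox v <- x) (v \ox u).
Fact tswap_bilinear : bilinear_map (fun (u : U) (v : V) => v \ox u).
Proof.
split=> [v a u u'|u a v v'] /=;
  [exact: (proj2 (tens_bilinear _ _))|exact: (proj1 (tens_bilinear _ _))].
Qed.
HB.instance Definition _ :=
  GRing.isLinear.Build F (U ⊗ V) (V ⊗ U) _ tswap (tlift_linear tswap_bilinear).
Lemma tswapE u v : tswap (u \ox v) = v \ox u.
Proof. by rewrite /tswap tlift_tens //; exact: tswap_bilinear. Qed.
End Tswap.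

Section Tassoc.
Variables (U V W : lmodType F).
Definition tassoc (x : (U ⊗ V) ⊗ W) : U ⊗ (V ⊗ W) :=
  \tsum_(y \ox w <- x) \tsum_(u \ox v <- y) (u \ox (v \ox w)).
Fact tassoc_bilinear0 (w : W) : bilinear_map (fun (u : U) (v : V) => u \ox (v \ox w)).
Proof.
split=> [v a u u'|u a v v'] /=; first exact: (proj1 (tens_bilinear _ _)).
by rewrite (proj1 (tens_bilinear _ _)) (proj2 (tens_bilinear _ _)).
Qed.
Fact tassoc_bilinear :
  bilinear_map (fun (y : U ⊗ V) (w : W) => \tsum_(u \ox v <- y) (u \ox (v \ox w))).
Proof.
split=> [w|y]; first exact: tlift_linear (tassoc_bilinear0 w).
apply: tlift_param => u v a w w' /=.
by rewrite !(proj2 (tens_bilinear _ _)).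
Qed.
HB.instance Definition _ :=
  GRing.isLinear.Build F ((U ⊗ V) ⊗ W) (U ⊗ (V ⊗ W)) _ tassoc
    (tlift_linear tassoc_bilinear).
Lemma tassocE u v w : tassoc (u \ox v \ox w) = u \ox (v \ox w).
Proof.
rewrite /tassoc tlift_tens; last exact: tassoc_bilinear.
by rewrite tlift_tens //; exact: tassoc_bilinear0.
Qed.
End Tassoc.

Section Tinter.
Variables (U V U' V' : lmodType F).
Definition tinter (x : (U ⊗ V) ⊗ (U' ⊗ V')) : (U ⊗ U') ⊗ (V ⊗ V') :=
  \tsum_(y \ox y' <- x) \tsum_(u \ox v <- y) \tsum_(u' \ox v' <- y')
    ((u \ox u') \ox (v \ox v')).
Fact tinter_bilinear0 (u : U) (v : V) :
  bilinear_map (fun (u' : U') (v' : V') =>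
    (u \ox u') \ox (v \ox v') : (U ⊗ U') ⊗ (V ⊗ V')).
Proof.
split=> [v' a u' u''|u' a v' v''] /=.
  by rewrite (proj2 (tens_bilinear _ _)) (proj1 (tens_bilinear _ _)).
by rewrite !(proj2 (tens_bilinear _ _)).
Qed.
Fact tinter_bilinear1 (y' : U' ⊗ V') :
  bilinear_map (fun (u : U) (v : V) =>
    \tsum_(u' \ox v' <- y') ((u \ox u') \ox (v \ox v'))).
Proof.
split=> [v|u]; apply: tlift_param => u' v' a z z' /=.
  by rewrite !(proj1 (tens_bilinear _ _)).
by rewrite (proj1 (tens_bilinear _ _)) (proj2 (tens_bilinear _ _)).
Qed.
Fact tinter_bilinear :
  bilinear_map (fun (y : U ⊗ V) (y' : U' ⊗ V') =>
    \tsum_(u \ox v <- y) \tsum_(u' \ox v' <- y') ((u \ox u') \ox (v \ox v'))).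
Proof.
split=> [y'|y]; first exact: tlift_linear (tinter_bilinear1 y').
by apply: tlift_param => u v; exact: tlift_linear (tinter_bilinear0 u v).
Qed.
HB.instance Definition _ :=
  GRing.isLinear.Build F ((U ⊗ V) ⊗ (U' ⊗ V')) ((U ⊗ U') ⊗ (V ⊗ V')) _ tinter
    (tlift_linear tinter_bilinear).
Lemma tinterE u v u' v' : tinter ((u \ox v) \ox (u' \ox v')) = (u \ox u') \ox (v \ox v').
Proof.
rewrite /tinter tlift_tens; last exact: tinter_bilinear.
rewrite tlift_tens; last exact: tinter_bilinear1.
by rewrite tlift_tens //; exact: tinter_bilinear0.
Qed.
End Tinter.

End TensorMaps.

Section Subspaces.
Variable F : fieldType.

Definition subsp (V : lmodType F) (P : submodClosed V) : Type := {x : V | x \in P}.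
HB.instance Definition _ V P := SubChoice.on (@subsp V P).
HB.instance Definition _ V P := [SubChoice_isSubLmodule of @subsp V P by <:].

End Subspaces.

Section LinearExtension.
Variables (F : fieldType) (V A B : lmodType F).
Variables (i : {linear V -> A}) (f : {linear V -> B}).

Local Open Scope classical_set_scope.

Lemma linear_extension_exists :
  injective i -> exists g : {linear A -> B}, forall v, g (i v) = f v.
Proof.
move=> inj_i.
pose good (G : set (A * B)) :=
  [/\ forall v, G (i v, f v),
      forall a x y, G x -> G y -> G (a *: x.1 + y.1, a *: x.2 + y.2)
    & forall b, G (0, b) -> b = 0].
have [|G [PG maxG]] := @Zorn_bigcup _ (fun G => G = set0 \/ good G).
  move=> C CP Ctot.
  have [[G0 [CG0 G0good]]|nogood] := pselect (exists G, C G /\ good G); last first.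
    left; apply/seteqP; split=> // x [G CG Gx]; have [G0|Gg] := CP _ CG.
      by move: Gx; rewrite /= G0.
    by apply: nogood; exists G.
  right; split=> [v|a x y [G CG Gx] [H CH Hy]|b [G CG Gb]].
  - by exists G0 => //; case: G0good.
  - have [GH|HG] := Ctot _ _ CG CH.
      exists H => //; have [HE|[_ + _]] := CP _ CH; first by move: Hy; rewrite HE.
      by apply=> //; exact: GH.
    exists G => //; have [GE|[_ + _]] := CP _ CG; first by move: Gx; rewrite GE.
    by apply=> //; exact: HG.
  - by have [GE|[_ _ +]] := CP _ CG; [move: Gb; rewrite GE|apply].
have base_good : good [set p | exists v, p = (i v, f v)].
  split=> [v|a _ _ [v ->] [w ->]|b [v [i0 ->]]]; first by exists v.
    by exists (a *: v + w); rewrite !linearP.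
  by rewrite (_ : v = 0) ?linear0 //; apply: inj_i; rewrite linear0.
have {PG} [Gb GL G0] : good G.
  case: PG => // G0; exfalso; apply: (maxG [set p | exists v, p = (i v, f v)]).
    split=> [p|/(_ (i 0, f 0))]; first by rewrite G0.
    by rewrite G0; apply; exists 0.
  by right.
have G00 : G (0, 0) by have := Gb 0; rewrite !linear0.
have Gfun a b b' : G (a, b) -> G (a, b') -> b = b'.
  move=> Gab Gab'; apply/eqP; rewrite -subr_eq0; apply/eqP/G0.
  have := GL (-1) _ _ Gab' Gab; rewrite /= !scaleN1r.
  by rewrite addNr [- _ + _]addrC.
have Gdom a : exists b, G (a, b).
  apply: contrapT => nGa.
  pose H := [set p : A * B | exists x y k, G (x, y) /\ p = (x + k *: a, y)].
  apply: (maxG H).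
    split=> [[x y] Gxy|HG]; first by exists x, y, 0; rewrite scale0r addr0.
    apply: nGa; exists 0; apply: HG; exists 0, 0, 1.
    by rewrite scale1r add0r.
  right; split=> [v|c _ _ [x [y [k [Gxy ->]]]] [x' [y' [k' [Gxy' ->]]]]|b].
  - by exists (i v), (f v), 0; rewrite scale0r addr0.
  - exists (c *: x + x'), (c *: y + y'), (c * k + k'); split.
      exact: (GL c _ _ Gxy Gxy').
    by rewrite /= scalerDr scalerDl scalerA addrACA.
  - move=> [x [y [k [Gxy [xk ->]]]]].
    have [k0|k0] := eqVneq k 0.
      by apply: G0; move: Gxy; rewrite xk k0 scale0r addr0.
    exfalso; apply: nGa; exists (- k^-1 *: y).
    have := GL (- k^-1) _ _ Gxy G00; rewrite /= !addr0.
    suff -> : - k^-1 *: x = a by [].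
    move/esym/eqP: xk; rewrite addr_eq0 => /eqP ->.
    by rewrite scalerN scaleNr opprK scalerA mulVf // scale1r.
pose g a := projT1 (cid (Gdom a)).
have Gg a : G (a, g a) by rewrite /g; case: cid.
have g_lin : linear g.
  by move=> k a b; apply: (Gfun (k *: a + b)) => //; exact: (GL k _ _ (Gg a) (Gg b)).
pose gl : {linear A -> B} := HB.pack g (GRing.isLinear.Build _ _ _ _ g g_lin).
by exists gl => v; apply: (Gfun (i v)).
Qed.

(* Some linear map g with g \o i = f; there is one as soon as i is injective.  *)
Definition lext : {linear A -> B} :=
  if pselect (exists g : {linear A -> B}, forall v, g (i v) = f v) is left h
  then projT1 (cid h) else \0.

Lemma lextE v : injective i -> lext (i v) = f v.
Proof.
move=> /linear_extension_exists h; rewrite /lext.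
by case: pselect => // h'; case: cid.
Qed.

End LinearExtension.

Section Cotensor.
Variables (F : fieldType) (S X Y : lmodType F).

(* The image of X ⊗ P in X ⊗ Y, for a subspace P of Y.  *)
Definition tens_sub (P : {pred Y}) : {pred X ⊗ Y} := fun z =>
  `[< exists2 s : seq (X * Y),
        all (fun p => p.2 \in P) s & z = \sum_(p <- s) p.1 \ox p.2 >].

Fact tens_sub_closed (P : {pred Y}) : submod_closed (tens_sub P).
Proof.
split=> [|a z w /asboolP [s sP ->] /asboolP [t tP ->]]; apply/asboolP.
  by exists [::]; rewrite ?big_nil.
exists ([seq (a *: p.1, p.2) | p <- s] ++ t).
  by rewrite all_cat tP andbT all_map.
rewrite big_cat big_map scaler_sumr; congr (_ + _).
apply: eq_bigr => p _ /=.
exact/esym/(GRing.scalable_linear (proj1 (@tens_bilinear _ X Y) p.2)).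
Qed.

Variables (rho : {linear X -> X ⊗ S}) (lam : {linear Y -> S ⊗ Y}).

Definition cotens_pred : {pred X ⊗ Y} := fun z =>
  tassoc (tmap rho idfun z) == tmap idfun lam z.

Fact cotens_closed : submod_closed cotens_pred.
Proof.
split=> [|a z w /eqP hz /eqP hw]; rewrite unfold_in; first by rewrite !linear0.
by rewrite !linearP /= hz hw.
Qed.
HB.instance Definition _ :=
  GRing.isSubmodClosed.Build F (X ⊗ Y) cotens_pred cotens_closed.

Definition cotens : submodClosed (X ⊗ Y) := cotens_pred.

End Cotensor.

Section Coalgebras.
Variable F : fieldType.

Record coalgebra := Coalgebra {
  coalg_space :> lmodType F;
  comul : {linear coalg_space -> coalg_space ⊗ coalg_space};
  counit : {linear coalg_space -> F^o};
  comulA : forall x,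
    tassoc (tmap comul idfun (comul x)) = tmap idfun comul (comul x);
  counitl : forall x, \tsum_(a \ox b <- comul x) (counit a *: b) = x;
  counitr : forall x, \tsum_(a \ox b <- comul x) (counit b *: a) = x
}.

Definition is_coalg_hom (C D : coalgebra) (f : {linear C -> D}) : Prop :=
  (forall x, comul D (f x) = tmap f f (comul C x)) /\
  (forall x, counit D (f x) = counit C x).

Definition left_comodule (C : coalgebra) (M : lmodType F)
    (lam : {linear M -> C ⊗ M}) : Prop :=
  (forall m, tassoc (tmap (comul C) idfun (lam m)) = tmap idfun lam (lam m)) /\
  (forall m, \tsum_(c \ox x <- lam m) (counit C c *: x) = m).

Definition right_comodule (C : coalgebra) (M : lmodType F)
    (rho : {linear M -> M ⊗ C}) : Prop :=
  (forall m, tassoc (tmap rho idfun (rho m)) = tmap idfun (comul C) (rho m)) /\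
  (forall m, \tsum_(x \ox c <- rho m) (counit C c *: x) = m).

Section Cop.
Variable C : coalgebra.

Let cop_comul : {linear C -> C ⊗ C} := @tswap _ C C \o comul C.

Fact counit_bilinear (U : lmodType F) :
  bilinear_map (fun (a : C) (b : U) => counit C a *: b).
Proof.
split=> [b k a a'|a k b b'] /=; first by rewrite linearP scalerDl scalerA.
by rewrite scalerDr !scalerA mulrC.
Qed.

Fact counit_bilinear' (U : lmodType F) :
  bilinear_map (fun (b : U) (a : C) => counit C a *: b).
Proof.
by split=> [a k b b'|b]; [exact: (proj2 (counit_bilinear U) a)
                         |exact: (proj1 (counit_bilinear U) b)].
Qed.

Fact tlift_swap (U V W : lmodType F) (f : U -> V -> W) (x : V ⊗ U) :
  bilinear_map f -> tlift f (tswap x) = tlift (fun v u => f u v) x.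
Proof.
move=> hf.
have hf' : bilinear_map (fun v u => f u v) by case: hf.
pose g : {linear U ⊗ V -> W} :=
  HB.pack (tlift f) (GRing.isLinear.Build _ _ _ _ (tlift f) (tlift_linear hf)).
pose g' : {linear V ⊗ U -> W} := HB.pack (tlift (fun v u => f u v))
  (GRing.isLinear.Build _ _ _ _ (tlift (fun v u => f u v)) (tlift_linear hf')).
rewrite -[LHS]/((g \o @tswap _ V U) x) -[RHS]/(g' x).
apply: tensor_linear_ext => v u /=.
by rewrite tswapE !tlift_tens.
Qed.

Fact cop_comulA x :
  tassoc (tmap cop_comul idfun (cop_comul x)) =
  tmap idfun cop_comul (cop_comul x).
Proof.
have E1 (y : C ⊗ C) : tmap cop_comul idfun y =
    tmap (@tswap _ C C) idfun (tmap (comul C) idfun y).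
  pose f := [the {linear _ -> _} of tmap cop_comul (@idfun C)].
  pose g := [the {linear _ -> _} of
    tmap (@tswap _ C C) (@idfun C) \o tmap (comul C) (@idfun C)].
  rewrite -[LHS]/(f y) -[RHS]/(g y); apply: tensor_linear_ext => a b /=.
  by rewrite !tmapE.
have E2 (y : C ⊗ C) : tmap idfun cop_comul (tswap y) =
    tmap idfun (@tswap _ C C) (tswap (tmap (comul C) idfun y)).
  pose f := [the {linear _ -> _} of tmap (@idfun C) cop_comul \o @tswap _ C C].
  pose g := [the {linear _ -> _} of
    tmap (@idfun C) (@tswap _ C C) \o @tswap _ _ _ \o tmap (comul C) (@idfun C)].
  rewrite -[LHS]/(f y) -[RHS]/(g y); apply: tensor_linear_ext => a b /=.
  by rewrite !(tmapE, tswapE).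
have E3 (y : C ⊗ C) : tmap (comul C) idfun (tswap y) =
    tswap (tmap idfun (comul C) y).
  pose f := [the {linear _ -> _} of tmap (comul C) (@idfun C) \o @tswap _ C C].
  pose g := [the {linear _ -> _} of @tswap _ _ _ \o tmap (@idfun C) (comul C)].
  rewrite -[LHS]/(f y) -[RHS]/(g y); apply: tensor_linear_ext => a b /=.
  by rewrite !(tmapE, tswapE).
rewrite E1 /cop_comul /= E2 E3 -comulA.
move: (tmap (comul C) idfun (comul C x)) => y.
pose f := [the {linear _ -> _} of
  @tassoc _ C C C \o tmap (@tswap _ C C) (@idfun C) \o @tswap _ _ _ \o @tassoc _ C C C].
pose g := [the {linear _ -> _} of
  tmap (@idfun C) (@tswap _ C C) \o @tswap _ (C ⊗ C) C].
rewrite -[LHS]/(f y) -[RHS]/(g y); apply: tensor_linear_ext => z c.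
pose tc : {linear C ⊗ C -> (C ⊗ C) ⊗ C} := HB.pack (fun z : C ⊗ C => z \ox c)
  (GRing.isLinear.Build _ _ _ _ (fun z : C ⊗ C => z \ox c)
    (proj1 (tens_bilinear _ _) c)).
pose fc := [the {linear _ -> _} of f \o tc].
pose gc := [the {linear _ -> _} of g \o tc].
rewrite -[LHS]/(fc z) -[RHS]/(gc z); apply: tensor_linear_ext => a b /=.
by rewrite /fc /gc /f /g /= !(tassocE, tswapE, tmapE) /= !(tassocE, tswapE).
Qed.

Fact cop_counitl x : \tsum_(a \ox b <- cop_comul x) (counit C a *: b) = x.
Proof. by rewrite /= tlift_swap ?counitr //; exact: counit_bilinear. Qed.

Fact cop_counitr x : \tsum_(a \ox b <- cop_comul x) (counit C b *: a) = x.
Proof. by rewrite /= tlift_swap ?counitl //; exact: counit_bilinear'. Qed.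

Definition cop : coalgebra := Coalgebra cop_comulA cop_counitl cop_counitr.

End Cop.
End Coalgebras.

Section Bicoalgebroids.
Variables (F : fieldType) (S : coalgebra F).

Record bicoalgebroid_base := BicoalgebroidBase {
  bb_coalg :> coalgebra F;
  alpha : {linear bb_coalg -> S};
  beta : {linear bb_coalg -> S};
  alpha_hom : is_coalg_hom alpha;
  beta_hom : is_coalg_hom (D := cop S) beta;
  alpha_beta : forall h,
    \tsum_(a \ox b <- comul bb_coalg h) (alpha a \ox beta b) =
    \tsum_(a \ox b <- comul bb_coalg h) (alpha b \ox beta a)
}.

Section BaseCoactions.
Variable K : bicoalgebroid_base.

(* h |-> alpha(h1) ⊗ h2 *)
Definition lcoS : {linear K -> S ⊗ K} := tmap (alpha K) idfun \o comul K.
(* h |-> h2 ⊗ beta(h1) *)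
Definition rcoS : {linear K -> K ⊗ S} :=
  @tswap _ S K \o tmap (beta K) idfun \o comul K.
(* h |-> beta(h1) ⊗ h2, over the co-opposite of S *)
Definition lcoScop : {linear K -> S ⊗ K} := tmap (beta K) idfun \o comul K.
(* h |-> h1 ⊗ beta(h2), over the co-opposite of S *)
Definition rcoScop : {linear K -> K ⊗ S} := tmap idfun (beta K) \o comul K.

End BaseCoactions.

Record bicoalgebroid_ops := BicoalgebroidOps {
  bo_base :> bicoalgebroid_base;
  bo_mul : {linear subsp (cotens (rcoS bo_base) (lcoS bo_base)) -> bo_base};
  eta : {linear S -> bo_base}
}.

(* The product is only given on K □_S K.  To apply it to two factors of a
   longer tensor it is extended linearly to K ⊗ K; on tensors of (K □_S K) ⊗ W
   the outcome does not depend on the extension, and the axioms below only use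
   such tensors.  The same device is used for nu^-1 and for module actions.  *)
Definition pmul (K : bicoalgebroid_ops) : {linear K ⊗ K -> K} :=
  lext [the {linear _ -> _} of val] (bo_mul K).
Definition bmul (K : bicoalgebroid_ops) (g h : K) : K := pmul K (g \ox h).

Local Notation "g ∙ h" := (bmul g h) (at level 40, left associativity).

(* X □ Y □ Z in X ⊗ (Y ⊗ Z), for X □ Y and Y □ Z given by (rX, lY) and
   (rY, lZ) *)
Definition cotens3 (X Y Z : lmodType F)
    (rX : {linear X -> X ⊗ S}) (lY : {linear Y -> S ⊗ Y})
    (rY : {linear Y -> Y ⊗ S}) (lZ : {linear Z -> S ⊗ Z}) :
    {pred X ⊗ (Y ⊗ Z)} := fun w =>
  (w \in tens_sub (cotens rY lZ)) &&
  (w \in cotens rX (@tassoc _ S Y Z \o tmap lY idfun)).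

Record bicoalgebroid_axioms (K : bicoalgebroid_ops) : Prop :=
    BicoalgebroidAxioms {
  mul_lcoS : forall z, z \in cotens (rcoS K) (lcoS K) ->
    lcoS K (\tsum_(g \ox h <- z) (g ∙ h)) =
    \tsum_(g \ox h <- z) \tsum_(g1 \ox g2 <- comul K g)
      (alpha K g1 \ox (g2 ∙ h));
  mul_rcoS : forall z, z \in cotens (rcoS K) (lcoS K) ->
    rcoS K (\tsum_(g \ox h <- z) (g ∙ h)) =
    \tsum_(g \ox h <- z) \tsum_(h1 \ox h2 <- comul K h)
      ((g ∙ h2) \ox beta K h1);
  mul_assoc : forall w, w \in cotens3 (rcoS K) (lcoS K) (rcoS K) (lcoS K) ->
    \tsum_(g \ox y <- w) \tsum_(h \ox l <- y) ((g ∙ h) ∙ l) =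
    \tsum_(g \ox y <- w) \tsum_(h \ox l <- y) (g ∙ (h ∙ l));
  eta_lcoS : forall c, lcoS K (eta K c) = tmap idfun (eta K) (comul S c);
  eta_rcoS : forall c, rcoS K (eta K c) = tmap (eta K) idfun (comul S c);
  mul_alpha_beta : forall z, z \in cotens (rcoS K) (lcoS K) ->
    \tsum_(g \ox h <- z) \tsum_(h1 \ox h2 <- comul K h)
      ((g ∙ h1) \ox alpha K h2) =
    \tsum_(g \ox h <- z) \tsum_(g1 \ox g2 <- comul K g)
      ((g1 ∙ h) \ox beta K g2);
  comul_mul : forall z, z \in cotens (rcoS K) (lcoS K) ->
    comul K (\tsum_(g \ox h <- z) (g ∙ h)) =
    \tsum_(g \ox h <- z)
      \tsum_(g1 \ox g2 <- comul K g) \tsum_(h1 \ox h2 <- comul K h)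
        ((g1 ∙ h1) \ox (g2 ∙ h2));
  counit_mul : forall z, z \in cotens (rcoS K) (lcoS K) ->
    counit K (\tsum_(g \ox h <- z) (g ∙ h)) =
    \tsum_(g \ox h <- z) (counit K g * counit K h : F^o);
  eta_alphaK : forall h,
    \tsum_(h1 \ox h2 <- comul K h) (eta K (alpha K h1) ∙ h2) = h;
  eta_betaK : forall h,
    \tsum_(h1 \ox h2 <- comul K h) (h2 ∙ eta K (beta K h1)) = h;
  comul_eta_alpha : forall c,
    comul K (eta K c) =
    \tsum_(e1 \ox e2 <- comul K (eta K c)) (e1 \ox eta K (alpha K e2));
  comul_eta_beta : forall c,
    comul K (eta K c) =
    \tsum_(e1 \ox e2 <- comul K (eta K c)) (e1 \ox eta K (beta K e2));
  counit_eta : forall c, counit K (eta K c) = counit S c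
}.

Record left_bicoalgebroid := LeftBicoalgebroid {
  lb_ops :> bicoalgebroid_ops;
  lb_axioms : bicoalgebroid_axioms lb_ops
}.

Section Nu.
Variable K : bicoalgebroid_ops.

Fact nu_bilinear : bilinear_map (fun k k' : K =>
  \tsum_(a \ox b <- comul K k') ((k ∙ a) \ox b)).
Proof.
have tl (b : K) : linear (fun a : K => a \ox b) := proj1 (tens_bilinear K K) b.
split=> [k' | k].
  apply: tlift_param => a b c x y.
  by rewrite /bmul (proj1 (tens_bilinear _ _)) linearP tl.
have hf : bilinear_map (fun a b : K => (k ∙ a) \ox b).
  split=> [b c x y|a]; last exact: (proj2 (tens_bilinear _ _)).
  by rewrite /bmul (proj2 (tens_bilinear _ _)) linearP tl.
by move=> c x y; rewrite linearP (tlift_linear hf).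
Qed.

Definition nu (z : K ⊗ K) : K ⊗ K :=
  \tsum_(k \ox k' <- z) \tsum_(a \ox b <- comul K k') ((k ∙ a) \ox b).

HB.instance Definition _ :=
  GRing.isLinear.Build F (K ⊗ K) (K ⊗ K) _ nu (tlift_linear nu_bilinear).

(* nu^-1 on nu (K □_S K), extended to K ⊗ K *)
Definition nuinv : {linear K ⊗ K -> K ⊗ K} :=
  let incl : {linear subsp (cotens (rcoS K) (lcoS K)) -> K ⊗ K} := val in
  lext (nu \o incl) incl.

End Nu.

Record hopf_coalgebra := HopfCoalgebra {
  hc_bicoalgebroid :> left_bicoalgebroid;
  nu_bij : set_bij [set` cotens (rcoS hc_bicoalgebroid) (lcoS hc_bicoalgebroid)]
    [set` cotens (rcoScop hc_bicoalgebroid) (lcoScop hc_bicoalgebroid)]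
    (nu (K := hc_bicoalgebroid))
}.

Section Modules.

Record module_ops (K : left_bicoalgebroid) := ModuleOps {
  mo_space :> lmodType F;
  mo_lcoS : {linear mo_space -> S ⊗ mo_space};
  act : {linear subsp (cotens (rcoS K) mo_lcoS) -> mo_space}
}.

Definition pact (K : left_bicoalgebroid) (M : module_ops K) :
    {linear K ⊗ M -> M} :=
  lext [the {linear _ -> _} of val] (act M).
Definition bact (K : left_bicoalgebroid) (M : module_ops K) (k : K) (m : M) : M :=
  pact M (k \ox m).

Local Notation "k ▷ m" := (bact k m) (at level 41, right associativity).

Record module_axioms (K : left_bicoalgebroid) (M : module_ops K) : Prop :=
    ModuleAxioms {
  mo_left_comodule : left_comodule (mo_lcoS M);
  act_assoc : forall w, w \in cotens3 (rcoS K) (lcoS K) (rcoS K) (mo_lcoS M) ->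
    \tsum_(g \ox y <- w) \tsum_(h \ox m <- y) ((g ∙ h) ▷ m) =
    \tsum_(g \ox y <- w) \tsum_(h \ox m <- y) (g ▷ (h ▷ m));
  act_unit : forall m, \tsum_(c \ox x <- mo_lcoS M m) (eta K c ▷ x) = m;
  act_lcoS : forall z, z \in cotens (rcoS K) (mo_lcoS M) ->
    mo_lcoS M (\tsum_(k \ox m <- z) (k ▷ m)) =
    \tsum_(k \ox m <- z) \tsum_(k1 \ox k2 <- comul K k)
      (alpha K k1 \ox (k2 ▷ m))
}.

Record left_module (K : left_bicoalgebroid) := LeftModule {
  lm_ops :> module_ops K;
  lm_axioms : module_axioms lm_ops
}.

Definition canonical_rcoS (K : left_bicoalgebroid) (M : left_module K) (m : M) :
    M ⊗ S :=
  \tsum_(c \ox x <- mo_lcoS M m) \tsum_(e1 \ox e2 <- comul K (eta K c))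
    ((e1 ▷ x) \ox alpha K e2).

Record module_comodule (K : left_bicoalgebroid) := ModuleComodule {
  mc_module :> left_module K;
  mc_rco : {linear mc_module -> mc_module ⊗ K};
  mc_right_comodule : right_comodule mc_rco
}.

Definition induced_rcoS (K : left_bicoalgebroid) (M : module_comodule K) :
    {linear M -> M ⊗ S} :=
  tmap idfun (beta K) \o mc_rco M.

(* Equation [ayd_compat] involves the partial operations ▷ and ∙.  That both
   of its sides are defined for every m ⊗ k in M □_Scop K is part of the
   condition, and is spelled out in [ayd_defl], [ayd_defr1], [ayd_defr2].  *)
Record ayd_axioms (K : hopf_coalgebra) (M : module_comodule K) : Prop :=
    AydAxioms {
  ayd_coactions : forall m, induced_rcoS M m = canonical_rcoS m;
  ayd_defl : forall z, z \in cotens (induced_rcoS M) (lcoScop K) ->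
    tswap z \in cotens (rcoS K) (mo_lcoS M);
  ayd_defr1 : forall z, z \in cotens (induced_rcoS M) (lcoScop K) ->
    \tsum_(m \ox k <- z)
      \tsum_(m0 \ox m1 <- mc_rco M m) \tsum_(k1 \ox k2 <- comul K k)
        \tsum_(n \ox p <- nuinv K (m1 \ox k1)) ((k2 \ox n) \ox (p \ox m0))
    \in tens_sub (cotens (rcoS K) (mo_lcoS M));
  ayd_defr2 : forall z, z \in cotens (induced_rcoS M) (lcoScop K) ->
    \tsum_(m \ox k <- z)
      \tsum_(m0 \ox m1 <- mc_rco M m) \tsum_(k1 \ox k2 <- comul K k)
        \tsum_(n \ox p <- nuinv K (m1 \ox k1)) ((p ▷ m0) \ox (k2 \ox n))
    \in tens_sub (cotens (rcoS K) (lcoS K));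
  ayd_compat : forall z, z \in cotens (induced_rcoS M) (lcoScop K) ->
    mc_rco M (\tsum_(m \ox k <- z) (k ▷ m)) =
    \tsum_(m \ox k <- z)
      \tsum_(m0 \ox m1 <- mc_rco M m) \tsum_(k1 \ox k2 <- comul K k)
        \tsum_(n \ox p <- nuinv K (m1 \ox k1)) ((p ▷ m0) \ox (k2 ∙ n))
}.

Record ayd_module (K : hopf_coalgebra) := AydModule {
  ayd_mc :> module_comodule K;
  ayd_ax : ayd_axioms ayd_mc
}.

Definition stable (K : hopf_coalgebra) (M : ayd_module K) : Prop :=
  forall m, \tsum_(m0 \ox m1 <- mc_rco M m) (m1 ▷ m0) = m.

End Modules.

Section ComoduleCoalgebras.

Record comodule_coalgebra (K : left_bicoalgebroid) := ComoduleCoalgebra {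
  cc_coalg :> coalgebra F;
  cc_lco : {linear cc_coalg -> K ⊗ cc_coalg};
  cc_left_comodule : left_comodule cc_lco;
  cc_counit : forall t,
    \tsum_(k \ox x <- cc_lco t) (counit cc_coalg x *: k) =
    \tsum_(k \ox x <- cc_lco t) (counit cc_coalg x *: eta K (alpha K k));
  cc_comul : forall t,
    \tsum_(k \ox x <- cc_lco t) (k \ox comul cc_coalg x) =
    \tsum_(t1 \ox t2 <- comul cc_coalg t)
      \tsum_(a \ox x <- cc_lco t1) \tsum_(b \ox y <- cc_lco t2)
        ((a ∙ b) \ox (x \ox y));
  cc_cotens : forall t,
    \tsum_(t1 \ox t2 <- comul cc_coalg t) \tsum_(a \ox x <- cc_lco t1)
      (beta K a \ox (x \ox t2)) =
    \tsum_(t1 \ox t2 <- comul cc_coalg t) \tsum_(b \ox y <- cc_lco t2)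
      (alpha K b \ox (t1 \ox y))
}.

Variables (K : left_bicoalgebroid) (T : comodule_coalgebra K).

Definition cc_lcoS : {linear T -> S ⊗ T} := tmap (alpha K) idfun \o cc_lco T.
Definition cc_rcoS : {linear T -> T ⊗ S} :=
  @tswap _ S T \o tmap (beta K) idfun \o cc_lco T.

(* T^{⊗ (n+1)}, bracketed to the right *)
Fixpoint tpow (n : nat) : lmodType F :=
  if n is n'.+1 then (T ⊗ tpow n' : lmodType F) else T.

Definition tpow_lcoS (n : nat) : {linear tpow n -> S ⊗ tpow n} :=
  match n with
  | 0 => cc_lcoS
  | n'.+1 => @tassoc _ S T (tpow n') \o tmap cc_lcoS idfun
  end.

(* T^{□_S (n+1)}, as a subspace of T^{⊗ (n+1)} *)
Fixpoint cotpow (n : nat) : {pred tpow n} :=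
  match n with
  | 0 => predT
  | n'.+1 => [pred x : T ⊗ tpow n' |
      (x \in tens_sub (@cotpow n')) && (x \in cotens cc_rcoS (tpow_lcoS n'))]
  end.

Fixpoint tpow_lco (n : nat) : {linear tpow n -> K ⊗ tpow n} :=
  match n with
  | 0 => cc_lco T
  | n'.+1 => tmap (pmul K) idfun \o @tinter _ K T K (tpow n') \o
               tmap (cc_lco T) (tpow_lco n')
  end.


Definition tpow_comul : forall n, nat -> tpow n -> tpow n.+1 :=
  fix D n i := match n, i return tpow n -> tpow n.+1 with
  | 0, _ => fun t => comul T t
  | n'.+1, 0 => fun x => \tsum_(t \ox y <- x) tassoc (comul T t \ox y)
  | n'.+1, i'.+1 => fun x => \tsum_(t \ox y <- x) (t \ox D n' i' y)
  end.

(* t_0 ⊗ .. ⊗ t_(n+1) |-> t_0 ⊗ .. ⊗ counit(t_(i+1)) ⊗ .. ⊗ t_(n+1) *)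
Definition tpow_counit : forall n, nat -> tpow n.+1 -> tpow n :=
  fix E n i := match n, i return tpow n.+1 -> tpow n with
  | 0, _ => fun x => \tsum_(t \ox u <- x) (counit T u *: t)
  | n'.+1, 0 => fun x => \tsum_(t \ox y <- x)
      (t \ox tlift (fun (u : T) (y' : tpow n') => counit T u *: y') y)
  | n'.+1, i'.+1 => fun x => \tsum_(t \ox y <- x) (t \ox E n' i' y)
  end.

Definition tpow_rcons : forall n, tpow n -> T -> tpow n.+1 :=
  fix A n := match n return tpow n -> T -> tpow n.+1 with
  | 0 => fun t u => t \ox u
  | n'.+1 => fun x u => \tsum_(t \ox y <- x) (t \ox A n' y u)
  end.

End ComoduleCoalgebras.

Section Cochains.
Variables (K : hopf_coalgebra) (T : comodule_coalgebra K) (M : ayd_module K).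

Local Notation "k ▷ m" := (bact k m) (at level 41, right associativity).

(* M □_K T^{□_S (n+1)}, as a subspace of M ⊗ T^{⊗ (n+1)} *)
Definition cochain_pred (n : nat) : {pred M ⊗ tpow T n} := fun z =>
  (z \in tens_sub (@cotpow _ T n)) && (z \in cotens (mc_rco M) (tpow_lco T n)).

Fact cochain_closed n : submod_closed (@cochain_pred n).
Proof.
have [z0 zP] := tens_sub_closed M (@cotpow _ T n).
have [w0 wP] := cotens_closed (mc_rco M) (tpow_lco T n).
split=> [|a z w /andP[z1 z2] /andP[w1 w2]]; rewrite unfold_in; first exact/andP.
by apply/andP; split; [exact: zP|exact: wP].
Qed.
HB.instance Definition _ n :=
  GRing.isSubmodClosed.Build F (M ⊗ tpow T n) (@cochain_pred n)
    (@cochain_closed n).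

Definition cochain (n : nat) : lmodType F := subsp (@cochain_pred n).

Definition cochain_incl (n : nat) : {linear cochain n -> M ⊗ tpow T n} :=
  [the {linear subsp (@cochain_pred n) -> _} of val].

Definition coface n (i : nat) (z : M ⊗ tpow T n) : M ⊗ tpow T n.+1 :=
  \tsum_(m \ox x <- z) (m \ox tpow_comul i x).

(* [tpow_comul 0] turns t_0 ⊗ .. ⊗ t_n into t_0^(1) ⊗ (t_0^(2) ⊗ t_1 ⊗ ..).  *)
Definition coface_last n (z : M ⊗ tpow T n) : M ⊗ tpow T n.+1 :=
  \tsum_(m \ox x <- z) \tsum_(a \ox y <- tpow_comul 0 x)
    \tsum_(k \ox y' <- tpow_lco T n y) ((k ▷ m) \ox tpow_rcons y' a).

Definition codegeneracy n (i : nat) (z : M ⊗ tpow T n.+1) : M ⊗ tpow T n :=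
  \tsum_(m \ox x <- z) (m \ox tpow_counit i x).

Definition cyclic_op n : M ⊗ tpow T n -> M ⊗ tpow T n :=
  match n with
  | 0 => idfun
  | n'.+1 => fun z =>
      \tsum_(m \ox x <- z) \tsum_(t0 \ox y <- x)
        \tsum_(k \ox y' <- tpow_lco T n' y) ((k ▷ m) \ox tpow_rcons y' t0)
  end.

End Cochains.
End Bicoalgebroids.

Arguments cochain_incl {F S K T M n}.

(* d n i : C n -> C n.+1 is meant for i <= n.+1 and s n i : C n.+1 -> C n for
   i <= n; nothing is asserted outside these ranges.  *)
Record is_cocyclic (F : fieldType) (C : nat -> lmodType F)
    (d : forall n, nat -> {linear C n -> C n.+1})
    (s : forall n, nat -> {linear C n.+1 -> C n})
    (t : forall n, {linear C n -> C n}) : Prop := IsCocyclic {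
  coface_coface : forall n i j x, (i < j <= n.+2)%N ->
    d n.+1 j (d n i x) = d n.+1 i (d n j.-1 x);
  codeg_codeg : forall n i j x, (i <= j <= n)%N ->
    s n j (s n.+1 i x) = s n i (s n.+1 j.+1 x);
  codeg_coface_lt : forall n i j x, (i < j <= n.+1)%N ->
    s n.+1 j (d n.+1 i x) = d n i (s n j.-1 x);
  codeg_coface_id : forall n i j x, (j <= n)%N -> (i == j) || (i == j.+1) ->
    s n j (d n i x) = x;
  codeg_coface_gt : forall n i j x, (j.+1 < i <= n.+2)%N ->
    s n.+1 j (d n.+1 i x) = d n i.-1 (s n j x);
  cyclic_coface : forall n i x, (0 < i <= n.+1)%N ->
    t n.+1 (d n i x) = d n i.-1 (t n x);
  cyclic_coface0 : forall n x, t n.+1 (d n 0 x) = d n n.+1 x;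
  cyclic_codeg : forall n i x, (0 < i <= n)%N ->
    t n (s n i x) = s n i.-1 (t n.+1 x);
  cyclic_codeg0 : forall n x, t n (s n 0 x) = s n n (t n.+1 (t n.+1 x));
  cyclic_order : forall n x, iter n.+1 (t n) x = x
}.

(* Main.v *)
Require Import Defs.
From HB Require Import structures.
From mathcomp Require Import all_boot all_order all_algebra.
From mathcomp Require Import boolp classical_sets functions.
From mathcomp Require Import reals complex.

Set Implicit Arguments.
Unset Strict Implicit.
Unset Printing Implicit Defensive.

Import GRing.Theory.
Local Open Scope ring_scope.
Local Notation eta := Defs.eta.

(* Let u_n move the last factor t_n to the front and act with its coaction:
   u_n(m (x) t_0 (x) ... (x) t_n) = t_n<-1> |> m (x) t_n<0> (x) t_0 (x) ... (x) t_(n-1).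
   By associativity of the action the cyclic operator is u_n^n, and u_n^(n+1) acts with the
   coaction of the whole of t_0 (x) ... (x) t_n, i.e. with m<1> on m<0>, hence is the identity
   by stability.  With e killing t_0, the relations u d_i = d_(i+1) u, u s_i = s_(i+1) u and
   s_0 u = u e hold on arbitrary tensors, so the cocyclic identities reduce to u_n^(n+1) = 1 and
   to the evident simplicial identities, and it is enough that u, d_0 and e preserve cochains.
   For u this is the anti-Yetter-Drinfeld condition: on a rotated cochain m<1> is a product b a
   with a = t_n<-1>, and nu^-1 (b a^(1) (x) a^(2)) = b (x) a. *)

(** * Sums over tensors *)

(** The product of K, its action on M and the inverse of nu exist only on cotensor products; [bmul],
    [bact] and [nuinv] are linear extensions chosen arbitrarily, and no axiom speaks about their
    other values. So no axiom may be applied to an isolated pair of factors of a Sweedler sum. The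
    recurring argument collects the factors that an axiom concerns in the last place of a tensor and
    all others in front of them, shows that the result lies in [tens_sub] of a cotensor product,
    that is in A ⊗ (X □ Y), and applies the axiom there by [tens_sub_eq]. Over a field, tensoring
    with A preserves equalizers, so such a membership can be verified as an equation between sums
    ([tens_cotensI]). Rotating a single factor keeps this manageable, since one factor acts without
    any product in K. The partial operations remain defined all around the circle because the left
    S-coaction of M is given by [alpha] as well as by [beta] of m<1> ([tsum_lam_alpha],
    [tsum_lam_beta]): the first rests on stability, the second on the definedness part of the
    anti-Yetter-Drinfeld condition. *)

Section Linearity.
Variables (F : fieldType).
Implicit Types U V W X : lmodType F.

Definition trilinear_map U V W X (f : U -> V -> W -> X) : Prop :=
  [/\ forall v w, linear (fun u => f u v w), forall u w, linear (fun v => f u v w)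
    & forall u v, linear (fun w => f u v w)].

Lemma linear_idfun V : linear (fun x : V => x).
Proof. by []. Qed.

Lemma linear_apply U V W (L : {linear V -> W}) (g : U -> V) :
  linear g -> linear (fun x => L (g x)).
Proof. by move=> hg a x y; rewrite hg linearP. Qed.

Lemma linear_app_fun U V W (f : V -> W) (g : U -> V) :
  linear f -> linear g -> linear (fun x => f (g x)).
Proof. by move=> hf hg a x y; rewrite hg hf. Qed.

Lemma linear_tensl U V W (g : U -> V) (w : W) :
  linear g -> linear (fun x => g x \ox w).
Proof. by move=> hg a x y; rewrite hg (proj1 (tens_bilinear _ _)). Qed.

Lemma linear_tensr U V W (g : U -> V) (w : W) :
  linear g -> linear (fun x => w \ox g x).
Proof. by move=> hg a x y; rewrite hg (proj2 (tens_bilinear _ _)). Qed.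

Lemma linear_tlift U V W X (f : V -> W -> X) (g : U -> V ⊗ W) :
  bilinear_map f -> linear g -> linear (fun x => tlift f (g x)).
Proof. by move=> hf hg a x y; rewrite hg (tlift_linear hf). Qed.

Lemma linear_scalel U V (g : U -> F^o) (v : V) :
  linear g -> linear (fun x => (g x : F) *: v).
Proof. by move=> hg a x y; rewrite hg scalerDl scalerA. Qed.

Lemma linear_scaler U V (g : U -> V) (c : F) :
  linear g -> linear (fun x => c *: g x).
Proof. by move=> hg a x y; rewrite hg scalerDr !scalerA mulrC. Qed.

Lemma bmul_bilinear (S : coalgebra F) (K : bicoalgebroid_ops S) :
  bilinear_map (@bmul F S K).
Proof.
by split=> v a x y; rewrite /bmul ?(proj1 (tens_bilinear _ _))
  ?(proj2 (tens_bilinear _ _)) linearP.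
Qed.

Lemma linear_bmull U (S : coalgebra F) (K : bicoalgebroid_ops S) (g : U -> K) (k : K) :
  linear g -> linear (fun x => bmul (g x) k).
Proof. by move=> hg a x y; rewrite hg (proj1 (bmul_bilinear K)). Qed.

Lemma linear_bmulr U (S : coalgebra F) (K : bicoalgebroid_ops S) (g : U -> K) (k : K) :
  linear g -> linear (fun x => bmul k (g x)).
Proof. by move=> hg a x y; rewrite hg (proj2 (bmul_bilinear K)). Qed.

Lemma bact_bilinear (S : coalgebra F) (K : left_bicoalgebroid S) (M : module_ops K) :
  bilinear_map (@bact F S K M).
Proof.
by split=> v a x y; rewrite /bact ?(proj1 (tens_bilinear _ _))
  ?(proj2 (tens_bilinear _ _)) linearP.
Qed.

Lemma linear_bactl U (S : coalgebra F) (K : left_bicoalgebroid S)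
    (M : module_ops K) (g : U -> K) (m : M) :
  linear g -> linear (fun x => bact (g x) m).
Proof. by move=> hg a x y; rewrite hg (proj1 (bact_bilinear M)). Qed.

Lemma linear_bactr U (S : coalgebra F) (K : left_bicoalgebroid S)
    (M : module_ops K) (g : U -> M) (k : K) :
  linear g -> linear (fun x => bact k (g x)).
Proof. by move=> hg a x y; rewrite hg (proj2 (bact_bilinear M)). Qed.

End Linearity.

Create HintDb mlin.

(** Linearity is proved by recursion on the shape of the map. In each bilinear operation the
    variable may occur in one argument only, which the patterns [fun _ => ?c] detect. Functions
    defined by recursion on the degree enter through the hint database or as linear instances. *)
Ltac mlin :=
  cbv beta;
  lazymatch goal with
  | |- forall _, _ => intro; mlin
  | |- bilinear_map _ => split; intro; mlin
  | |- trilinear_map _ => split; intros ? ?; mlin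
  | |- linear (fun x => x) => exact: linear_idfun
  | |- linear (fun x => tens (@?f x) (@?g x)) =>
    lazymatch f with
    | fun _ => ?c => apply: (@linear_tensr _ _ _ _ g c); mlin
    | _ => lazymatch g with fun _ => ?c => apply: (@linear_tensl _ _ _ _ f c); mlin end
    end
  | |- linear (fun x => bmul (@?f x) (@?g x)) =>
    lazymatch f with
    | fun _ => ?c => apply: (linear_bmulr (g := g)); mlin
    | _ => lazymatch g with fun _ => ?c => apply: (linear_bmull (g := f)); mlin end
    end
  | |- linear (fun x => bact (@?f x) (@?g x)) =>
    lazymatch f with
    | fun _ => ?c => apply: (linear_bactr (g := g)); mlin
    | _ => lazymatch g with fun _ => ?c => apply: (linear_bactl (g := f)); mlin end
    end
  | |- linear (fun x => tlift (@?f x) (@?g x)) =>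
    lazymatch f with
    | fun _ => ?c => apply: (linear_tlift (f := c) (g := g)); mlin
    | _ => lazymatch g with fun _ => ?c => apply: (@tlift_param _ _ _ _ _ f c); mlin end
    end
  | |- linear (fun x => GRing.scale (@?f x) (@?g x)) =>
    lazymatch f with
    | fun _ => ?c => apply: (linear_scaler (g := g)); mlin
    | _ => lazymatch g with fun _ => ?c => apply: (linear_scalel (g := f)); mlin end
    end
  | |- linear (fun x => idfun (@?g x)) => change (linear g); mlin
  | |- linear (tlift ?f) => change (linear (fun x => tlift f x)); mlin
  | |- linear (tens ?u) => change (linear (fun x => tens u x)); mlin
  | |- linear (bmul ?k) => change (linear (fun x => bmul k x)); mlin
  | |- linear (bact ?k) => change (linear (fun x => bact k x)); mlin
  | |- linear (fun x => @GRing.Linear.sort _ _ _ _ ?L (@?g x)) =>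
      apply: (linear_apply L (g := g)); mlin
  | |- _ => first
    [ mlin_atom
    | lazymatch goal with |- linear (fun x => ?f (@?g x) (@?h x)) =>
        lazymatch h with fun _ => ?c =>
          apply: (@linear_app_fun _ _ _ _ (fun y => f y c) g); [mlin_atom | mlin] end end
    | lazymatch goal with |- linear (fun x => ?f (@?g x)) =>
        apply: (@linear_app_fun _ _ _ _ f g); [mlin_atom | mlin] end ]
  end
with mlin_atom := first
  [ eassumption
  | exact: linearP
  | match goal with
    | H : bilinear_map _ |- _ => first [exact: (proj1 H) | exact: (proj2 H)]
    | H : trilinear_map _ |- _ => case: H => *; solve [eauto]
    end
  | solve [eauto with mlin] ].

Section TensorSums.
Variable F : fieldType.
Implicit Types A B U V W X : lmodType F.

Lemma eq_tlift U V W (f g : U -> V -> W) (x : U ⊗ V) :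
  (forall u v, f u v = g u v) -> tlift f x = tlift g x.
Proof. by move=> fg; apply: eq_bigr => p _; exact: fg. Qed.

Lemma tlift_exchange A B U V W (f : A -> B -> U -> V -> W) (x : A ⊗ B) (y : U ⊗ V) :
  \tsum_(a \ox b <- x) \tsum_(u \ox v <- y) f a b u v =
  \tsum_(u \ox v <- y) \tsum_(a \ox b <- x) f a b u v.
Proof. exact: exchange_big. Qed.

Lemma linear_sum_fun V W (f : V -> W) (I : Type) (r : seq I) (g : I -> V) :
  linear f -> f (\sum_(i <- r) g i) = \sum_(i <- r) f (g i).
Proof.
move=> hf; pose L : {linear V -> W} := HB.pack f (GRing.isLinear.Build _ _ _ _ f hf).
exact: (linear_sum L).
Qed.

Lemma linear_tsum U V W X (L : W -> X) (f : U -> V -> W) (x : U ⊗ V) :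
  linear L -> L (tlift f x) = \tsum_(u \ox v <- x) L (f u v).
Proof. by move=> hL; rewrite /tlift /tens_eval linear_sum_fun. Qed.

Lemma tlift_tlift A B U V W (f : U -> V -> W) (g : A -> B -> U ⊗ V) (x : A ⊗ B) :
  bilinear_map f -> tlift f (tlift g x) = \tsum_(a \ox b <- x) tlift f (g a b).
Proof. by move=> hf; apply: linear_tsum; exact: tlift_linear. Qed.

Lemma linear_eq U V W (f g : U ⊗ V -> W) (x : U ⊗ V) :
  linear f -> linear g -> (forall u v, f (u \ox v) = g (u \ox v)) -> f x = g x.
Proof.
move=> hf hg fg.
pose f' : {linear U ⊗ V -> W} := HB.pack f (GRing.isLinear.Build _ _ _ _ f hf).
pose g' : {linear U ⊗ V -> W} := HB.pack g (GRing.isLinear.Build _ _ _ _ g hg).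
exact: (@tensor_linear_ext _ _ _ _ f' g').
Qed.

End TensorSums.

(** Generalizes [x] in the goal and replaces it by a simple tensor, both sides being linear in it.
    Hypotheses on [x] say nothing about the simple tensors, so this serves only for identities that
    hold on all tensors. *)
Ltac tens_ext x :=
  let y := fresh in move: (x) => y; pattern y;
  lazymatch goal with
  | |- (fun z => @eq _ (@?f z) (@?g z)) _ =>
    refine (@linear_eq _ _ _ _ f g y _ _ _); [mlin | mlin | clear y; cbv beta]
  end.

Section SweedlerSums.
Variable F : fieldType.
Implicit Types A B C U V W : lmodType F.

Lemma tlift_id U V (x : U ⊗ V) : \tsum_(u \ox v <- x) (u \ox v) = x.
Proof. by rewrite [RHS]tensor_sum. Qed.

Lemma tlift_tmap A B U V W (f : U -> V -> W) (g : {linear A -> U}) (h : {linear B -> V})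
    (x : A ⊗ B) :
  bilinear_map f -> tlift f (tmap g h x) = \tsum_(a \ox b <- x) f (g a) (h b).
Proof.
move=> hf; rewrite /tmap tlift_tlift //.
by apply: eq_tlift => a b; rewrite tlift_tens.
Qed.

Lemma tlift_tassoc A B C W (f : A -> B ⊗ C -> W) (x : A ⊗ B ⊗ C) :
  bilinear_map f ->
  tlift f (tassoc x) = \tsum_(y \ox c <- x) \tsum_(a \ox b <- y) f a (b \ox c).
Proof.
move=> hf; rewrite /tassoc tlift_tlift //; apply: eq_tlift => y c.
by rewrite tlift_tlift //; apply: eq_tlift => a b; rewrite tlift_tens.
Qed.

Lemma tlift_tswap A B W (f : B -> A -> W) (x : A ⊗ B) :
  bilinear_map f -> tlift f (tswap x) = \tsum_(a \ox b <- x) f b a.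
Proof. exact: tlift_swap. Qed.

(** Packs a Sweedler context as one linear map on the right-bracketed product, so that
    [tsum_coassoc] can apply it to both sides of an equation between tensors. *)
Lemma trilinear_tens A B C W (f : A -> B -> C -> W) : trilinear_map f ->
  exists2 L : {linear A ⊗ (B ⊗ C) -> W}, forall a b c, f a b c = L (a \ox (b \ox c))
    & forall a (v : B ⊗ C), \tsum_(b \ox c <- v) f a b c = L (a \ox v).
Proof.
move=> [h1 h2 h3].
have hf a : bilinear_map (f a) by split.
have hg : bilinear_map (fun a (v : B ⊗ C) => tlift (f a) v).
  split=> [v|a]; last exact: tlift_linear.
  exact: (@tlift_param _ _ _ _ _ f v).
pose L : {linear A ⊗ (B ⊗ C) -> W} := HB.pack (tlift (fun a v => tlift (f a) v))
  (GRing.isLinear.Build _ _ _ _ _ (tlift_linear hg)).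
exists L => [a b c|a v]; rewrite /L /= tlift_tens //.
by rewrite tlift_tens.
Qed.

(* Equations of the shape of coassociativity (or of the cotensor condition) are only used
   in this Sweedler form, valid in any trilinear context. *)
Lemma tsum_coassoc A B C U V W (g : {linear U -> A ⊗ B}) (h : {linear V -> B ⊗ C})
    (x : U ⊗ C) (y : A ⊗ V) (f : A -> B -> C -> W) :
  tassoc (tmap g idfun x) = tmap idfun h y -> trilinear_map f ->
  \tsum_(u \ox c <- x) \tsum_(a \ox b <- g u) f a b c =
  \tsum_(a \ox v <- y) \tsum_(b \ox c <- h v) f a b c.
Proof.
move=> E /trilinear_tens [L fL1 fL2].
transitivity (L (tassoc (tmap g idfun x))).
  transitivity (\tsum_(u \ox c <- x) \tsum_(a \ox b <- g u) L (a \ox (b \ox c))).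
    by apply: eq_tlift => u c; apply: eq_tlift.
  tens_ext x => u c.
  rewrite tlift_tens; last by mlin.
  rewrite tmapE /=.
  tens_ext (g u) => a b.
  by rewrite tlift_tens ?tassocE //; mlin.
rewrite E; transitivity (\tsum_(a \ox v <- y) L (a \ox h v)); last exact: eq_tlift.
tens_ext y => a v.
by rewrite tlift_tens ?tmapE //; mlin.
Qed.

End SweedlerSums.

(** * Slices, and tensors whose last factor lies in a subspace *)

Section Subspaces.
Variable F : fieldType.
Implicit Types A B C U V W X Y : lmodType F.

(** The identity of [P] extends along the inclusion of [P], by the Zorn argument of
    [linear_extension_exists]. *)
Lemma subspace_projector V (P : {pred V}) : submod_closed P ->
  exists2 e : {linear V -> V}, forall v, e v \in P & forall v, v \in P -> e v = v.
Proof.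
move=> cP.
pose P' : submodClosed V := HB.pack P (GRing.isSubmodClosed.Build F V P cP).
pose i : {linear subsp P' -> V} := [the {linear _ -> _} of val].
have [p pK] := linear_extension_exists (idfun : {linear subsp P' -> subsp P'}) (@val_inj _ _ (subsp P')).
exists (i \o p) => [v|v vP] /=; first exact: (proj2_sig (p v)).
have /= -> := pK (exist _ v vP : subsp P').
by [].
Qed.

Lemma tensDr A B (a : A) (b c : B) : a \ox (b + c) = a \ox b + a \ox c.
Proof. by have := proj2 (tens_bilinear A B) a 1 b c; rewrite !scale1r. Qed.

Lemma tens0r A B (a : A) : a \ox (0 : B) = 0.
Proof. by apply: (addrI (a \ox (0 : B))); rewrite -tensDr !addr0. Qed.

Lemma tensZl A B k (a : A) (b : B) : (k *: a) \ox b = k *: (a \ox b).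
Proof. exact: (GRing.scalable_linear (proj1 (tens_bilinear A B) b)). Qed.

Lemma tensZr A B k (a : A) (b : B) : a \ox (k *: b) = k *: (a \ox b).
Proof. exact: (GRing.scalable_linear (proj2 (tens_bilinear A B) a)). Qed.

(* Slices by functionals detect zero, and membership in [tens_sub P]: this transports the
   axioms, stated on cotensor products, to a context with further tensor factors. *)
Definition slice A B (phi : {linear A -> F^o}) (x : A ⊗ B) : B :=
  \tsum_(a \ox b <- x) ((phi a : F) *: b).

Lemma slice_linear A B (phi : {linear A -> F^o}) : linear (@slice A B phi).
Proof. by rewrite /slice; mlin. Qed.

HB.instance Definition _ A B (phi : {linear A -> F^o}) :=
  GRing.isLinear.Build F (A ⊗ B) B _ (slice phi) (@slice_linear A B phi).

Lemma slice_tens A B (phi : {linear A -> F^o}) a (b : B) :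
  slice phi (a \ox b) = (phi a : F) *: b.
Proof. by rewrite /slice tlift_tens //; mlin. Qed.

Lemma separating_functional A r (a : A) (f : nat -> A) :
  (exists2 phi : {linear A -> F^o}, phi a = 1 & forall i, (i < r)%N -> phi (f i) = 0) \/
  (exists c : nat -> F, a = \sum_(i < r) c i *: f i).
Proof.
pose P : {pred A} := fun v => `[< exists c : nat -> F, v = \sum_(i < r) c i *: f i >].
have cP : submod_closed P.
  split=> [|k _ _ /asboolP[c ->] /asboolP[d ->]]; apply/asboolP.
    by exists (fun=> 0); rewrite big1 // => i _; rewrite scale0r.
  exists (fun i => k * c i + d i); rewrite scaler_sumr -big_split.
  by apply: eq_bigr => i _; rewrite scalerDl scalerA.
have [e eP eid] := subspace_projector cP.
have [/eqP ea|ea] := boolP (e a == a); [right|left].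
  by have /asboolP := eP a; rewrite ea.
(* The functional is prescribed on the line through [a - e a], which is nonzero here. Composed with
   [id - e], it takes the value 1 at [a] and vanishes on the span. *)
have [//|phi phiE] := @linear_extension_exists F F^o A F^o
    (HB.pack (fun k : F^o => (k : F) *: (a - e a)) (GRing.isLinear.Build _ F^o _ _
      (fun k : F^o => (k : F) *: (a - e a)) (linear_scalel _ (@linear_idfun _ F^o)))) idfun.
  move=> k l /= /eqP; rewrite -subr_eq0 -scalerBl scaler_eq0 subr_eq0.
  by rewrite subr_eq0 [a == _]eq_sym (negPf ea) orbF => /eqP.
pose q := [the {linear A -> A} of idfun \- e].
exists (phi \o q) => [|i ir] /=.
  by have /= := phiE 1; rewrite scale1r.
rewrite /= eid ?subrr ?linear0 //; apply/asboolP.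
exists (fun j => (j == i)%:R); rewrite (bigD1 (Ordinal ir)) //= eqxx scale1r.
by rewrite big1 ?addr0 // => j; rewrite -val_eqE /= => /negPf ->; rewrite scale0r.
Qed.

(** Induction on the number of simple tensors. If the last left factor is separated from the others,
    its right factor is a slice and vanishes; otherwise it is a combination of the others, and the
    sum becomes shorter. *)
Lemma slice_eq0 A B (x : A ⊗ B) : (forall phi, slice phi x = 0) -> x = 0.
Proof.
have [s ->] : exists s : seq (A * B), x = \sum_(p <- s) p.1 \ox p.2.
  by exists (repr x); exact: tensor_sum.
suff main r (f : nat -> A) (g : nat -> B) :
    (forall phi, slice phi (\sum_(i < r) f i \ox g i) = 0) -> \sum_(i < r) f i \ox g i = 0.
  rewrite (big_nth (0, 0)) big_mkord.
  exact: (main _ (fun i => (nth (0, 0) s i).1) (fun i => (nth (0, 0) s i).2)).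
elim: r f g => [|r IHr] f g; first by rewrite big_ord0.
have [[phi phi1 phi0]|[c fr]] := separating_functional r (f r) f => h.
  rewrite big_ord_recr /=.
  have gr : g r = 0.
    have := h phi; rewrite linear_sum big_ord_recr /= slice_tens phi1 scale1r.
    rewrite big1 ?add0r // => i _.
    by rewrite slice_tens phi0 // scale0r.
  have xE : f r \ox g r = 0 by rewrite gr tens0r.
  rewrite xE addr0; apply: (IHr f g) => psi.
  by have := h psi; rewrite big_ord_recr /= xE addr0.
have xE : \sum_(i < r.+1) f i \ox g i = \sum_(i < r) f i \ox (g i + c i *: g r).
  rewrite big_ord_recr /= fr.
  rewrite (linear_sum_fun _ _ (proj1 (tens_bilinear A B) (g r))) -big_split /=.
  apply: eq_bigr => i _.
  by rewrite tensDr tensZl tensZr.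
rewrite xE; apply: (IHr f (fun i => g i + c i *: g r)) => phi.
by rewrite -xE.
Qed.

Lemma slice_eq A B (x y : A ⊗ B) : (forall phi, slice phi x = slice phi y) -> x = y.
Proof.
move=> xy; apply/eqP; rewrite -subr_eq0; apply/eqP/slice_eq0 => phi.
by rewrite linearB /= xy subrr.
Qed.

Lemma slice_tmap A B C (f : {linear B -> C}) (x : A ⊗ B) phi :
  slice phi (tmap idfun f x) = f (slice phi x).
Proof. by tens_ext x => a b; rewrite tmapE !slice_tens linearZ. Qed.

Lemma slice_tsum A B U V phi (f : U -> V -> A ⊗ B) (x : U ⊗ V) :
  slice phi (tlift f x) = \tsum_(u \ox v <- x) slice phi (f u v).
Proof. by rewrite linear_tsum //; exact: linearP. Qed.

(** A projector [e] onto [P] fixes slices that lie in [P]; then [x] and [tmap idfun e x] have the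
    same slices, hence are equal, and the latter is visibly in A ⊗ P. *)
Lemma tens_subP A B (P : {pred B}) (x : A ⊗ B) : submod_closed P ->
  reflect (forall phi, slice phi x \in P) (x \in tens_sub P).
Proof.
move=> cP; apply: (iffP idP) => [/asboolP[s sP ->] phi|h].
  have [P0 PL] := cP; rewrite linear_sum /= big_seq.
  apply: (big_ind (fun y => y \in P)) => // [y z yP zP|p /(allP sP) pP].
    by rewrite -[y]scale1r; exact: PL.
  by rewrite slice_tens -[_ *: _]addr0; exact: PL.
have [e eP eid] := subspace_projector cP.
have xE : x = tmap idfun e x by apply: slice_eq => phi; rewrite slice_tmap eid.
apply/asboolP; exists [seq (p.1, e p.2) | p <- repr x].
  by apply/allP => _ /mapP[p _ ->] /=.
by rewrite big_map {1}xE.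
Qed.

(** With a cotensor product as [P], this applies an axiom inside a longer sum; [a] collects the
    factors that the axiom leaves alone. *)
Lemma tens_sub_eq A B W (P : {pred B}) (f g : A -> B -> W) (x : A ⊗ B) :
  x \in tens_sub P -> bilinear_map f -> bilinear_map g ->
  (forall a b, b \in P -> f a b = g a b) -> tlift f x = tlift g x.
Proof.
move=> /asboolP[s sP ->] hf hg fg.
rewrite !(linear_sum_fun _ _ (tlift_linear _)) // !big_seq.
by apply: eq_bigr => p /(allP sP) pP; rewrite !tlift_tens ?fg.
Qed.

Lemma tens_sub_tlift A B W (P : {pred B}) (Q : {pred W}) (f : A -> B -> W)
    (x : A ⊗ B) : x \in tens_sub P -> submod_closed Q -> bilinear_map f ->
  (forall a b, b \in P -> f a b \in Q) -> tlift f x \in Q.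
Proof.
move=> /asboolP[s sP ->] [Q0 QL] hf fQ.
rewrite (linear_sum_fun _ _ (tlift_linear hf)) big_seq.
apply: (big_ind (fun y => y \in Q)) => // [y z yP zP|p /(allP sP) pP].
  by rewrite -[y]scale1r; exact: QL.
by rewrite tlift_tens ?fQ.
Qed.

Lemma tens_sub_tsum A B A' B' (P : {pred B}) (Q : {pred B'}) (f : A -> B -> A' ⊗ B')
    (x : A ⊗ B) : x \in tens_sub P -> submod_closed Q -> bilinear_map f ->
  (forall a b, b \in P -> f a b \in tens_sub Q) -> tlift f x \in tens_sub Q.
Proof. by move=> xP cQ; apply: tens_sub_tlift xP _; exact: tens_sub_closed. Qed.

Lemma tens_sub_tens A B (P : {pred B}) (a : A) (b : B) : b \in P -> a \ox b \in tens_sub P.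
Proof.
by move=> bP; apply/asboolP; exists [:: (a, b)]; rewrite /= ?bP // big_seq1.
Qed.

(** Slicing commutes with both maps whose equalizer is the cotensor product, so every slice of [x]
    lies in that equalizer. *)
Lemma tens_cotensP A S X Y (rho : {linear X -> X ⊗ S}) (lam : {linear Y -> S ⊗ Y})
    (x : A ⊗ (X ⊗ Y)) :
  tmap idfun (@tassoc _ X S Y \o tmap rho idfun) x = tmap idfun (tmap idfun lam) x ->
  x \in tens_sub (cotens rho lam).
Proof.
move=> E; apply/tens_subP => [|phi]; first exact: cotens_closed.
by apply/eqP; rewrite -[LHS]/((@tassoc _ X S Y \o tmap rho idfun) _) -!slice_tmap E.
Qed.

End Subspaces.

(* [tnorm] brings both sides of an equation to the form of nested sums over atomic
   tensors, pulling sums out of linear contexts and evaluating them on simple tensors. *)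
Ltac tnf_pull :=
  match goal with
  | |- ?X = _ =>
    match X with
    | context [@tlift ?F ?U ?V ?W ?f ?x] =>
      let X' := eval pattern (@tlift F U V W f x) in X in
      match X' with
      | ?L _ => apply: etrans; [apply: (@linear_tsum _ U V W _ L f x); by mlin | cbv beta]
      end
    end
  end.
Ltac tnf :=
  lazymatch goal with
  | |- @tlift _ _ _ _ _ (@tlift _ _ _ _ _ _) = _ =>
      apply: etrans; [apply: tlift_tlift; by mlin | cbv beta; tnf]
  | |- @tlift _ _ _ _ _ (@tens _ _ _ _ _) = _ =>
      apply: etrans; [apply: tlift_tens; by mlin | cbv beta; tnf]
  | |- @tlift _ _ _ _ _ ?x = _ =>
      first [is_var x; unfold x; tnf | apply: eq_tlift => ? ?; tnf]
  | |- _ => first [tnf_pull; tnf | reflexivity]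
  end.
Ltac tnorm :=
  apply: etrans; [tnf | cbv beta]; symmetry; apply: etrans; [tnf | cbv beta]; symmetry.

(** * Cotensor products, bicoalgebroids and modules *)

Section Cotensor.
Variables (F : fieldType) (A S X Y : lmodType F).
Variables (rho : {linear X -> X ⊗ S}) (lam : {linear Y -> S ⊗ Y}).

Lemma cotensE (W : lmodType F) (f : X -> S -> Y -> W) (x : X ⊗ Y) :
  x \in cotens rho lam -> trilinear_map f ->
  \tsum_(g \ox h <- x) \tsum_(g0 \ox s <- rho g) f g0 s h =
  \tsum_(g \ox h <- x) \tsum_(s \ox h0 <- lam h) f g s h0.
Proof. by move=> /eqP; exact: tsum_coassoc. Qed.

Lemma cotensI (x : X ⊗ Y) :
  \tsum_(g \ox h <- x) \tsum_(g0 \ox s <- rho g) (g0 \ox (s \ox h)) =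
  \tsum_(g \ox h <- x) \tsum_(s \ox h0 <- lam h) (g \ox (s \ox h0)) ->
  x \in cotens rho lam.
Proof.
move=> E; apply/eqP; move: E; congr (_ = _).
  tens_ext x => g h; rewrite tmapE tlift_tens /=; last by mlin.
  by tens_ext (rho g) => g0 s; rewrite tlift_tens ?tassocE //; mlin.
tens_ext x => g h; rewrite tmapE tlift_tens /=; last by mlin.
by tens_ext (lam h) => s h0; rewrite tlift_tens //; mlin.
Qed.

Lemma tens_cotensI (x : A ⊗ (X ⊗ Y)) :
  \tsum_(c \ox p <- x) \tsum_(g \ox h <- p) \tsum_(g0 \ox s <- rho g)
    (c \ox (g0 \ox (s \ox h))) =
  \tsum_(c \ox p <- x) \tsum_(g \ox h <- p) \tsum_(s \ox h0 <- lam h)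
    (c \ox (g \ox (s \ox h0))) ->
  x \in tens_sub (cotens rho lam).
Proof.
move=> E; apply: tens_cotensP; move: E; congr (_ = _).
  tens_ext x => c p; rewrite tmapE tlift_tens /=; last by mlin.
  tens_ext p => g h; rewrite tmapE tlift_tens /=; last by mlin.
  by tens_ext (rho g) => g0 s; rewrite tlift_tens ?tassocE //; mlin.
tens_ext x => c p; rewrite tmapE tlift_tens /=; last by mlin.
tens_ext p => g h; rewrite tmapE tlift_tens /=; last by mlin.
by tens_ext (lam h) => s h0; rewrite tlift_tens //; mlin.
Qed.

End Cotensor.

Section Coalgebra.
Variables (F : fieldType) (C : coalgebra F) (V : lmodType F).

Lemma tsum_comulA (x : C) (f : C -> C -> C -> V) : trilinear_map f ->
  \tsum_(a \ox b <- comul C x) \tsum_(a1 \ox a2 <- comul C a) f a1 a2 b =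
  \tsum_(a \ox b <- comul C x) \tsum_(b1 \ox b2 <- comul C b) f a b1 b2.
Proof. exact/tsum_coassoc/comulA. Qed.

Lemma tsum_counitr (x : C) (f : C -> V) : linear f ->
  \tsum_(a \ox b <- comul C x) ((counit C b : F) *: f a) = f x.
Proof.
move=> hf; rewrite -[in RHS](counitr x) linear_tsum //.
by apply: eq_tlift => a b; rewrite (GRing.scalable_linear hf).
Qed.

End Coalgebra.
Arguments tsum_comulA {F C V x f}.

Section Bicoalgebroid.
Variables (F : fieldType) (S : coalgebra F) (K : left_bicoalgebroid S).
Local Notation "g ∙ h" := (bmul g h) (at level 40, left associativity).
Implicit Types V W A : lmodType F.

Lemma tsum_alpha_comul V (f : S -> S -> V) h : bilinear_map f ->
  tlift f (comul S (alpha K h)) =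
  \tsum_(a \ox b <- comul K h) f (alpha K a) (alpha K b).
Proof. by move=> hf; rewrite (proj1 (alpha_hom K)) tlift_tmap. Qed.

Lemma tsum_alpha_beta V (f : S -> S -> V) (h : K) : bilinear_map f ->
  \tsum_(a \ox b <- comul K h) f (alpha K a) (beta K b) =
  \tsum_(a \ox b <- comul K h) f (alpha K b) (beta K a).
Proof.
move=> hf; transitivity (tlift f (\tsum_(a \ox b <- comul K h) (alpha K a \ox beta K b))).
  by rewrite tlift_tlift //; apply: eq_tlift => a b; rewrite tlift_tens.
rewrite alpha_beta tlift_tlift //.
by apply: eq_tlift => a b; rewrite tlift_tens.
Qed.

Lemma tsum_rcoS V (f : K -> S -> V) g : bilinear_map f ->
  tlift f (rcoS K g) = \tsum_(a \ox b <- comul K g) f b (beta K a).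
Proof.
move=> hf; have hf' : bilinear_map (fun u v => f v u) by case: hf.
by rewrite /rcoS /= tlift_tswap // (tlift_tmap (f := fun u v => f v u)).
Qed.

Lemma tsum_lcoS V (f : S -> K -> V) g : bilinear_map f ->
  tlift f (lcoS K g) = \tsum_(a \ox b <- comul K g) f (alpha K a) b.
Proof. by move=> hf; rewrite /lcoS /= tlift_tmap. Qed.

Lemma tsum_lcoScop V (f : S -> K -> V) g : bilinear_map f ->
  tlift f (lcoScop K g) = \tsum_(a \ox b <- comul K g) f (beta K a) b.
Proof. by move=> hf; rewrite /lcoScop /= tlift_tmap. Qed.

Lemma pmulE (z : K ⊗ K) : \tsum_(g \ox h <- z) (g ∙ h) = pmul K z.
Proof. by tens_ext z => g h; rewrite tlift_tens //; mlin. Qed.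

Section LeftFactor.
Variables (Y : lmodType F) (lam : {linear Y -> S ⊗ Y}).

Lemma cotens_rcoSE W (f : K -> S -> Y -> W) (x : K ⊗ Y) :
  x \in cotens (rcoS K) lam -> trilinear_map f ->
  \tsum_(g \ox h <- x) \tsum_(g1 \ox g2 <- comul K g) f g2 (beta K g1) h =
  \tsum_(g \ox h <- x) \tsum_(s \ox h0 <- lam h) f g s h0.
Proof.
move=> xP hf; rewrite -(cotensE xP) //; apply: eq_tlift => g h.
by rewrite tsum_rcoS //; case: hf => h1 h2 h3; split.
Qed.

Lemma tens_cotens_rcoSI A (x : A ⊗ (K ⊗ Y)) :
  \tsum_(c \ox p <- x) \tsum_(g \ox h <- p) \tsum_(g1 \ox g2 <- comul K g)
    (c \ox (g2 \ox (beta K g1 \ox h))) =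
  \tsum_(c \ox p <- x) \tsum_(g \ox h <- p) \tsum_(s \ox h0 <- lam h)
    (c \ox (g \ox (s \ox h0))) ->
  x \in tens_sub (cotens (rcoS K) lam).
Proof.
move=> E; apply: tens_cotensI; rewrite -E.
apply: eq_tlift => c p; apply: eq_tlift => g h.
by rewrite tsum_rcoS //; mlin.
Qed.

End LeftFactor.

Lemma cotens_mulE W (f : K -> S -> K -> W) (x : K ⊗ K) :
  x \in cotens (rcoS K) (lcoS K) -> trilinear_map f ->
  \tsum_(g \ox h <- x) \tsum_(g1 \ox g2 <- comul K g) f g2 (beta K g1) h =
  \tsum_(g \ox h <- x) \tsum_(h1 \ox h2 <- comul K h) f g (alpha K h1) h2.
Proof.
move=> xP hf; rewrite (cotens_rcoSE xP) //; apply: eq_tlift => g h.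
by rewrite tsum_lcoS //; case: hf => h1 h2 h3; split.
Qed.

Lemma tens_cotens_mulI A (x : A ⊗ (K ⊗ K)) :
  \tsum_(c \ox p <- x) \tsum_(g \ox h <- p) \tsum_(g1 \ox g2 <- comul K g)
    (c \ox (g2 \ox (beta K g1 \ox h))) =
  \tsum_(c \ox p <- x) \tsum_(g \ox h <- p) \tsum_(h1 \ox h2 <- comul K h)
    (c \ox (g \ox (alpha K h1 \ox h2))) ->
  x \in tens_sub (cotens (rcoS K) (lcoS K)).
Proof.
move=> E; apply: tens_cotens_rcoSI; rewrite E.
apply: eq_tlift => c p; apply: eq_tlift => g h.
by rewrite tsum_lcoS //; mlin.
Qed.

Section Products.
Variable z : K ⊗ K.
Hypothesis zP : z \in cotens (rcoS K) (lcoS K).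
Let axK := lb_axioms K.

Lemma counit_pmul : counit K (pmul K z) =
  \tsum_(g \ox h <- z) ((counit K g : F) *: (counit K h : F^o)).
Proof. by rewrite -pmulE (counit_mul axK). Qed.

Lemma tsum_alpha_pmul V (f : S -> K -> V) : bilinear_map f ->
  \tsum_(k1 \ox k2 <- comul K (pmul K z)) f (alpha K k1) k2 =
  \tsum_(g \ox h <- z) \tsum_(g1 \ox g2 <- comul K g) f (alpha K g1) (g2 ∙ h).
Proof.
move=> hf; rewrite -tsum_lcoS // -pmulE (mul_lcoS axK) // tlift_tlift //.
apply: eq_tlift => g h; rewrite tlift_tlift //; apply: eq_tlift => a b.
by rewrite tlift_tens.
Qed.

Lemma tsum_beta_pmul V (f : S -> K -> V) : bilinear_map f ->
  \tsum_(k1 \ox k2 <- comul K (pmul K z)) f (beta K k1) k2 =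
  \tsum_(g \ox h <- z) \tsum_(h1 \ox h2 <- comul K h) f (beta K h1) (g ∙ h2).
Proof.
move=> hf; have hf' : bilinear_map (fun u v => f v u) by case: hf.
rewrite -(tsum_rcoS (f := fun u v => f v u)) //.
rewrite -pmulE (mul_rcoS axK) // tlift_tlift //.
apply: eq_tlift => g h; rewrite tlift_tlift //; apply: eq_tlift => a b.
by rewrite tlift_tens.
Qed.

Lemma tsum_mul_alpha_beta V (f : K -> S -> V) : bilinear_map f ->
  \tsum_(g \ox h <- z) \tsum_(h1 \ox h2 <- comul K h) f (g ∙ h1) (alpha K h2) =
  \tsum_(g \ox h <- z) \tsum_(g1 \ox g2 <- comul K g) f (g1 ∙ h) (beta K g2).
Proof.
move=> hf; have := congr1 (tlift f) (mul_alpha_beta axK zP).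
rewrite !tlift_tlift // => E; move: E; congr (_ = _); apply: eq_tlift => g h;
  rewrite tlift_tlift //; apply: eq_tlift => a b; by rewrite tlift_tens.
Qed.

(** The counit is applied to the second leg of alpha((gh)^(1)) ⊗ (gh)^(2) = alpha(g^(1)) ⊗ g^(2) h.
    Multiplicativity of the counit then needs g^(2) ⊗ h to stay in the cotensor product next to
    alpha(g^(1)), which is [z1P]. *)
Lemma alpha_pmul : alpha K (pmul K z) = \tsum_(g \ox h <- z) ((counit K h : F) *: alpha K g).
Proof.
pose z1 := \tsum_(g \ox h <- z) \tsum_(g1 \ox g2 <- comul K g) (alpha K g1 \ox (g2 \ox h)).
have z1P : z1 \in tens_sub (cotens (rcoS K) (lcoS K)).
  apply: tens_cotens_mulI.
  transitivity (\tsum_(g \ox h <- z) \tsum_(a \ox b <- comul K g)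
     \tsum_(b1 \ox b2 <- comul K b) (alpha K a \ox (b2 \ox (beta K b1 \ox h)))).
    by tnorm.
  (* Exchanging [alpha] and [beta] on neighbouring legs moves [beta] to the outermost leg of [g],
     where the cotensor condition of [z] can be used. *)
  transitivity (\tsum_(g \ox h <- z) \tsum_(a \ox b <- comul K g)
     \tsum_(a1 \ox a2 <- comul K a) (alpha K a2 \ox (b \ox (beta K a1 \ox h)))).
    apply: eq_tlift => g h; rewrite -tsum_comulA; last by mlin.
    apply: eq_tlift => a b.
    by apply: (tsum_alpha_beta (f := fun s t => s \ox (b \ox (t \ox h)))); mlin.
  transitivity (\tsum_(g \ox h <- z) \tsum_(a \ox b <- comul K g)
     \tsum_(b1 \ox b2 <- comul K b) (alpha K b1 \ox (b2 \ox (beta K a \ox h)))).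
    by apply: eq_tlift => g h; apply: tsum_comulA; mlin.
  rewrite (cotens_mulE (f := fun g s h => \tsum_(b1 \ox b2 <- comul K g)
     (alpha K b1 \ox (b2 \ox (s \ox h))))) //; last by mlin.
  tnorm; apply: eq_tlift => g h; exact: tlift_exchange.
transitivity (\tsum_(c \ox q <- z1) ((counit K (pmul K q) : F) *: c)).
  rewrite -(tsum_counitr (pmul K z) (f := alpha K)); last by mlin.
  rewrite (tsum_alpha_pmul (f := fun s k => (counit K k : F) *: s)); last by mlin.
  by tnorm.
transitivity (\tsum_(c \ox q <- z1)
    (((\tsum_(g \ox h <- q) ((counit K g : F) *: (counit K h : F^o))) : F) *: c)).
  apply: (tens_sub_eq z1P) => [||c q qP]; [by mlin|by mlin|].
  by rewrite -pmulE (counit_mul axK).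
transitivity (\tsum_(g \ox h <- z) \tsum_(a \ox b <- comul K g)
   ((counit K b : F) *: ((counit K h : F) *: alpha K a))).
  by tnorm; do 2![apply: eq_tlift => ? ?]; rewrite scalerA.
apply: eq_tlift => g h.
by apply: (tsum_counitr _ (f := fun g => (counit K h : F) *: alpha K g)); mlin.
Qed.

(** Mirror image of [alpha_pmul], from the right colinearity of the product. *)
Lemma beta_pmul : beta K (pmul K z) = \tsum_(g \ox h <- z) ((counit K g : F) *: beta K h).
Proof.
pose z1 := \tsum_(g \ox h <- z) \tsum_(h1 \ox h2 <- comul K h) (beta K h1 \ox (g \ox h2)).
have z1P : z1 \in tens_sub (cotens (rcoS K) (lcoS K)).
  apply: tens_cotens_mulI.
  transitivity (\tsum_(g \ox h <- z) \tsum_(g1 \ox g2 <- comul K g)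
     \tsum_(h1 \ox h2 <- comul K h) (beta K h1 \ox (g2 \ox (beta K g1 \ox h2)))).
    by tnorm; apply: eq_tlift => g h; exact: tlift_exchange.
  rewrite (cotens_mulE (f := fun g s h => \tsum_(h1 \ox h2 <- comul K h)
     (beta K h1 \ox (g \ox (s \ox h2))))) //; last by mlin.
  transitivity (\tsum_(g \ox h <- z) \tsum_(a \ox b <- comul K h)
     \tsum_(a1 \ox a2 <- comul K a) (beta K a2 \ox (g \ox (alpha K a1 \ox b)))).
    by apply: eq_tlift => g h; symmetry; apply: tsum_comulA; mlin.
  transitivity (\tsum_(g \ox h <- z) \tsum_(a \ox b <- comul K h)
     \tsum_(a1 \ox a2 <- comul K a) (beta K a1 \ox (g \ox (alpha K a2 \ox b)))).
    apply: eq_tlift => g h; apply: eq_tlift => a b.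
    by apply: (tsum_alpha_beta (f := fun s t => t \ox (g \ox (s \ox b)))); mlin.
  transitivity (\tsum_(g \ox h <- z) \tsum_(a \ox b <- comul K h)
     \tsum_(b1 \ox b2 <- comul K b) (beta K a \ox (g \ox (alpha K b1 \ox b2)))).
    by apply: eq_tlift => g h; apply: tsum_comulA; mlin.
  by tnorm.
transitivity (\tsum_(c \ox q <- z1) ((counit K (pmul K q) : F) *: c)).
  rewrite -(tsum_counitr (pmul K z) (f := beta K)); last by mlin.
  rewrite (tsum_beta_pmul (f := fun s k => (counit K k : F) *: s)); last by mlin.
  by tnorm.
transitivity (\tsum_(c \ox q <- z1)
    (((\tsum_(g \ox h <- q) ((counit K g : F) *: (counit K h : F^o))) : F) *: c)).
  apply: (tens_sub_eq z1P) => [||c q qP]; [by mlin|by mlin|].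
  by rewrite -pmulE (counit_mul axK).
transitivity (\tsum_(g \ox h <- z) \tsum_(a \ox b <- comul K h)
   ((counit K b : F) *: ((counit K g : F) *: beta K a))).
  by tnorm; do 2![apply: eq_tlift => ? ?]; rewrite scalerA mulrC.
apply: eq_tlift => g h.
by apply: (tsum_counitr _ (f := fun h => (counit K g : F) *: beta K h)); mlin.
Qed.

End Products.

End Bicoalgebroid.

Section Cotensor3.
Variables (F : fieldType) (S : coalgebra F) (A X Y Z : lmodType F).
Variables (rX : {linear X -> X ⊗ S}) (lY : {linear Y -> S ⊗ Y}).
Variables (rY : {linear Y -> Y ⊗ S}) (lZ : {linear Z -> S ⊗ Z}).

Lemma cotens3_closed : submod_closed (cotens3 rX lY rY lZ).
Proof.
have [t0 tL] := tens_sub_closed X (cotens rY lZ).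
have [c0 cL] := cotens_closed rX (@tassoc _ S Y Z \o tmap lY idfun).
split=> [|a x y /andP[x1 x2] /andP[y1 y2]]; first exact/andP.
by apply/andP; split; [exact: tL|exact: cL].
Qed.

(** Each of the two neighbouring cotensor conditions is checked on its own, the remaining factor
    joining [c] in front; this explains the reordering in the second hypothesis. *)
Lemma tens_cotens3I (x : A ⊗ (X ⊗ (Y ⊗ Z))) :
  \tsum_(c \ox p <- x) \tsum_(g \ox q <- p) ((c \ox g) \ox q)
    \in tens_sub (cotens rY lZ) ->
  \tsum_(c \ox p <- x) \tsum_(g \ox q <- p) \tsum_(h \ox l <- q) ((c \ox l) \ox (g \ox h))
    \in tens_sub (cotens rX lY) ->
  x \in tens_sub (cotens3 rX lY rY lZ).
Proof.
move=> x1 x2; apply/tens_subP => [|phi]; first exact: cotens3_closed.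
apply/andP; split.
  have -> : slice phi x = \tsum_(d \ox q <- \tsum_(c \ox p <- x) \tsum_(g \ox q <- p)
      ((c \ox g) \ox q)) (slice phi d \ox q).
    symmetry; tnorm; rewrite /slice; apply: eq_tlift => c p.
    by tens_ext p => g q; rewrite tlift_tens; [rewrite tlift_tens ?tensZl|]; mlin.
  apply: (tens_sub_tsum x1); [exact: cotens_closed|by mlin|].
  by move=> a b bP; exact: tens_sub_tens.
apply/eqP.
transitivity (\tsum_(d \ox p <- \tsum_(c \ox p <- x) \tsum_(g \ox q <- p)
    \tsum_(h \ox l <- q) ((c \ox l) \ox (g \ox h)))
  \tsum_(c \ox l <- d) \tsum_(g \ox h <- p) \tsum_(g0 \ox s <- rX g)
    ((phi c : F) *: (g0 \ox (s \ox (h \ox l))))).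
  rewrite /slice; tens_ext x => c p; rewrite !tlift_tens; [|by mlin..].
  tens_ext p => g q; rewrite !tlift_tens; [|by mlin..].
  tens_ext q => h l; rewrite !tlift_tens; [|by mlin..].
  rewrite -tensZl tmapE linearZ /=.
  by tens_ext (rX g) => g0 s; rewrite tlift_tens -?tensZl ?tassocE //; mlin.
transitivity (\tsum_(d \ox p <- \tsum_(c \ox p <- x) \tsum_(g \ox q <- p)
    \tsum_(h \ox l <- q) ((c \ox l) \ox (g \ox h)))
  \tsum_(c \ox l <- d) \tsum_(g \ox h <- p) \tsum_(s \ox h0 <- lY h)
    ((phi c : F) *: (g \ox (s \ox (h0 \ox l))))).
  apply: (tens_sub_eq x2); [by mlin|by mlin|].
  move=> d p pP; apply: eq_tlift => c l.
  by apply: (cotensE (f := fun g s h => (phi c : F) *: (g \ox (s \ox (h \ox l))))) => //; mlin.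
rewrite /slice; tens_ext x => c p; rewrite !tlift_tens; [|by mlin..].
tens_ext p => g q; rewrite !tlift_tens; [|by mlin..].
tens_ext q => h l; rewrite !tlift_tens; [|by mlin..].
rewrite linearZ /= tmapE /= tmapE /=.
tens_ext (lY h) => s h0; rewrite tlift_tens ?tassocE //; by mlin.
Qed.

End Cotensor3.

Section Module.
Variables (F : fieldType) (S : coalgebra F) (K : left_bicoalgebroid S).
Local Notation "g ∙ h" := (bmul g h) (at level 40, left associativity).
Local Notation "k ▷ m" := (bact k m) (at level 41, right associativity).
Implicit Types V W A : lmodType F.
Let axK := lb_axioms K.

Lemma tsum_mul_assoc A W (x : A ⊗ (K ⊗ (K ⊗ K))) (f : A -> K -> W) : bilinear_map f ->
  x \in tens_sub (cotens3 (rcoS K) (lcoS K) (rcoS K) (lcoS K)) ->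
  \tsum_(c \ox p <- x) \tsum_(g \ox q <- p) \tsum_(h \ox l <- q) f c ((g ∙ h) ∙ l) =
  \tsum_(c \ox p <- x) \tsum_(g \ox q <- p) \tsum_(h \ox l <- q) f c (g ∙ (h ∙ l)).
Proof.
move=> [f1 f2] xP.
transitivity (\tsum_(c \ox p <- x)
    f c (\tsum_(g \ox q <- p) \tsum_(h \ox l <- q) ((g ∙ h) ∙ l))).
  apply: eq_tlift => c p; rewrite linear_tsum //; apply: eq_tlift => g q.
  by rewrite linear_tsum.
transitivity (\tsum_(c \ox p <- x)
    f c (\tsum_(g \ox q <- p) \tsum_(h \ox l <- q) (g ∙ (h ∙ l)))).
  apply: (tens_sub_eq xP) => [||c p pP].
  - split=> [p|c]; [exact: f1|apply: (linear_app_fun (f2 c)); by mlin].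
  - split=> [p|c]; [exact: f1|apply: (linear_app_fun (f2 c)); by mlin].
  by rewrite (mul_assoc axK).
apply: eq_tlift => c p; rewrite linear_tsum //; apply: eq_tlift => g q.
by rewrite linear_tsum.
Qed.

Lemma tsum_eta_alpha V (c : S) (f : S -> K -> V) : bilinear_map f ->
  \tsum_(a \ox b <- comul K (eta K c)) f (alpha K a) b =
  \tsum_(c1 \ox c2 <- comul S c) f c1 (eta K c2).
Proof.
by move=> hf; rewrite -tsum_lcoS // (eta_lcoS axK) tlift_tmap.
Qed.

Lemma tsum_eta_beta V (c : S) (f : S -> K -> V) : bilinear_map f ->
  \tsum_(a \ox b <- comul K (eta K c)) f (beta K a) b =
  \tsum_(c1 \ox c2 <- comul S c) f c2 (eta K c1).
Proof.
move=> hf; have hf' : bilinear_map (fun u v => f v u) by case: hf.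
rewrite -(tsum_rcoS (f := fun u v => f v u)) // (eta_rcoS axK).
by rewrite (tlift_tmap (f := fun u v => f v u)).
Qed.

Arguments tsum_eta_alpha {V c f}.
Arguments tsum_eta_beta {V c f}.

Variable M : left_module K.
Let axM := lm_axioms M.

Lemma pactE (z : K ⊗ M) : \tsum_(k \ox m <- z) (k ▷ m) = pact M z.
Proof. by tens_ext z => k m; rewrite tlift_tens //; mlin. Qed.

Lemma tsum_mo_lcoSA V (m : M) (f : S -> S -> M -> V) : trilinear_map f ->
  \tsum_(c \ox x <- mo_lcoS M m) \tsum_(c1 \ox c2 <- comul S c) f c1 c2 x =
  \tsum_(c \ox x <- mo_lcoS M m) \tsum_(d \ox y <- mo_lcoS M x) f c d y.
Proof. exact/tsum_coassoc/(proj1 (mo_left_comodule axM)). Qed.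

Arguments tsum_mo_lcoSA {V m f}.

Lemma tsum_act_assoc A W (x : A ⊗ (K ⊗ (K ⊗ M))) (f : A -> M -> W) : bilinear_map f ->
  x \in tens_sub (cotens3 (rcoS K) (lcoS K) (rcoS K) (mo_lcoS M)) ->
  \tsum_(c \ox p <- x) \tsum_(g \ox q <- p) \tsum_(h \ox m <- q) f c ((g ∙ h) ▷ m) =
  \tsum_(c \ox p <- x) \tsum_(g \ox q <- p) \tsum_(h \ox m <- q) f c (g ▷ (h ▷ m)).
Proof.
move=> [f1 f2] xP.
transitivity (\tsum_(c \ox p <- x)
    f c (\tsum_(g \ox q <- p) \tsum_(h \ox m <- q) ((g ∙ h) ▷ m))).
  apply: eq_tlift => c p; rewrite linear_tsum //; apply: eq_tlift => g q.
  by rewrite linear_tsum.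
transitivity (\tsum_(c \ox p <- x)
    f c (\tsum_(g \ox q <- p) \tsum_(h \ox m <- q) (g ▷ (h ▷ m)))).
  apply: (tens_sub_eq xP) => [||c p pP].
  - split=> [p|c]; [exact: f1|apply: (linear_app_fun (f2 c)); by mlin].
  - split=> [p|c]; [exact: f1|apply: (linear_app_fun (f2 c)); by mlin].
  by rewrite (act_assoc axM).
apply: eq_tlift => c p; rewrite linear_tsum //; apply: eq_tlift => g q.
by rewrite linear_tsum.
Qed.

Lemma tsum_act_alpha V (x : K ⊗ M) (f : S -> M -> V) : bilinear_map f ->
  x \in cotens (rcoS K) (mo_lcoS M) ->
  tlift f (mo_lcoS M (pact M x)) =
  \tsum_(k \ox m <- x) \tsum_(k1 \ox k2 <- comul K k) f (alpha K k1) (k2 ▷ m).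
Proof.
move=> hf xP; rewrite -pactE (act_lcoS axM) // tlift_tlift //.
apply: eq_tlift => k m; rewrite tlift_tlift //; apply: eq_tlift => a b.
by rewrite tlift_tens.
Qed.

(* The module analogue of [mul_alpha_beta]: the canonical coaction of [M] can be
   traded for the coaction of [K] on the acting factor. *)
Lemma tsum_act_beta V (x : K ⊗ M) (f : M -> S -> V) :
  (forall m : M, canonical_rcoS m = tswap (mo_lcoS M m)) -> bilinear_map f ->
  x \in cotens (rcoS K) (mo_lcoS M) ->
  \tsum_(g \ox m <- x) \tsum_(c \ox m0 <- mo_lcoS M m) f (g ▷ m0) c =
  \tsum_(g \ox m <- x) \tsum_(g1 \ox g2 <- comul K g) f (g1 ▷ m) (beta K g2).
Proof.
move=> Mcan [f1 f2] xP.
transitivity (\tsum_(g \ox m <- x) \tsum_(c \ox m0 <- mo_lcoS M m)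
    \tsum_(e1 \ox e2 <- comul K (eta K c)) f (g ▷ (e1 ▷ m0)) (alpha K e2)).
  apply: eq_tlift => g m.
  have hfg : bilinear_map (fun y c => f (g ▷ y) c).
    by mlin.
  rewrite -(tlift_tswap (f := fun y c => f (g ▷ y) c)) //.
  rewrite -Mcan /canonical_rcoS tlift_tlift //; apply: eq_tlift => c y.
  by rewrite tlift_tlift //; apply: eq_tlift => a b; rewrite tlift_tens.
(* With h = [eta K c], the chain is: g (h^(1) m0) = (g h^(1)) m0 on [z1], then g h^(1) ⊗
   alpha(h^(2)) = g^(1) h ⊗ beta(g^(2)) on [z2], then (g^(1) h) m0 = g^(1) (h m0) on [z3], where
   unitality absorbs h into m. *)
pose z1 := \tsum_(g \ox m <- x) \tsum_(c \ox m0 <- mo_lcoS M m)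
    \tsum_(e1 \ox e2 <- comul K (eta K c)) (alpha K e2 \ox (g \ox (e1 \ox m0))).
pose z2 := \tsum_(g \ox m <- x) \tsum_(c \ox m0 <- mo_lcoS M m) (m0 \ox (g \ox eta K c)).
pose z3 := \tsum_(g \ox m <- x) \tsum_(c \ox m0 <- mo_lcoS M m)
    \tsum_(g1 \ox g2 <- comul K g) (beta K g2 \ox (g1 \ox (eta K c \ox m0))).
have z1P : z1 \in tens_sub (cotens3 (rcoS K) (lcoS K) (rcoS K) (mo_lcoS M)).
  apply: tens_cotens3I.
    apply: tens_cotens_rcoSI.
    transitivity (\tsum_(g \ox m <- x) \tsum_(c \ox m0 <- mo_lcoS M m)
      \tsum_(a \ox b <- comul K (eta K c)) \tsum_(b1 \ox b2 <- comul K b)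
        ((alpha K b2 \ox g) \ox (b1 \ox (beta K a \ox m0)))).
      tnorm; apply: eq_tlift => g m; apply: eq_tlift => c m0.
      by apply: (tsum_comulA (f := fun a1 a2 b =>
        ((alpha K b \ox g) \ox (a2 \ox (beta K a1 \ox m0))))); mlin.
    transitivity (\tsum_(g \ox m <- x) \tsum_(c \ox m0 <- mo_lcoS M m)
      \tsum_(c1 \ox c2 <- comul S c) \tsum_(b1 \ox b2 <- comul K (eta K c1))
        ((alpha K b2 \ox g) \ox (b1 \ox (c2 \ox m0)))).
      apply: eq_tlift => g m; apply: eq_tlift => c m0.
      by apply: (tsum_eta_beta (f := fun s k => \tsum_(b1 \ox b2 <- comul K k)
        ((alpha K b2 \ox g) \ox (b1 \ox (s \ox m0))))); mlin.
    transitivity (\tsum_(g \ox m <- x) \tsum_(c \ox y <- mo_lcoS M m)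
      \tsum_(d \ox m0 <- mo_lcoS M y) \tsum_(b1 \ox b2 <- comul K (eta K c))
        ((alpha K b2 \ox g) \ox (b1 \ox (d \ox m0)))).
      apply: eq_tlift => g m.
      by apply: (tsum_mo_lcoSA (f := fun c1 c2 m0 => \tsum_(b1 \ox b2 <- comul K (eta K c1))
        ((alpha K b2 \ox g) \ox (b1 \ox (c2 \ox m0))))); mlin.
    by tnorm; do 2![apply: eq_tlift => ? ?]; exact: tlift_exchange.
  apply: tens_cotens_mulI.
  transitivity (\tsum_(g \ox m <- x) \tsum_(g1 \ox g2 <- comul K g)
     \tsum_(c \ox m0 <- mo_lcoS M m) \tsum_(e1 \ox e2 <- comul K (eta K c))
      ((alpha K e2 \ox m0) \ox (g2 \ox (beta K g1 \ox e1)))).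
    tnorm; apply: eq_tlift => g m; rewrite [RHS]tlift_exchange.
    by apply: eq_tlift => c m0; exact: tlift_exchange.
  transitivity (\tsum_(g \ox m <- x) \tsum_(s \ox y <- mo_lcoS M m)
     \tsum_(c \ox m0 <- mo_lcoS M y) \tsum_(e1 \ox e2 <- comul K (eta K c))
      ((alpha K e2 \ox m0) \ox (g \ox (s \ox e1)))).
    by apply: (cotens_rcoSE (f := fun g s m =>
      \tsum_(c \ox m0 <- mo_lcoS M m) \tsum_(e1 \ox e2 <- comul K (eta K c))
      ((alpha K e2 \ox m0) \ox (g \ox (s \ox e1)))) xP); mlin.
  transitivity (\tsum_(g \ox m <- x) \tsum_(c \ox m0 <- mo_lcoS M m)
     \tsum_(c1 \ox c2 <- comul S c) \tsum_(e1 \ox e2 <- comul K (eta K c2))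
      ((alpha K e2 \ox m0) \ox (g \ox (c1 \ox e1)))).
    apply: eq_tlift => g m; symmetry.
    by apply: (tsum_mo_lcoSA (f := fun c1 c2 m0 => \tsum_(e1 \ox e2 <- comul K (eta K c2))
      ((alpha K e2 \ox m0) \ox (g \ox (c1 \ox e1))))); mlin.
  transitivity (\tsum_(g \ox m <- x) \tsum_(c \ox m0 <- mo_lcoS M m)
     \tsum_(a \ox b <- comul K (eta K c)) \tsum_(e1 \ox e2 <- comul K b)
      ((alpha K e2 \ox m0) \ox (g \ox (alpha K a \ox e1)))).
    apply: eq_tlift => g m; apply: eq_tlift => c m0; symmetry.
    by apply: (tsum_eta_alpha (f := fun s k => \tsum_(e1 \ox e2 <- comul K k)
      ((alpha K e2 \ox m0) \ox (g \ox (s \ox e1))))); mlin.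
  symmetry; tnorm; apply: eq_tlift => g m; apply: eq_tlift => c m0.
  by apply: (tsum_comulA (f := fun a1 a2 b =>
    ((alpha K b \ox m0) \ox (g \ox (alpha K a1 \ox a2))))); mlin.
have z2P : z2 \in tens_sub (cotens (rcoS K) (lcoS K)).
  apply: tens_cotens_mulI.
  transitivity (\tsum_(g \ox m <- x) \tsum_(g1 \ox g2 <- comul K g)
     \tsum_(c \ox m0 <- mo_lcoS M m) (m0 \ox (g2 \ox (beta K g1 \ox eta K c)))).
    by tnorm; apply: eq_tlift => g m; exact: tlift_exchange.
  transitivity (\tsum_(g \ox m <- x) \tsum_(s \ox y <- mo_lcoS M m)
     \tsum_(c \ox m0 <- mo_lcoS M y) (m0 \ox (g \ox (s \ox eta K c)))).
    by apply: (cotens_rcoSE (f := fun g s m =>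
      \tsum_(c \ox m0 <- mo_lcoS M m) (m0 \ox (g \ox (s \ox eta K c)))) xP); mlin.
  transitivity (\tsum_(g \ox m <- x) \tsum_(c \ox m0 <- mo_lcoS M m)
     \tsum_(c1 \ox c2 <- comul S c) (m0 \ox (g \ox (c1 \ox eta K c2)))).
    apply: eq_tlift => g m; symmetry.
    by apply: (tsum_mo_lcoSA (f := fun c1 c2 m0 => (m0 \ox (g \ox (c1 \ox eta K c2))))); mlin.
  symmetry; tnorm; apply: eq_tlift => g m; apply: eq_tlift => c m0.
  by apply: (tsum_eta_alpha (f := fun s k => (m0 \ox (g \ox (s \ox k))))); mlin.
have z3P : z3 \in tens_sub (cotens3 (rcoS K) (lcoS K) (rcoS K) (mo_lcoS M)).
  apply: tens_cotens3I.
    apply: tens_cotens_rcoSI.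
    transitivity (\tsum_(g \ox m <- x) \tsum_(c \ox m0 <- mo_lcoS M m)
      \tsum_(a \ox b <- comul K (eta K c)) \tsum_(g1 \ox g2 <- comul K g)
        ((beta K g2 \ox g1) \ox (b \ox (beta K a \ox m0)))).
      by tnorm; do 2![apply: eq_tlift => ? ?]; exact: tlift_exchange.
    transitivity (\tsum_(g \ox m <- x) \tsum_(c \ox m0 <- mo_lcoS M m)
      \tsum_(c1 \ox c2 <- comul S c) \tsum_(g1 \ox g2 <- comul K g)
        ((beta K g2 \ox g1) \ox (eta K c1 \ox (c2 \ox m0)))).
      apply: eq_tlift => g m; apply: eq_tlift => c m0.
      by apply: (tsum_eta_beta (f := fun s k => \tsum_(g1 \ox g2 <- comul K g)
        ((beta K g2 \ox g1) \ox (k \ox (s \ox m0))))); mlin.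
    transitivity (\tsum_(g \ox m <- x) \tsum_(c \ox y <- mo_lcoS M m)
      \tsum_(d \ox m0 <- mo_lcoS M y) \tsum_(g1 \ox g2 <- comul K g)
        ((beta K g2 \ox g1) \ox (eta K c \ox (d \ox m0)))).
      apply: eq_tlift => g m.
      by apply: (tsum_mo_lcoSA (f := fun c1 c2 m0 => \tsum_(g1 \ox g2 <- comul K g)
        ((beta K g2 \ox g1) \ox (eta K c1 \ox (c2 \ox m0))))); mlin.
    by tnorm; do 2![apply: eq_tlift => ? ?]; exact: tlift_exchange.
  apply: tens_cotens_mulI.
  transitivity (\tsum_(g \ox m <- x) \tsum_(a \ox b <- comul K g)
     \tsum_(c \ox m0 <- mo_lcoS M m) \tsum_(b1 \ox b2 <- comul K b)
      ((beta K b2 \ox m0) \ox (b1 \ox (beta K a \ox eta K c)))).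
    tnorm; apply: eq_tlift => g m; rewrite [RHS]tlift_exchange.
    apply: eq_tlift => c m0.
    by apply: (tsum_comulA (f := fun a1 a2 b =>
      ((beta K b \ox m0) \ox (a2 \ox (beta K a1 \ox eta K c))))); mlin.
  transitivity (\tsum_(g \ox m <- x) \tsum_(s \ox y <- mo_lcoS M m)
     \tsum_(c \ox m0 <- mo_lcoS M y) \tsum_(b1 \ox b2 <- comul K g)
      ((beta K b2 \ox m0) \ox (b1 \ox (s \ox eta K c)))).
    by apply: (cotens_rcoSE (f := fun g s m =>
      \tsum_(c \ox m0 <- mo_lcoS M m) \tsum_(b1 \ox b2 <- comul K g)
      ((beta K b2 \ox m0) \ox (b1 \ox (s \ox eta K c)))) xP); mlin.
  transitivity (\tsum_(g \ox m <- x) \tsum_(c \ox m0 <- mo_lcoS M m)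
     \tsum_(c1 \ox c2 <- comul S c) \tsum_(b1 \ox b2 <- comul K g)
      ((beta K b2 \ox m0) \ox (b1 \ox (c1 \ox eta K c2)))).
    apply: eq_tlift => g m; symmetry.
    by apply: (tsum_mo_lcoSA (f := fun c1 c2 m0 => \tsum_(b1 \ox b2 <- comul K g)
      ((beta K b2 \ox m0) \ox (b1 \ox (c1 \ox eta K c2))))); mlin.
  transitivity (\tsum_(g \ox m <- x) \tsum_(c \ox m0 <- mo_lcoS M m)
     \tsum_(a \ox b <- comul K (eta K c)) \tsum_(b1 \ox b2 <- comul K g)
      ((beta K b2 \ox m0) \ox (b1 \ox (alpha K a \ox b)))).
    apply: eq_tlift => g m; apply: eq_tlift => c m0; symmetry.
    by apply: (tsum_eta_alpha (f := fun s k => \tsum_(b1 \ox b2 <- comul K g)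
      ((beta K b2 \ox m0) \ox (b1 \ox (s \ox k))))); mlin.
  by tnorm; do 2![apply: eq_tlift => ? ?]; exact: tlift_exchange.
have hF : bilinear_map (fun (s : S) (m : M) => f m s) by split.
transitivity (\tsum_(c \ox p <- z1) \tsum_(g \ox q <- p) \tsum_(h \ox m <- q)
    f (g ▷ (h ▷ m)) c).
  by tnorm.
rewrite -(tsum_act_assoc hF z1P).
transitivity (\tsum_(m \ox p <- z2) \tsum_(g \ox h <- p) \tsum_(h1 \ox h2 <- comul K h)
    f ((g ∙ h1) ▷ m) (alpha K h2)).
  by tnorm.
transitivity (\tsum_(m \ox p <- z2) \tsum_(g \ox h <- p) \tsum_(g1 \ox g2 <- comul K g)
    f ((g1 ∙ h) ▷ m) (beta K g2)).
  apply: (tens_sub_eq z2P) => [||m p pP]; [by mlin|by mlin|].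
  by apply: (tsum_mul_alpha_beta pP (f := fun k s => f (k ▷ m) s)); mlin.
transitivity (\tsum_(c \ox p <- z3) \tsum_(g \ox q <- p) \tsum_(h \ox m <- q)
    f ((g ∙ h) ▷ m) c).
  by tnorm.
rewrite (tsum_act_assoc hF z3P).
tnorm; apply: eq_tlift => g m; rewrite tlift_exchange.
apply: eq_tlift => g1 g2; rewrite -[in RHS](act_unit axM m).
rewrite [RHS](linear_tsum (L := fun y => f (g1 ▷ y) (beta K g2))) //.
by mlin.
Qed.

End Module.
Arguments tsum_eta_alpha {F S K V c f}.
Arguments tsum_eta_beta {F S K V c f}.
Arguments tsum_mo_lcoSA {F S K M V m f}.

(** * Cotensor powers of a comodule coalgebra *)

Section TensorPowers.
Variables (F : fieldType) (S : coalgebra F) (K : left_bicoalgebroid S).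
Variable T : comodule_coalgebra K.
Local Notation "g ∙ h" := (bmul g h) (at level 40, left associativity).
Local Notation lco := (cc_lco T).
Local Notation tlco := (tpow_lco T).
Local Notation cotpow n := (@cotpow F S K T n).
Implicit Type V : lmodType F.

Lemma tsum_lcoA V (t : T) (f : K -> K -> T -> V) : trilinear_map f ->
  \tsum_(k \ox x <- lco t) \tsum_(a \ox b <- comul K k) f a b x =
  \tsum_(k \ox x <- lco t) \tsum_(l \ox y <- lco x) f k l y.
Proof. exact/tsum_coassoc/(proj1 (cc_left_comodule T)). Qed.
Arguments tsum_lcoA {V t f}.

Lemma tsum_lco_counit V (t : T) (f : T -> V) : linear f ->
  \tsum_(k \ox x <- lco t) ((counit K k : F) *: f x) = f t.
Proof.
move=> hf; rewrite -[in RHS](proj2 (cc_left_comodule T) t) linear_tsum //.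
by apply: eq_tlift => a b; rewrite (GRing.scalable_linear hf).
Qed.
Arguments tsum_lco_counit {V t f}.

Lemma tsum_cc_rcoS V (t : T) (f : T -> S -> V) : bilinear_map f ->
  tlift f (cc_rcoS T t) = \tsum_(k \ox x <- lco t) f x (beta K k).
Proof.
move=> hf; have hf' : bilinear_map (fun u v => f v u) by case: hf.
by rewrite /cc_rcoS /= tlift_tswap // (tlift_tmap (f := fun u v => f v u)).
Qed.
Arguments tsum_cc_rcoS {V t f}.

Lemma tsum_cc_lcoS V (t : T) (f : S -> T -> V) : bilinear_map f ->
  tlift f (cc_lcoS T t) = \tsum_(k \ox x <- lco t) f (alpha K k) x.
Proof. by move=> hf; rewrite /cc_lcoS /= tlift_tmap. Qed.
Arguments tsum_cc_lcoS {V t f}.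

Lemma tsum_tpow_lcoS n V (w : T ⊗ tpow T n) (f : S -> T ⊗ tpow T n -> V) : bilinear_map f ->
  tlift f (tpow_lcoS T n.+1 w) =
  \tsum_(t \ox y <- w) \tsum_(k \ox x <- lco t) f (alpha K k) (x \ox y).
Proof.
move=> hf; rewrite /= tlift_tassoc //.
rewrite tlift_tmap; last by mlin.
apply: eq_tlift => t y.
by rewrite (tsum_cc_lcoS (f := fun s x => f s (x \ox y))) //; mlin.
Qed.
Arguments tsum_tpow_lcoS {n V w f}.

Lemma tsum_tpow_lco n V (w : T ⊗ tpow T n) (f : K -> T ⊗ tpow T n -> V) : bilinear_map f ->
  tlift f (tlco n.+1 w) =
  \tsum_(t \ox y <- w) \tsum_(a \ox x <- lco t) \tsum_(b \ox y0 <- tlco n y)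
    f (a ∙ b) (x \ox y0).
Proof.
move=> hf; rewrite /= tlift_tmap //.
tens_ext w => t y; rewrite [RHS]tlift_tens ?tmapE; last by mlin.
tens_ext (lco t) => a x; rewrite [RHS]tlift_tens; last by mlin.
tens_ext (tlco n y) => b y0; rewrite [RHS]tlift_tens; last by mlin.
by rewrite tinterE tlift_tens //; mlin.
Qed.
Arguments tsum_tpow_lco {n V w f}.

(* The coaction before multiplication of the [K]-factors of head and tail. *)
Definition tpow_lco_split n (w : T ⊗ tpow T n) : (T ⊗ tpow T n) ⊗ (K ⊗ K) :=
  \tsum_(t \ox y <- w) \tsum_(a \ox x <- lco t) \tsum_(b \ox y0 <- tlco n y)
    ((x \ox y0) \ox (a \ox b)).

Lemma tpow_lco_split_linear n : linear (@tpow_lco_split n).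
Proof. by rewrite /tpow_lco_split; mlin. Qed.

Lemma tsum_tpow_lco_split n V (w : T ⊗ tpow T n) (f : K -> T ⊗ tpow T n -> V) :
  bilinear_map f ->
  tlift f (tlco n.+1 w) = \tsum_(c \ox p <- tpow_lco_split w) f (pmul K p) c.
Proof. by move=> hf; rewrite tsum_tpow_lco // /tpow_lco_split; tnorm. Qed.
Arguments tsum_tpow_lco_split {n V w f}.

Lemma cotpow_closed n : submod_closed (cotpow n).
Proof.
case: n => [|n]; first by split.
have [t0 tL] := tens_sub_closed T (cotpow n).
have [c0 cL] := cotens_closed (cc_rcoS T) (tpow_lcoS T n).
split=> [|a x y /andP[x1 x2] /andP[y1 y2]]; first exact/andP.
by apply/andP; split; [exact: tL|exact: cL].
Qed.

Lemma cotpowS n (w : T ⊗ tpow T n) : w \in cotpow n.+1 ->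
  w \in tens_sub (cotpow n) /\ w \in cotens (cc_rcoS T) (tpow_lcoS T n).
Proof. by move=> /andP. Qed.

Section Step.
Variable n : nat.
Hypothesis IH : forall y : tpow T n, y \in cotpow n ->
  \tsum_(k \ox y0 <- tlco n y) \tsum_(a \ox b <- comul K k) (alpha K a \ox (b \ox y0)) =
  \tsum_(s \ox y' <- tpow_lcoS T n y) \tsum_(b \ox y0 <- tlco n y') (s \ox (b \ox y0)).

(** Stated relative to [IH] because of a mutual dependence: colinearity of the coaction on the tail
    makes the product of head and tail factors defined, and this is what colinearity one degree
    higher requires. *)
Lemma tpow_lco_split_cotens_step (w : T ⊗ tpow T n) : w \in cotpow n.+1 ->
  tpow_lco_split w \in tens_sub (cotens (rcoS K) (lcoS K)).
Proof.
move=> /cotpowS[w1 w2]; apply: tens_cotens_mulI.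
transitivity (\tsum_(t \ox y <- w) \tsum_(a \ox x <- lco t) \tsum_(a1 \ox a2 <- comul K a)
    \tsum_(b \ox y0 <- tlco n y) ((x \ox y0) \ox (a2 \ox (beta K a1 \ox b)))).
  by rewrite /tpow_lco_split; tnorm; do 2![apply: eq_tlift => ? ?]; exact: tlift_exchange.
transitivity (\tsum_(t \ox y <- w) \tsum_(k \ox z <- lco t) \tsum_(a \ox x <- lco z)
    \tsum_(b \ox y0 <- tlco n y) ((x \ox y0) \ox (a \ox (beta K k \ox b)))).
  apply: eq_tlift => t y.
  by apply: (tsum_lcoA (f := fun a1 a2 x => \tsum_(b \ox y0 <- tlco n y)
    ((x \ox y0) \ox (a2 \ox (beta K a1 \ox b))))); mlin.
transitivity (\tsum_(t \ox y <- w) \tsum_(z \ox s <- cc_rcoS T t) \tsum_(a \ox x <- lco z)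
    \tsum_(b \ox y0 <- tlco n y) ((x \ox y0) \ox (a \ox (s \ox b)))).
  by apply: eq_tlift => t y; rewrite tsum_cc_rcoS //; mlin.
transitivity (\tsum_(t \ox y <- w) \tsum_(s \ox y' <- tpow_lcoS T n y)
    \tsum_(a \ox x <- lco t) \tsum_(b \ox y0 <- tlco n y')
    ((x \ox y0) \ox (a \ox (s \ox b)))).
  by apply: (cotensE (f := fun z s y' => \tsum_(a \ox x <- lco z)
    \tsum_(b \ox y0 <- tlco n y') ((x \ox y0) \ox (a \ox (s \ox b)))) w2); mlin.
transitivity (\tsum_(t \ox y <- w) \tsum_(a \ox x <- lco t)
   \tsum_(s \ox p <- \tsum_(s \ox y' <- tpow_lcoS T n y) \tsum_(b \ox y0 <- tlco n y')
      (s \ox (b \ox y0))) \tsum_(b \ox y0 <- p)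
    ((x \ox y0) \ox (a \ox (s \ox b)))).
  by tnorm; apply: eq_tlift => ? ?; exact: tlift_exchange.
transitivity (\tsum_(t \ox y <- w) \tsum_(a \ox x <- lco t)
   \tsum_(s \ox p <- \tsum_(k \ox y0 <- tlco n y) \tsum_(a \ox b <- comul K k)
      (alpha K a \ox (b \ox y0))) \tsum_(b \ox y0 <- p)
    ((x \ox y0) \ox (a \ox (s \ox b)))).
  apply: (tens_sub_eq w1) => [||t y yP]; [by mlin|by mlin|].
  by apply: eq_tlift => a x; rewrite IH.
by rewrite /tpow_lco_split; tnorm.
Qed.

End Step.

(** The left S-coaction of a product is that of its first factor ([tsum_alpha_pmul]), so the
    coaction of a tensor power is left S-colinear through its head. *)
Lemma tpow_lco_alpha n (y : tpow T n) : y \in cotpow n ->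
  \tsum_(k \ox y0 <- tlco n y) \tsum_(a \ox b <- comul K k) (alpha K a \ox (b \ox y0)) =
  \tsum_(s \ox y' <- tpow_lcoS T n y) \tsum_(b \ox y0 <- tlco n y') (s \ox (b \ox y0)).
Proof.
elim: n y => [|n IHn] w wP.
  rewrite [RHS]tsum_cc_lcoS; last by mlin.
  by apply: (tsum_lcoA (f := fun a b x => alpha K a \ox (b \ox x))); mlin.
have JP := tpow_lco_split_cotens_step IHn wP.
rewrite [LHS]tsum_tpow_lco_split; last by mlin.
transitivity (\tsum_(c \ox p <- tpow_lco_split w) \tsum_(g \ox h <- p)
   \tsum_(g1 \ox g2 <- comul K g) (alpha K g1 \ox (g2 ∙ h \ox c))).
  apply: (tens_sub_eq JP) => [||c p pP]; [by mlin|by mlin|].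
  by apply: (tsum_alpha_pmul pP (f := fun s k => s \ox (k \ox c))); mlin.
transitivity (\tsum_(t \ox y <- w) \tsum_(a \ox x <- lco t) \tsum_(a1 \ox a2 <- comul K a)
    \tsum_(b \ox y0 <- tlco n y) (alpha K a1 \ox (a2 ∙ b \ox (x \ox y0)))).
  by rewrite /tpow_lco_split; tnorm; do 2![apply: eq_tlift => ? ?]; exact: tlift_exchange.
rewrite [RHS]tsum_tpow_lcoS; last by mlin.
apply: eq_tlift => t y.
transitivity (\tsum_(k \ox z <- lco t) \tsum_(a \ox x <- lco z)
    \tsum_(b \ox y0 <- tlco n y) (alpha K k \ox (a ∙ b \ox (x \ox y0)))).
  by apply: (tsum_lcoA (f := fun a1 a2 x => \tsum_(b \ox y0 <- tlco n y)
    (alpha K a1 \ox (a2 ∙ b \ox (x \ox y0))))); mlin.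
apply: eq_tlift => k z; rewrite tsum_tpow_lco; last by mlin.
by rewrite tlift_tens //; mlin.
Qed.

Lemma tpow_lco_split_cotens n (w : T ⊗ tpow T n) : w \in cotpow n.+1 ->
  tpow_lco_split w \in tens_sub (cotens (rcoS K) (lcoS K)).
Proof. exact/tpow_lco_split_cotens_step/tpow_lco_alpha. Qed.

Lemma tpow_lco_counit n (y : tpow T n) : y \in cotpow n ->
  \tsum_(k \ox y0 <- tlco n y) ((counit K k : F) *: y0) = y.
Proof.
elim: n y => [|n IHn] w wP; first exact: (proj2 (cc_left_comodule T)).
rewrite [LHS]tsum_tpow_lco_split; last by mlin.
transitivity (\tsum_(c \ox p <- tpow_lco_split w) \tsum_(g \ox h <- p)
   ((counit K g : F) *: ((counit K h : F) *: c))).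
  apply: (tens_sub_eq (tpow_lco_split_cotens wP)) => [||c p pP]; [by mlin|by mlin|].
  rewrite counit_pmul // (linear_tsum (L := fun k : F^o => (k : F) *: c)); last by mlin.
  by apply: eq_tlift => g h; rewrite scalerA.
transitivity (\tsum_(t \ox y <- w) \tsum_(a \ox x <- lco t) \tsum_(b \ox y0 <- tlco n y)
   ((counit K a : F) *: (x \ox ((counit K b : F) *: y0)))).
  rewrite /tpow_lco_split; tnorm; do 3![apply: eq_tlift => ? ?].
  by rewrite tensZr.
transitivity (\tsum_(t \ox y <- w) (t \ox y)); last exact: tlift_id.
apply: (tens_sub_eq (proj1 (cotpowS wP))) => [||t y yP]; [by mlin|by mlin|].
transitivity (\tsum_(a \ox x <- lco t) ((counit K a : F) *: (x \ox y))); last first.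
  by apply: (tsum_lco_counit (f := fun x => x \ox y)); mlin.
apply: eq_tlift => a x; rewrite -[in RHS](IHn y yP).
by rewrite (linear_tsum (L := fun y => (counit K a : F) *: (x \ox y))) //; mlin.
Qed.

(** By [alpha_pmul] only the K factor of the head contributes, the tail being restored by its
    counit. [tpow_rcoS_beta] is the mirror image, through the last factor. *)
Lemma tpow_lcoS_alpha n (y : tpow T n) : y \in cotpow n ->
  \tsum_(k \ox y0 <- tlco n y) (alpha K k \ox y0) = tpow_lcoS T n y.
Proof.
case: n y => [|n] w wP; first by rewrite -[RHS]tlift_id tsum_cc_lcoS //; mlin.
rewrite [LHS]tsum_tpow_lco_split; last by mlin.
transitivity (\tsum_(c \ox p <- tpow_lco_split w) \tsum_(g \ox h <- p)
   ((counit K h : F) *: (alpha K g \ox c))).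
  apply: (tens_sub_eq (tpow_lco_split_cotens wP)) => [||c p pP]; [by mlin|by mlin|].
  rewrite alpha_pmul // (linear_tsum (L := fun s => s \ox c)); last by mlin.
  by apply: eq_tlift => g h; rewrite tensZl.
transitivity (\tsum_(t \ox y <- w) \tsum_(a \ox x <- lco t) \tsum_(b \ox y0 <- tlco n y)
   (alpha K a \ox (x \ox ((counit K b : F) *: y0)))).
  rewrite /tpow_lco_split; tnorm; do 3![apply: eq_tlift => ? ?].
  by rewrite !tensZr.
rewrite -[RHS]tlift_id tsum_tpow_lcoS; last by mlin.
apply: (tens_sub_eq (proj1 (cotpowS wP))) => [||t y yP]; [by mlin|by mlin|].
apply: eq_tlift => a x; rewrite -[in RHS](tpow_lco_counit yP).
by rewrite (linear_tsum (L := fun y => alpha K a \ox (x \ox y))) //; mlin.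
Qed.

(* The right S-coaction through the last factor, with the S-factor on the left. *)
Fixpoint tpow_rcoS_fun n : tpow T n -> S ⊗ tpow T n :=
  match n return tpow T n -> S ⊗ tpow T n with
  | 0 => fun t : T => \tsum_(k \ox x <- lco t) (beta K k \ox x)
  | n'.+1 => fun w : T ⊗ tpow T n' => \tsum_(t \ox y <- w)
      \tsum_(s \ox y' <- tpow_rcoS_fun y) (s \ox (t \ox y'))
  end.

Lemma tpow_rcoS_linear n : linear (@tpow_rcoS_fun n).
Proof.
elim: n => [|n IHn] /=; mlin.
Qed.

HB.instance Definition _ n := GRing.isLinear.Build F (tpow T n) (S ⊗ tpow T n) _
  (@tpow_rcoS_fun n) (@tpow_rcoS_linear n).
Definition tpow_rcoS n : {linear tpow T n -> S ⊗ tpow T n} := @tpow_rcoS_fun n.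

Lemma tpow_rcoS0 (t : tpow T 0) :
  tpow_rcoS 0 t = \tsum_(k \ox x <- lco t) (beta K k \ox x).
Proof. by []. Qed.

Lemma tpow_rcoSE n (w : T ⊗ tpow T n) : tpow_rcoS n.+1 w =
  \tsum_(t \ox y <- w) \tsum_(s \ox y' <- tpow_rcoS n y) (s \ox (t \ox y')).
Proof. by []. Qed.

Lemma tpow_rcoS_beta n (y : tpow T n) : y \in cotpow n ->
  \tsum_(k \ox y0 <- tlco n y) (beta K k \ox y0) = tpow_rcoS n y.
Proof.
elim: n y => [//|n IHn] w wP.
rewrite [LHS]tsum_tpow_lco_split; last by mlin.
transitivity (\tsum_(c \ox p <- tpow_lco_split w) \tsum_(g \ox h <- p)
   ((counit K g : F) *: (beta K h \ox c))).
  apply: (tens_sub_eq (tpow_lco_split_cotens wP)) => [||c p pP]; [by mlin|by mlin|].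
  rewrite beta_pmul // (linear_tsum (L := fun s => s \ox c)); last by mlin.
  by apply: eq_tlift => g h; rewrite tensZl.
transitivity (\tsum_(t \ox y <- w) \tsum_(a \ox x <- lco t) ((counit K a : F) *:
   (\tsum_(b \ox y0 <- tlco n y) (beta K b \ox (x \ox y0))))).
  by rewrite /tpow_lco_split; tnorm.
rewrite tpow_rcoSE.
apply: (tens_sub_eq (proj1 (cotpowS wP))) => [||t y yP]; [by mlin|by mlin|].
rewrite (tsum_lco_counit (f := fun x => \tsum_(b \ox y0 <- tlco n y)
  (beta K b \ox (x \ox y0)))); last by mlin.
by rewrite -IHn //; tnorm.
Qed.

(** Right-hand counterpart of [tpow_lco_alpha]: by [tsum_beta_pmul] the leg with [beta] travels down
    to the last factor. *)
Lemma tpow_lco_beta n (y : tpow T n) : y \in cotpow n ->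
  \tsum_(k \ox y0 <- tlco n y) \tsum_(a \ox b <- comul K k) (beta K a \ox (b \ox y0)) =
  \tsum_(s \ox y' <- tpow_rcoS n y) \tsum_(b \ox y0 <- tlco n y') (s \ox (b \ox y0)).
Proof.
elim: n y => [|n IHn] w wP.
  rewrite /tpow_rcoS /=; symmetry; tnorm; symmetry.
  by apply: (tsum_lcoA (f := fun a b x => beta K a \ox (b \ox x))); mlin.
have JP := tpow_lco_split_cotens wP.
rewrite [LHS]tsum_tpow_lco_split; last by mlin.
transitivity (\tsum_(c \ox p <- tpow_lco_split w) \tsum_(g \ox h <- p)
   \tsum_(h1 \ox h2 <- comul K h) (beta K h1 \ox (g ∙ h2 \ox c))).
  apply: (tens_sub_eq JP) => [||c p pP]; [by mlin|by mlin|].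
  by apply: (tsum_beta_pmul pP (f := fun s k => s \ox (k \ox c))); mlin.
transitivity (\tsum_(t \ox y <- w) \tsum_(a \ox x <- lco t)
   \tsum_(s \ox p <- \tsum_(k \ox y0 <- tlco n y) \tsum_(a \ox b <- comul K k)
      (beta K a \ox (b \ox y0))) \tsum_(b \ox y0 <- p)
    (s \ox (a ∙ b \ox (x \ox y0)))).
  by rewrite /tpow_lco_split; tnorm.
rewrite tpow_rcoSE.
transitivity (\tsum_(t \ox y <- w) \tsum_(a \ox x <- lco t)
   \tsum_(s \ox p <- \tsum_(s \ox y' <- tpow_rcoS n y) \tsum_(b \ox y0 <- tlco n y')
      (s \ox (b \ox y0))) \tsum_(b \ox y0 <- p)
    (s \ox (a ∙ b \ox (x \ox y0)))).
  apply: (tens_sub_eq (proj1 (cotpowS wP))) => [||t y yP]; [by mlin|by mlin|].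
  by apply: eq_tlift => a x; rewrite IHn.
symmetry; tnorm; apply: eq_tlift => t y; rewrite [RHS]tlift_exchange.
apply: eq_tlift => s y'; rewrite tsum_tpow_lco; last by mlin.
by rewrite tlift_tens //; mlin.
Qed.

End TensorPowers.
Arguments tsum_lcoA {F S K T V t f}.
Arguments tsum_lco_counit {F S K T V t f}.
Arguments tsum_cc_rcoS {F S K T V t f}.
Arguments tsum_cc_lcoS {F S K T V t f}.
Arguments tsum_tpow_lcoS {F S K T n V w f}.
Arguments tsum_tpow_lco {F S K T n V w f}.
Arguments tsum_tpow_lco_split {F S K T n V w f}.

(** * Rotation of tensor powers and its effect on the S-coactions *)

Section Rotation.
Variables (F : fieldType) (S : coalgebra F) (K : left_bicoalgebroid S).
Variable T : comodule_coalgebra K.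
Local Notation lco := (cc_lco T).
Local Notation cotpow n := (@cotpow F S K T n).

(* [tpow_ins k t y] inserts the factor [t] at position [k] of [y], for [k <= n.+1]. *)
Fixpoint tpow_ins n : nat -> T -> tpow T n -> tpow T n.+1 :=
  match n return nat -> T -> tpow T n -> tpow T n.+1 with
  | 0 => fun k t (y : T) => if k is 0 then t \ox y else y \ox t
  | n'.+1 => fun k t (y : T ⊗ tpow T n') =>
      if k is k'.+1 then \tsum_(l \ox y' <- y) (l \ox tpow_ins k' t y') else t \ox y
  end.

Lemma tpow_ins_bilinear n k : bilinear_map (@tpow_ins n k).
Proof.
elim: n k => [|n IHn] [|k] /=; try by mlin.
by have H := IHn k; mlin.
Qed.

Lemma tpow_ins_linearl n k (y : tpow T n) : linear (fun t => tpow_ins k t y).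
Proof. exact: (proj1 (tpow_ins_bilinear n k)). Qed.

Lemma tpow_ins_linearr n k t : linear (@tpow_ins n k t).
Proof. exact: (proj2 (tpow_ins_bilinear n k)). Qed.

Local Hint Resolve tpow_ins_linearl tpow_ins_linearr : mlin.

Lemma tpow_ins0 n t (y : tpow T n) : tpow_ins 0 t y = t \ox y.
Proof. by case: n y. Qed.

Lemma tpow_insS n k t l (y : tpow T n) :
  @tpow_ins n.+1 k.+1 t (l \ox y) = l \ox tpow_ins k t y.
Proof. by rewrite /= tlift_tens //; mlin. Qed.

(* Moves the last factor to the front. *)
Fixpoint tpow_rot_fun n : tpow T n -> tpow T n :=
  match n return tpow T n -> tpow T n with
  | 0 => fun t => t
  | n'.+1 => fun w : T ⊗ tpow T n' => \tsum_(t \ox y <- w) tpow_ins 1 t (tpow_rot_fun y)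
  end.

Lemma tpow_rot_linear n : linear (@tpow_rot_fun n).
Proof. by elim: n => [//|n IHn] /=; mlin. Qed.

HB.instance Definition _ n := GRing.isLinear.Build F (tpow T n) (tpow T n) _
  (@tpow_rot_fun n) (@tpow_rot_linear n).
Definition tpow_rot n : {linear tpow T n -> tpow T n} := @tpow_rot_fun n.

Lemma tpow_rotE n (w : T ⊗ tpow T n) :
  tpow_rot n.+1 w = \tsum_(t \ox y <- w) tpow_ins 1 t (tpow_rot n y).
Proof. by []. Qed.

Lemma tpow_rot_tens n t (y : tpow T n) : tpow_rot n.+1 (t \ox y) = tpow_ins 1 t (tpow_rot n y).
Proof. by rewrite tpow_rotE tlift_tens //; mlin. Qed.

Lemma tpow_rotS n (w : T ⊗ tpow T n.+1) : tpow_rot n.+2 w =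
  \tsum_(t \ox w' <- w) \tsum_(l \ox x <- (tpow_rot n.+1 w' : T ⊗ tpow T n))
    (l \ox (t \ox x) : tpow T n.+2).
Proof.
rewrite tpow_rotE; apply: eq_tlift => t w'.
tens_ext (tpow_rot n.+1 w') => l x.
by rewrite tlift_tens ?tpow_insS ?tpow_ins0 //; mlin.
Qed.

Lemma tpow_ins_ins n k t l (y : tpow T n) : (k <= n)%N ->
  tpow_ins k.+2 t (tpow_ins 1 l y) = tpow_ins 1 l (tpow_ins k.+1 t y).
Proof.
case: n y => [|n] y kn.
  by rewrite /= tlift_tens ?tlift_tens //; mlin.
tens_ext y => z y'.
by rewrite !tpow_insS !tpow_ins0 !tpow_insS.
Qed.

(** The position [n.+1] is excluded, since a factor inserted there is the one that rotation brings
    to the front. *)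
Lemma tpow_rot_ins n k t (y : tpow T n) : (k <= n)%N ->
  tpow_rot n.+1 (tpow_ins k t y) = tpow_ins k.+1 t (tpow_rot n y).
Proof.
elim: n k y => [|n IHn] [|k] y kn //; rewrite ?tpow_ins0 ?tpow_rot_tens //.
tens_ext y => l y'.
rewrite tpow_insS !tpow_rot_tens IHn //.
by rewrite tpow_ins_ins.
Qed.

(** Rotation puts the old first factor at the start of the tail and the old last factor at the head.
    Hence the left S-coaction of [w] becomes that of the tail, and its right one, in
    [tpow_rot_rcoS], that of the head. *)
Lemma tpow_rot_lcoS n (w : tpow T n.+1) :
  \tsum_(s \ox v <- tpow_lcoS T n.+1 w) (s \ox tpow_rot n.+1 v) =
  \tsum_(l \ox x <- (tpow_rot n.+1 w : T ⊗ tpow T n)) \tsum_(s \ox x' <- tpow_lcoS T n x)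
     (s \ox (l \ox x' : tpow T n.+1)).
Proof.
tens_ext w => t y.
rewrite tsum_tpow_lcoS; last by mlin.
rewrite tlift_tens; last by mlin.
rewrite tpow_rot_tens; case: n {w} y => [|n] y.
  rewrite tlift_tens; last by mlin.
  rewrite tsum_cc_lcoS; last by mlin.
  by apply: eq_tlift => k x; rewrite tpow_rot_tens.
under eq_tlift => k x do rewrite tpow_rot_tens.
tens_ext (tpow_rot n.+1 y) => l z.
rewrite tpow_insS tpow_ins0 tlift_tens; last by mlin.
rewrite tsum_tpow_lcoS; last by mlin.
rewrite tlift_tens; last by mlin.
by apply: eq_tlift => k x; rewrite tpow_insS tpow_ins0.
Qed.

Lemma tpow_rot_rcoS n (w : tpow T n.+1) :
  \tsum_(s \ox v <- tpow_rcoS T n.+1 w) (s \ox tpow_rot n.+1 v) =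
  \tsum_(t \ox x <- (tpow_rot n.+1 w : T ⊗ tpow T n)) \tsum_(k \ox t0 <- lco t)
     (beta K k \ox (t0 \ox x : tpow T n.+1)).
Proof.
elim: n w => [|n IHn] w.
  tens_ext w => x t.
  rewrite tpow_rot_tens tpow_rcoSE /=.
  rewrite tlift_tens; last by mlin.
  rewrite tlift_tens; last by mlin.
  by tnorm.
tens_ext w => t w'.
rewrite tpow_rcoSE tlift_tens; last by mlin.
rewrite tpow_rot_tens.
transitivity (\tsum_(s \ox v <- \tsum_(s \ox v <- tpow_rcoS T n.+1 w') (s \ox tpow_rot n.+1 v))
   (s \ox tpow_ins 1 t v)).
  by tnorm; apply: eq_tlift => s v; rewrite tpow_rot_tens.
rewrite IHn; tens_ext (tpow_rot n.+1 w') => l x.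
rewrite tpow_insS tpow_ins0 !tlift_tens; [|by mlin..].
by tnorm; apply: eq_tlift => k l0; rewrite tpow_insS tpow_ins0.
Qed.

Lemma cotpow0 (t : tpow T 0) : t \in cotpow 0.
Proof. by []. Qed.

(** Slicing the head of the rotated tensor is applying a functional to the last factor of [w]. This
    map [q] commutes with the left S-coaction, which sits on the first factor, so it preserves the
    conditions between the factors that remain. *)
Lemma tpow_rot_tens_sub n (w : tpow T n.+1) : w \in cotpow n.+1 ->
  (tpow_rot n.+1 w : T ⊗ tpow T n) \in tens_sub (cotpow n).
Proof.
elim: n w => [|n IHn] w wP.
  by apply/tens_subP => [|phi]; [exact: cotpow_closed|exact: cotpow0].
have [w1 w2] := cotpowS wP.
apply/tens_subP => [|phi]; first exact: cotpow_closed.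
pose q : {linear tpow T n.+1 -> tpow T n} := slice phi \o tpow_rot n.+1.
have qdef v : q v = slice phi (tpow_rot n.+1 v : T ⊗ tpow T n) by [].
have qE (v : T ⊗ tpow T n.+1) : slice phi (tpow_rot n.+2 v : T ⊗ tpow T n.+1) = tmap idfun q v.
  tens_ext v => t v'; rewrite tpow_rot_tens tmapE qdef.
  tens_ext (tpow_rot n.+1 v') => l x.
  by rewrite tpow_insS tpow_ins0 !slice_tens tensZr.
have qlco (v : tpow T n.+1) : tpow_lcoS T n (q v) = tmap idfun q (tpow_lcoS T n.+1 v).
  transitivity (\tsum_(l \ox x <- (tpow_rot n.+1 v : T ⊗ tpow T n))
      \tsum_(s \ox x' <- tpow_lcoS T n x) (s \ox slice phi (l \ox x'))).
    rewrite qdef; tens_ext (tpow_rot n.+1 v) => l x.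
    rewrite tlift_tens; last by mlin.
    rewrite slice_tens linearZ /=; tens_ext (tpow_lcoS T n x) => s x'.
    by rewrite tlift_tens ?slice_tens ?tensZr //; mlin.
  transitivity (\tsum_(s \ox v <- \tsum_(s \ox v <- tpow_lcoS T n.+1 v)
      (s \ox tpow_rot n.+1 v)) (s \ox slice phi (v : T ⊗ tpow T n))).
    by rewrite tpow_rot_lcoS; tnorm.
  by tnorm.
apply/andP; rewrite qE; split.
  apply: (tens_sub_tsum w1); [exact: cotpow_closed|by mlin|].
  move=> t v vP; apply: tens_sub_tens; rewrite qdef.
  by apply: (elimT (tens_subP _ (cotpow_closed _ _)) (IHn _ vP)).
move/eqP: w2 => w2; apply/eqP.
have -> : tassoc (tmap (cc_rcoS T) idfun (tmap idfun q w)) =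
    tmap idfun (tmap idfun q) (tassoc (tmap (cc_rcoS T) idfun w)).
  tens_ext w => t v; rewrite !tmapE.
  change (tassoc (cc_rcoS T t \ox q v) =
    tmap idfun (tmap idfun q) (tassoc (cc_rcoS T t \ox v))).
  by tens_ext (cc_rcoS T t) => x s; rewrite !tassocE tmapE /= tmapE.
rewrite w2; tens_ext w => t v; rewrite !tmapE.
by rewrite -[RHS]/(t \ox tpow_lcoS T n (q v)) qlco.
Qed.

(** The junction between the last two factors of [w], which lies deepest in the recursion of
    [cotpow]: after rotation it links the end of the tail with the head. *)
Lemma cotpow_last n (w : tpow T n.+1) : w \in cotpow n.+1 ->
  \tsum_(t \ox x <- (tpow_rot n.+1 w : T ⊗ tpow T n)) \tsum_(s \ox x' <- tpow_rcoS T n x)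
    (t \ox (s \ox x')) =
  \tsum_(t \ox x <- (tpow_rot n.+1 w : T ⊗ tpow T n)) \tsum_(k \ox t0 <- lco t)
    (t0 \ox (alpha K k \ox x)).
Proof.
elim: n w => [|n IHn] w wP; have [w1 w2] := cotpowS wP.
  have rotE (v : T ⊗ tpow T 0) : (tpow_rot 1 v : T ⊗ tpow T 0) = tswap v.
    by tens_ext v => x t; rewrite tpow_rot_tens tswapE.
  rewrite rotE !tlift_tswap; [|by mlin..].
  transitivity (\tsum_(x \ox t <- w) \tsum_(x0 \ox s <- cc_rcoS T x) (t \ox (s \ox x0))).
    by apply: eq_tlift => x t; rewrite tsum_cc_rcoS ?tpow_rcoS0; [tnorm|mlin].
  rewrite (cotensE (f := fun x s t => t \ox (s \ox x)) w2); last by mlin.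
  by apply: eq_tlift => x t; rewrite tsum_cc_lcoS //; mlin.
rewrite !tpow_rotS.
transitivity (\tsum_(t' \ox w' <- w) \tsum_(t \ox p <-
    \tsum_(t \ox x <- (tpow_rot n.+1 w' : T ⊗ tpow T n)) \tsum_(s \ox x' <- tpow_rcoS T n x)
      (t \ox (s \ox x'))) \tsum_(s \ox x <- p) (t \ox (s \ox (t' \ox x : tpow T n.+1)))).
  tnorm; do 2![apply: eq_tlift => ? ?].
  by rewrite tpow_rcoSE tlift_tens; [tnorm|mlin].
transitivity (\tsum_(t' \ox w' <- w) \tsum_(t \ox p <-
    \tsum_(t \ox x <- (tpow_rot n.+1 w' : T ⊗ tpow T n)) \tsum_(k \ox t0 <- lco t)
    (t0 \ox (alpha K k \ox x))) \tsum_(s \ox x <- p) (t \ox (s \ox (t' \ox x : tpow T n.+1)))).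
  apply: (tens_sub_eq w1) => [||t v vP]; [by mlin|by mlin|].
  by rewrite IHn.
by tnorm.
Qed.

End Rotation.

(** * The K-coaction of a rotated tensor *)

Section RotationCoaction.
Variables (F : fieldType) (S : coalgebra F) (K : left_bicoalgebroid S).
Variable T : comodule_coalgebra K.
Local Notation "g ∙ h" := (bmul g h) (at level 40, left associativity).
Local Notation lco := (cc_lco T).
Local Notation tlco := (tpow_lco T).
Local Notation cotpow n := (@cotpow F S K T n).
Local Hint Resolve tpow_ins_linearl tpow_ins_linearr : mlin.

(** Counterpart of [tpow_lco_split] for a rotated tensor: the head came last in the original order,
    so its factor [a] stands to the right of [b]. *)
Definition tpow_lco_rot n (w : T ⊗ tpow T n) : (T ⊗ tpow T n) ⊗ (K ⊗ K) :=
  \tsum_(t \ox x <- w) \tsum_(a \ox t0 <- lco t) \tsum_(b \ox x0 <- tlco n x)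
    ((t0 \ox x0) \ox (b \ox a)).

Lemma tpow_lco_rot_linear n : linear (@tpow_lco_rot n).
Proof. by rewrite /tpow_lco_rot; mlin. Qed.

Local Hint Extern 1 => first [exact: tpow_lco_rot_linear | exact: tpow_lco_split_linear] : mlin.

Lemma tpow_lco_rot_cotens n (w : tpow T n.+1) : w \in cotpow n.+1 ->
  tpow_lco_rot (tpow_rot T n.+1 w) \in tens_sub (cotens (rcoS K) (lcoS K)).
Proof.
move=> wP; have rP := tpow_rot_tens_sub wP; apply: tens_cotens_mulI.
transitivity (\tsum_(t \ox x <- (tpow_rot T n.+1 w : T ⊗ tpow T n)) \tsum_(a \ox t0 <- lco t)
   \tsum_(s \ox p <- \tsum_(k \ox x0 <- tlco n x) \tsum_(a \ox b <- comul K k)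
      (beta K a \ox (b \ox x0))) \tsum_(b \ox x0 <- p) ((t0 \ox x0) \ox (b \ox (s \ox a)))).
  by rewrite /tpow_lco_rot; tnorm.
transitivity (\tsum_(t \ox x <- (tpow_rot T n.+1 w : T ⊗ tpow T n)) \tsum_(a \ox t0 <- lco t)
   \tsum_(s \ox p <- \tsum_(s \ox x' <- tpow_rcoS T n x) \tsum_(b \ox x0 <- tlco n x')
      (s \ox (b \ox x0))) \tsum_(b \ox x0 <- p) ((t0 \ox x0) \ox (b \ox (s \ox a)))).
  apply: (tens_sub_eq rP) => [||t x xP]; [by mlin|by mlin|].
  by apply: eq_tlift => a t0; rewrite tpow_lco_beta.
transitivity (\tsum_(t \ox p <- \tsum_(t \ox x <- (tpow_rot T n.+1 w : T ⊗ tpow T n))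
    \tsum_(s \ox x' <- tpow_rcoS T n x) (t \ox (s \ox x')))
    \tsum_(s \ox x <- p) \tsum_(a \ox t0 <- lco t) \tsum_(b \ox x0 <- tlco n x)
      ((t0 \ox x0) \ox (b \ox (s \ox a)))).
  by tnorm; apply: eq_tlift => t x; exact: tlift_exchange.
rewrite cotpow_last //.
transitivity (\tsum_(t \ox x <- (tpow_rot T n.+1 w : T ⊗ tpow T n))
    \tsum_(k \ox z <- lco t) \tsum_(a \ox t0 <- lco z) \tsum_(b \ox x0 <- tlco n x)
      ((t0 \ox x0) \ox (b \ox (alpha K k \ox a)))).
  by tnorm.
transitivity (\tsum_(t \ox x <- (tpow_rot T n.+1 w : T ⊗ tpow T n))
    \tsum_(k \ox t0 <- lco t) \tsum_(a1 \ox a2 <- comul K k) \tsum_(b \ox x0 <- tlco n x)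
      ((t0 \ox x0) \ox (b \ox (alpha K a1 \ox a2)))).
  apply: eq_tlift => t x; symmetry.
  by apply: (tsum_lcoA (f := fun a1 a2 t0 => \tsum_(b \ox x0 <- tlco n x)
      ((t0 \ox x0) \ox (b \ox (alpha K a1 \ox a2))))); mlin.
by rewrite /tpow_lco_rot; tnorm; do 2![apply: eq_tlift => ? ?]; exact: tlift_exchange.
Qed.

(* The coaction of t_0 ... t_n read off after rotation, with the rotated factor
   still acting from the right. *)
Lemma tpow_rot_lco n (w : tpow T n.+1) : w \in cotpow n.+1 ->
  \tsum_(k \ox v <- tlco n.+1 w) (k \ox tpow_rot T n.+1 v) =
  \tsum_(t \ox x <- (tpow_rot T n.+1 w : T ⊗ tpow T n)) \tsum_(a \ox t0 <- lco t)
    \tsum_(b \ox x0 <- tlco n x) (b ∙ a \ox (t0 \ox x0 : tpow T n.+1)).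
Proof.
elim: n w => [|n IHn] w wP.
  rewrite [LHS](tsum_tpow_lco (n := 0)); last by mlin.
  tens_ext w => x t; rewrite tpow_rot_tens !tlift_tens; [|by mlin..].
  rewrite [RHS]tlift_exchange; apply: eq_tlift => b x0; apply: eq_tlift => a t0.
  by rewrite tpow_rot_tens.
have [w1 w2] := cotpowS wP.
transitivity (\tsum_(t' \ox w' <- w) \tsum_(a' \ox t'0 <- lco t')
   \tsum_(k \ox v <- \tsum_(k \ox v <- tlco n.+1 w') (k \ox tpow_rot T n.+1 v))
     (a' ∙ k \ox tpow_ins 1 t'0 v)).
  rewrite [LHS](tsum_tpow_lco (n := n.+1)); last by mlin.
  tnorm; do 3![apply: eq_tlift => ? ?]; by rewrite tpow_rot_tens.
transitivity (\tsum_(t' \ox w' <- w) \tsum_(a' \ox t'0 <- lco t')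
   \tsum_(k \ox v <- \tsum_(t \ox x <- (tpow_rot T n.+1 w' : T ⊗ tpow T n))
      \tsum_(a \ox t0 <- lco t) \tsum_(b \ox x0 <- tlco n x)
       (b ∙ a \ox (t0 \ox x0 : tpow T n.+1))) (a' ∙ k \ox tpow_ins 1 t'0 v)).
  apply: (tens_sub_eq w1) => [||t v vP]; [by mlin|by mlin|].
  by apply: eq_tlift => a x; rewrite IHn.
(* The induction step reassociates a' (b a) to (a' b) a. That b and a can be multiplied comes from
   [w'], that a' and b can from the tail of the rotated [w]. *)
pose z := \tsum_(t' \ox w' <- w) \tsum_(a' \ox t'0 <- lco t')
  \tsum_(t \ox x <- (tpow_rot T n.+1 w' : T ⊗ tpow T n))
  \tsum_(a \ox t0 <- lco t) \tsum_(b \ox x0 <- tlco n x)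
    ((t0 \ox (t'0 \ox x0 : tpow T n.+1) : tpow T n.+2) \ox (a' \ox (b \ox a))).
have zP : z \in tens_sub (cotens3 (rcoS K) (lcoS K) (rcoS K) (lcoS K)).
  apply: tens_cotens3I.
    have -> : \tsum_(c \ox p <- z) \tsum_(g \ox q <- p) ((c \ox g) \ox q) =
      \tsum_(t' \ox w' <- w) \tsum_(c \ox p <- tpow_lco_rot (tpow_rot T n.+1 w'))
       ((\tsum_(a' \ox t'0 <- lco t') \tsum_(t0 \ox x0 <- c)
         ((t0 \ox (t'0 \ox x0 : tpow T n.+1) : tpow T n.+2) \ox a')) \ox p).
      rewrite /tpow_lco_rot; tnorm; apply: eq_tlift => t' w'.
      do 3![rewrite [LHS]tlift_exchange; apply: eq_tlift => ? ?].
      by [].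
    apply: (tens_sub_tsum w1); [exact: cotens_closed|by mlin|].
    move=> t' w' w'P; apply: (tens_sub_tsum (tpow_lco_rot_cotens w'P)).
    - exact: cotens_closed.
    - by mlin.
    - by move=> c p; exact: tens_sub_tens.
  have -> : \tsum_(c \ox p <- z) \tsum_(g \ox q <- p) \tsum_(h \ox l <- q)
      ((c \ox l) \ox (g \ox h)) =
    \tsum_(t \ox x <- (tpow_rot T n.+2 w : T ⊗ tpow T n.+1))
    \tsum_(c \ox p <- tpow_lco_split x)
      ((\tsum_(a \ox t0 <- lco t) ((t0 \ox c : tpow T n.+2) \ox a)) \ox p).
    rewrite tpow_rotS /tpow_lco_split; tnorm; apply: eq_tlift => t' w'.
    rewrite [LHS]tlift_exchange; apply: eq_tlift => t x; apply: eq_tlift => a' t'0.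
    exact: tlift_exchange.
  apply: (tens_sub_tsum (tpow_rot_tens_sub wP)); [exact: cotens_closed|by mlin|].
  move=> t x xP; apply: (tens_sub_tsum (tpow_lco_split_cotens xP)).
  - exact: cotens_closed.
  - by mlin.
  - by move=> c p; exact: tens_sub_tens.
transitivity (\tsum_(c \ox p <- z) \tsum_(g \ox q <- p) \tsum_(h \ox l <- q)
   (g ∙ (h ∙ l) \ox c)).
  tnorm; do 5![apply: eq_tlift => ? ?].
  by rewrite tpow_insS tpow_ins0.
rewrite -(tsum_mul_assoc (f := fun c k => k \ox c) _ zP); last by mlin.
rewrite tpow_rotS; tnorm; apply: eq_tlift => t' w'.
rewrite [LHS]tlift_exchange; apply: eq_tlift => t x.
rewrite [LHS]tlift_exchange; apply: eq_tlift => a t0.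
rewrite [RHS](tsum_tpow_lco (n := n)); last by mlin.
by rewrite tlift_tens //; mlin.
Qed.

End RotationCoaction.

(** * Doubling or dropping the first factor is compatible with the coactions *)

Section FaceDegeneracy.
Variables (F : fieldType) (S : coalgebra F) (K : left_bicoalgebroid S).
Variable T : comodule_coalgebra K.
Local Notation "g ∙ h" := (bmul g h) (at level 40, left associativity).
Local Notation lco := (cc_lco T).
Local Notation tlco := (tpow_lco T).
Local Notation cotpow n := (@cotpow F S K T n).
Local Notation Delta := (comul T).
Local Hint Extern 1 => exact: tpow_lco_split_linear : mlin.

Lemma tpow_comul_linear n i : linear (@tpow_comul F S K T n i).
Proof.
by elim: n i => [|n IHn] [|i] /=; mlin.
Qed.

HB.instance Definition _ n i := GRing.isLinear.Build F (tpow T n) (tpow T n.+1) _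
  (@tpow_comul F S K T n i) (@tpow_comul_linear n i).

Lemma tpow_comul0 i (t : tpow T 0) : tpow_comul i t = Delta t.
Proof. by []. Qed.

Lemma tpow_comulS0 n (w : T ⊗ tpow T n) : @tpow_comul F S K T n.+1 0 w =
  \tsum_(t \ox y <- w) \tsum_(t1 \ox t2 <- Delta t) (t1 \ox (t2 \ox y : tpow T n.+1)).
Proof.
rewrite /=; apply: eq_tlift => t y.
by tens_ext (Delta t) => t1 t2; rewrite tassocE tlift_tens //; mlin.
Qed.

Lemma comul_cotpow (t : T) : (Delta t : tpow T 1) \in cotpow 1.
Proof.
apply/andP; split.
  by apply/tens_subP => [|phi]; [exact: cotpow_closed|exact: cotpow0].
apply: cotensI.
transitivity (\tsum_(s \ox p <- \tsum_(t1 \ox t2 <- Delta t) \tsum_(a \ox x <- lco t1)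
    (beta K a \ox (x \ox t2))) \tsum_(x \ox t2 <- p) (x \ox (s \ox t2))).
  by tnorm; apply: eq_tlift => t1 t2; rewrite tsum_cc_rcoS //; mlin.
rewrite cc_cotens; tnorm; apply: eq_tlift => t1 t2.
by rewrite tsum_cc_lcoS //; mlin.
Qed.

Lemma comul_tpow_lco (t : T) :
  tlco 1 (Delta t) = \tsum_(k \ox x <- lco t) (k \ox (Delta x : tpow T 1)).
Proof.
rewrite -[LHS]tlift_id (tsum_tpow_lco (n := 0)); last by mlin.
by rewrite cc_comul.
Qed.

(** Right S-colinearity of the comultiplication comes from [cc_comul]: applied to the coaction of
    [Delta t], the map [beta] meets only the last factor ([tpow_rcoS_beta]). *)
Lemma comul_beta (t : T) :
  \tsum_(k \ox x <- lco t) (beta K k \ox Delta x) =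
  \tsum_(t1 \ox t2 <- Delta t) \tsum_(k \ox x <- lco t2) (beta K k \ox (t1 \ox x)).
Proof.
have := tpow_rcoS_beta (comul_cotpow t); rewrite comul_tpow_lco tpow_rcoSE.
move=> E; transitivity (\tsum_(t1 \ox t2 <- Delta t) \tsum_(s \ox y' <- tpow_rcoS T 0 t2)
   (s \ox (t1 \ox y' : tpow T 1))).
  by rewrite -E; symmetry; tnorm.
by apply: eq_tlift => t1 t2; rewrite tpow_rcoS0; tnorm.
Qed.

Lemma tpow_comul0_cotpow n (w : tpow T n) : w \in cotpow n -> tpow_comul 0 w \in cotpow n.+1.
Proof.
case: n w => [|n] w wP; first exact: comul_cotpow.
have [w1 w2] := cotpowS wP; rewrite tpow_comulS0; apply/andP; split.
  apply/tens_subP => [|phi]; first exact: cotpow_closed.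
  (* A slice of the doubled tensor is [q] applied to the first factor, and [q] is right S-colinear
     by [comul_beta]; so the condition between the first two factors survives. *)
  pose q : {linear T -> T} := slice phi \o Delta.
  have qdef t : q t = slice phi (Delta t) by [].
  have -> : slice phi (\tsum_(t \ox y <- w) \tsum_(t1 \ox t2 <- Delta t)
      (t1 \ox (t2 \ox y : tpow T n.+1))) = tmap q idfun w.
    tens_ext w => t y; rewrite tlift_tens ?tmapE ?qdef; last by mlin.
    tens_ext (Delta t) => t1 t2; rewrite tlift_tens; last by mlin.
    by rewrite !slice_tens tensZl.
  have qrco t : cc_rcoS T (q t) = tmap q idfun (cc_rcoS T t).
    rewrite -[LHS]tlift_id -[RHS]tlift_id tsum_cc_rcoS; last by mlin.
    rewrite tlift_tmap; last by mlin.
    rewrite tsum_cc_rcoS; last by mlin.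
    transitivity (\tsum_(s \ox p <- \tsum_(t1 \ox t2 <- Delta t) \tsum_(k \ox x <- lco t2)
       (beta K k \ox (t1 \ox x))) (slice phi p \ox s)).
      tnorm; rewrite qdef; tens_ext (Delta t) => t1 t2.
      rewrite slice_tens linearZ /= tlift_tens; last by mlin.
      tens_ext (lco t2) => k x; rewrite tlift_tens; last by mlin.
      by rewrite -tensZr tlift_tens ?slice_tens ?tensZr ?tensZl //; mlin.
    by rewrite -comul_beta; tnorm.
  apply/andP; split.
    rewrite /tmap; apply: (tens_sub_tsum w1); [exact: cotpow_closed|by mlin|].
    by move=> t y yP; exact: tens_sub_tens.
  apply: cotensI; rewrite !tlift_tmap; [|by mlin..].
  transitivity (\tsum_(t \ox y <- w) \tsum_(x \ox s <- cc_rcoS T t) (q x \ox (s \ox y))).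
    apply: eq_tlift => t y; rewrite qrco tlift_tmap //; by mlin.
  by apply: (cotensE (f := fun x s y => q x \ox (s \ox y)) w2); mlin.
apply: cotensI.
transitivity (\tsum_(t \ox y <- w) \tsum_(s \ox p <- \tsum_(t1 \ox t2 <- Delta t)
    \tsum_(a \ox x <- lco t1) (beta K a \ox (x \ox t2))) \tsum_(x \ox t2 <- p)
     (x \ox (s \ox (t2 \ox y : tpow T n.+1)))).
  tnorm; do 2![apply: eq_tlift => ? ?].
  by rewrite tsum_cc_rcoS //; mlin.
transitivity (\tsum_(t \ox y <- w) \tsum_(s \ox p <- \tsum_(t1 \ox t2 <- Delta t)
    \tsum_(a \ox x <- lco t2) (alpha K a \ox (t1 \ox x))) \tsum_(x \ox t2 <- p)
     (x \ox (s \ox (t2 \ox y : tpow T n.+1)))).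
  by apply: eq_tlift => t y; rewrite cc_cotens.
tnorm; do 2![apply: eq_tlift => ? ?].
rewrite tsum_tpow_lcoS; last by mlin.
by rewrite tlift_tens //; mlin.
Qed.

Lemma tpow_comul0_lco n (w : tpow T n) : w \in cotpow n ->
  tlco n.+1 (tpow_comul 0 w) = \tsum_(k \ox v <- tlco n w) (k \ox tpow_comul 0 v).
Proof.
case: n w => [|n] w wP; first exact: comul_tpow_lco.
have [w1 w2] := cotpowS wP.
(* The coaction of the doubled tensor is a (b c); in (a b) c the product a b is the coaction of [t]
   by [cc_comul]. *)
pose z := \tsum_(t \ox y <- w) \tsum_(t1 \ox t2 <- Delta t) \tsum_(a \ox x1 <- lco t1)
  \tsum_(b \ox x2 <- lco t2) \tsum_(c \ox y0 <- tlco n y)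
   ((x1 \ox (x2 \ox y0 : tpow T n.+1) : tpow T n.+2) \ox (a \ox (b \ox c))).
have zP : z \in tens_sub (cotens3 (rcoS K) (lcoS K) (rcoS K) (lcoS K)).
  apply: tens_cotens3I.
    have -> : \tsum_(c \ox p <- z) \tsum_(g \ox q <- p) ((c \ox g) \ox q) =
      \tsum_(t1 \ox v <- (tpow_comul 0 w : T ⊗ tpow T n.+1)) \tsum_(c \ox p <- tpow_lco_split v)
       ((\tsum_(a \ox x1 <- lco t1) ((x1 \ox c : tpow T n.+2) \ox a)) \ox p).
      rewrite tpow_comulS0 /tpow_lco_split; tnorm; do 2![apply: eq_tlift => ? ?].
      rewrite [LHS]tlift_exchange; apply: eq_tlift => b x2.
      exact: tlift_exchange.
    apply: (tens_sub_tsum (proj1 (cotpowS (tpow_comul0_cotpow wP)))).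
    - exact: cotens_closed.
    - by mlin.
    move=> t1 v vP; apply: (tens_sub_tsum (tpow_lco_split_cotens vP)).
    - exact: cotens_closed.
    - by mlin.
    - by move=> c p; exact: tens_sub_tens.
  have -> : \tsum_(c \ox p <- z) \tsum_(g \ox q <- p) \tsum_(h \ox l <- q)
      ((c \ox l) \ox (g \ox h)) =
    \tsum_(t \ox y <- w) \tsum_(d \ox p <- tpow_lco_split (n := 0) (Delta t))
      ((\tsum_(c \ox y0 <- tlco n y) \tsum_(x1 \ox x2 <- d)
        ((x1 \ox (x2 \ox y0 : tpow T n.+1) : tpow T n.+2) \ox c)) \ox p).
    by rewrite /tpow_lco_split; tnorm.
  apply: (tens_sub_tsum w1); [exact: cotens_closed|by mlin|].
  move=> t y _; apply: (tens_sub_tsum (tpow_lco_split_cotens (comul_cotpow t))).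
  - exact: cotens_closed.
  - by mlin.
  - by move=> c p; exact: tens_sub_tens.
transitivity (\tsum_(c \ox p <- z) \tsum_(g \ox q <- p) \tsum_(h \ox l <- q)
   (g ∙ (h ∙ l) \ox c)).
  rewrite -[LHS]tlift_id (tsum_tpow_lco (n := n.+1)); last by mlin.
  rewrite tpow_comulS0; tnorm; do 3![apply: eq_tlift => ? ?].
  rewrite [LHS](tsum_tpow_lco (n := n)); last by mlin.
  by rewrite tlift_tens //; mlin.
rewrite -(tsum_mul_assoc (f := fun c k => k \ox c) _ zP); last by mlin.
transitivity (\tsum_(t \ox y <- w) \tsum_(k \ox p <- \tsum_(t1 \ox t2 <- Delta t)
    \tsum_(a \ox x <- lco t1) \tsum_(b \ox y <- lco t2) ((a ∙ b) \ox (x \ox y)))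
   \tsum_(c \ox y0 <- tlco n y) \tsum_(x1 \ox x2 <- p)
   (k ∙ c \ox (x1 \ox (x2 \ox y0 : tpow T n.+1) : tpow T n.+2))).
  by tnorm.
transitivity (\tsum_(t \ox y <- w) \tsum_(k \ox p <- \tsum_(k \ox x <- lco t) (k \ox Delta x))
   \tsum_(c \ox y0 <- tlco n y) \tsum_(x1 \ox x2 <- p)
   (k ∙ c \ox (x1 \ox (x2 \ox y0 : tpow T n.+1) : tpow T n.+2))).
  by apply: eq_tlift => t y; rewrite cc_comul.
rewrite [RHS](tsum_tpow_lco (n := n)); last by mlin.
tnorm; do 3![apply: eq_tlift => ? ?].
rewrite [in RHS]tpow_comulS0 tlift_tens; last by mlin.
by symmetry; tnorm.
Qed.

Definition tpow_drop n : {linear T ⊗ tpow T n -> tpow T n} := slice (counit T).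

Lemma tpow_drop_tens n t (y : tpow T n) : tpow_drop n (t \ox y) = (counit T t : F) *: y.
Proof. exact: slice_tens. Qed.

Lemma tpow_drop_cotpow n (w : tpow T n.+1) : w \in cotpow n.+1 -> tpow_drop n w \in cotpow n.
Proof.
move=> /cotpowS[w1 _].
exact: (elimT (tens_subP _ (cotpow_closed _ _)) w1).
Qed.

(** The counit on the head turns its K factor into [eta (beta a)]. The cotensor condition replaces
    this element of S by [alpha] of the first leg of the factor of the tail, and eta(alpha(k^(1)))
    k^(2) = k absorbs it. *)
Lemma tpow_drop_lco n (w : tpow T n.+1) : w \in cotpow n.+1 ->
  tlco n (tpow_drop n w) = \tsum_(k \ox v <- tlco n.+1 w) (k \ox tpow_drop n v).
Proof.
move=> /cotpowS[w1 w2]; symmetry.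
rewrite [LHS](tsum_tpow_lco (n := n)); last by mlin.
(* [cc_counit] provides [eta (alpha a)], but the condition between head and tail involves [beta] of
   the head. Applying eta ∘ beta to [cc_counit], with beta ∘ eta = id, shows that the two sums
   agree. *)
have etaE t : \tsum_(a \ox x <- lco t) ((counit T x : F) *: a) =
    \tsum_(a \ox x <- lco t) ((counit T x : F) *: eta K (beta K a)).
  have E := cc_counit t.
  rewrite E; have := congr1 (fun k => eta K (beta K k)) E.
  rewrite (linear_tsum (L := fun k => eta K (beta K k))); last by mlin.
  rewrite [RHS](linear_tsum (L := fun k => eta K (beta K k))); last by mlin.
  have betaeta s : beta K (eta K s) = s.
    transitivity (\tsum_(a \ox b <- comul K (eta K s)) ((counit K b : F) *: beta K a)).
      by rewrite tsum_counitr //; mlin.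
    rewrite (tsum_eta_beta (f := fun s k => (counit K k : F) *: s)); last by mlin.
    rewrite -[RHS](counitl (c := S)); apply: eq_tlift => a b.
    by rewrite (counit_eta (lb_axioms K)).
  move=> H; transitivity (\tsum_(k \ox x <- lco t)
      eta K (beta K ((counit T x : F) *: eta K (alpha K k)))).
    by apply: eq_tlift => k x; rewrite !linearZ /= betaeta.
  by rewrite -H; apply: eq_tlift => k x; rewrite !linearZ.
transitivity (\tsum_(t \ox y <- w) \tsum_(b \ox y0 <- tlco n y)
   ((\tsum_(a \ox x <- lco t) ((counit T x : F) *: a)) ∙ b \ox y0)).
  tnorm; apply: eq_tlift => t y; rewrite tlift_exchange; apply: eq_tlift => b y0.
  apply: eq_tlift => a x; rewrite tpow_drop_tens tensZr.
  by rewrite (GRing.scalable_linear (linear_bmull b (@linear_idfun _ K))) tensZl.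
transitivity (\tsum_(t \ox y <- w) \tsum_(b \ox y0 <- tlco n y)
   ((\tsum_(a \ox x <- lco t) ((counit T x : F) *: eta K (beta K a))) ∙ b \ox y0)).
  by apply: eq_tlift => t y; rewrite etaE.
transitivity (\tsum_(t \ox y <- w) \tsum_(x \ox s <- cc_rcoS T t) \tsum_(b \ox y0 <- tlco n y)
   ((counit T x : F) *: ((eta K s) ∙ b \ox y0))).
  tnorm; apply: eq_tlift => t y; rewrite tsum_cc_rcoS; last by mlin.
  rewrite tlift_exchange; do 2![apply: eq_tlift => ? ?].
  by rewrite (GRing.scalable_linear (linear_bmull _ (@linear_idfun _ K))) tensZl.
rewrite (cotensE (f := fun x s y => \tsum_(b \ox y0 <- tlco n y)
   ((counit T x : F) *: ((eta K s) ∙ b \ox y0))) w2); last by mlin.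
transitivity (\tsum_(t \ox y <- w) \tsum_(s \ox p <- \tsum_(s \ox y' <- tpow_lcoS T n y)
   \tsum_(b \ox y0 <- tlco n y') (s \ox (b \ox y0))) \tsum_(b \ox y0 <- p)
   ((counit T t : F) *: ((eta K s) ∙ b \ox y0))).
  by tnorm.
transitivity (\tsum_(t \ox y <- w) ((counit T t : F) *: tlco n y)); last first.
  tens_ext w => t y; rewrite tpow_drop_tens linearZ tlift_tens //; by mlin.
apply: (tens_sub_eq w1) => [||t y yP]; [by mlin|by mlin|].
rewrite -tpow_lco_alpha // -[in RHS](tlift_id (tlco n y)).
rewrite [RHS](linear_tsum (L := fun v => (counit T t : F) *: v)); last by mlin.
tnorm; apply: eq_tlift => k y0; rewrite -[in RHS](eta_alphaK (lb_axioms K) k).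
by symmetry; tnorm.
Qed.

End FaceDegeneracy.

(** * Stable anti-Yetter-Drinfeld modules *)

Section CanonicalCoaction.
Variables (F : fieldType) (S : coalgebra F) (K : left_bicoalgebroid S) (M : left_module K).
Local Notation "g ∙ h" := (bmul g h) (at level 40, left associativity).
Local Notation "k ▷ m" := (bact k m) (at level 41, right associativity).
Implicit Type V : lmodType F.
Let axK := lb_axioms K.

(** By [comul_eta_beta] the second leg of the comultiplication of [eta K c] may be written as
    eta(beta(e2)), and alpha ∘ eta = id. *)
Lemma tsum_eta_alpha_beta V (c : S) (f : K -> S -> V) : bilinear_map f ->
  \tsum_(e1 \ox e2 <- comul K (eta K c)) f e1 (alpha K e2) =
  \tsum_(e1 \ox e2 <- comul K (eta K c)) f e1 (beta K e2).
Proof.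
move=> hf.
have alphaeta s : alpha K (eta K s) = s.
  transitivity (\tsum_(a \ox b <- comul K (eta K s)) ((counit K b : F) *: alpha K a)).
    by rewrite tsum_counitr //; mlin.
  rewrite (tsum_eta_alpha (f := fun s k => (counit K k : F) *: s)); last by mlin.
  rewrite -[RHS](counitr (c := S)); apply: eq_tlift => a b.
  by rewrite (counit_eta axK).
rewrite [in LHS](comul_eta_beta axK); apply: etrans; [tnf|].
by apply: eq_tlift => a b; rewrite alphaeta.
Qed.
Arguments tsum_eta_alpha_beta {V c f}.

(** With e = eta(alpha(k^(1))) the left side is e^(1) (k^(2) m) ⊗ alpha(e^(2)). Associativity on
    [z1], the exchange of [alpha] and [beta] on e, and [mul_alpha_beta] on [z2] give (e k^(2)) m ⊗
    alpha(k^(3)), and the unit law contracts e k^(2). *)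
Lemma canonical_rcoS_act (x : K ⊗ M) : x \in cotens (rcoS K) (mo_lcoS M) ->
  canonical_rcoS (pact M x) =
  \tsum_(k \ox m <- x) \tsum_(k1 \ox k2 <- comul K k) ((k1 ▷ m) \ox alpha K k2).
Proof.
move=> xP; rewrite /canonical_rcoS tsum_act_alpha //; last by mlin.
pose z1 := \tsum_(k \ox m <- x) \tsum_(k1 \ox k2 <- comul K k)
  \tsum_(e1 \ox e2 <- comul K (eta K (alpha K k1))) (alpha K e2 \ox (e1 \ox (k2 \ox m))).
pose z2 := \tsum_(k \ox m <- x) \tsum_(k1 \ox k2 <- comul K k)
  (m \ox (eta K (alpha K k1) \ox k2)).
have z1P : z1 \in tens_sub (cotens3 (rcoS K) (lcoS K) (rcoS K) (mo_lcoS M)).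
  apply: tens_cotens3I.
    apply: tens_cotens_rcoSI.
    pose D (s : S) := \tsum_(e1 \ox e2 <- comul K (eta K s)) (alpha K e2 \ox e1).
    have DL : linear D by rewrite /D; mlin.
    transitivity (\tsum_(k \ox m <- x) \tsum_(k1 \ox k2 <- comul K k)
      \tsum_(a \ox b <- comul K k2) (D (alpha K k1) \ox (b \ox (beta K a \ox m)))).
      rewrite /D; tnorm; do 2![apply: eq_tlift => ? ?]; exact: tlift_exchange.
    transitivity (\tsum_(k \ox m <- x) \tsum_(k' \ox b <- comul K k)
      \tsum_(k1 \ox k2 <- comul K k') (D (alpha K k1) \ox (b \ox (beta K k2 \ox m)))).
      apply: eq_tlift => k m; symmetry.
      by apply: (tsum_comulA (f := fun k1 k2 b =>
        (D (alpha K k1) \ox (b \ox (beta K k2 \ox m))))); mlin.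
    transitivity (\tsum_(k \ox m <- x) \tsum_(k' \ox b <- comul K k)
      \tsum_(k1 \ox k2 <- comul K k') (D (alpha K k2) \ox (b \ox (beta K k1 \ox m)))).
      apply: eq_tlift => k m; apply: eq_tlift => k' b.
      by apply: (tsum_alpha_beta (f := fun s t => (D s \ox (b \ox (t \ox m))))); mlin.
    transitivity (\tsum_(k \ox m <- x) \tsum_(k1 \ox k' <- comul K k)
      \tsum_(k2 \ox b <- comul K k') (D (alpha K k2) \ox (b \ox (beta K k1 \ox m)))).
      apply: eq_tlift => k m.
      by apply: (tsum_comulA (f := fun k1 k2 b =>
        (D (alpha K k2) \ox (b \ox (beta K k1 \ox m))))); mlin.
    rewrite (cotens_rcoSE (f := fun g s m => \tsum_(k2 \ox b <- comul K g)
      (D (alpha K k2) \ox (b \ox (s \ox m)))) xP); last by mlin.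
    symmetry; rewrite /D; tnorm; apply: eq_tlift => k m.
    rewrite [RHS]tlift_exchange; apply: eq_tlift => k1 k2; exact: tlift_exchange.
  apply: tens_cotens_mulI.
  transitivity (\tsum_(k \ox m <- x) \tsum_(k1 \ox k2 <- comul K k)
    \tsum_(a \ox e <- comul K (eta K (alpha K k1))) \tsum_(b \ox e2 <- comul K e)
     ((alpha K e2 \ox m) \ox (b \ox (beta K a \ox k2)))).
    tnorm; apply: eq_tlift => k m; apply: eq_tlift => k1 k2.
    by apply: (tsum_comulA (f := fun a b e2 =>
      ((alpha K e2 \ox m) \ox (b \ox (beta K a \ox k2))))); mlin.
  transitivity (\tsum_(k \ox m <- x) \tsum_(k1 \ox k2 <- comul K k)
    \tsum_(a \ox b <- comul K k1) \tsum_(e1 \ox e2 <- comul K (eta K (alpha K a)))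
     ((alpha K e2 \ox m) \ox (e1 \ox (alpha K b \ox k2)))).
    apply: eq_tlift => k m; apply: eq_tlift => k1 k2.
    rewrite (tsum_eta_beta (f := fun s k => \tsum_(e1 \ox e2 <- comul K k)
      ((alpha K e2 \ox m) \ox (e1 \ox (s \ox k2))))); last by mlin.
    by rewrite tsum_alpha_comul //; mlin.
  transitivity (\tsum_(k \ox m <- x) \tsum_(k1 \ox k' <- comul K k)
    \tsum_(a \ox b <- comul K k') \tsum_(e1 \ox e2 <- comul K (eta K (alpha K k1)))
     ((alpha K e2 \ox m) \ox (e1 \ox (alpha K a \ox b)))).
    apply: eq_tlift => k m.
    by apply: (tsum_comulA (f := fun k1 a b =>
      \tsum_(e1 \ox e2 <- comul K (eta K (alpha K k1)))
      ((alpha K e2 \ox m) \ox (e1 \ox (alpha K a \ox b))))); mlin.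
  by tnorm; do 2![apply: eq_tlift => ? ?]; exact: tlift_exchange.
have z2P : z2 \in tens_sub (cotens (rcoS K) (lcoS K)).
  apply: tens_cotens_mulI.
  transitivity (\tsum_(k \ox m <- x) \tsum_(k1 \ox k2 <- comul K k)
    \tsum_(a \ox b <- comul K k1) (m \ox (eta K (alpha K a) \ox (alpha K b \ox k2)))).
    tnorm; do 2![apply: eq_tlift => ? ?].
    rewrite (tsum_eta_beta (f := fun s k => (_ \ox (k \ox (s \ox _))))); last by mlin.
    by rewrite tsum_alpha_comul //; mlin.
  transitivity (\tsum_(k \ox m <- x) \tsum_(k1 \ox k' <- comul K k)
    \tsum_(a \ox b <- comul K k') (m \ox (eta K (alpha K k1) \ox (alpha K a \ox b)))).
    apply: eq_tlift => k m.
    by apply: (tsum_comulA (f := fun k1 a b =>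
      (m \ox (eta K (alpha K k1) \ox (alpha K a \ox b))))); mlin.
  by tnorm.
transitivity (\tsum_(c \ox p <- z1) \tsum_(g \ox q <- p) \tsum_(h \ox m <- q)
    ((g ▷ (h ▷ m)) \ox c)).
  by tnorm.
rewrite -(tsum_act_assoc (f := fun c y => y \ox c) _ z1P); last by mlin.
transitivity (\tsum_(m \ox p <- z2) \tsum_(g \ox h <- p) \tsum_(g1 \ox g2 <- comul K g)
    (((g1 ∙ h) ▷ m) \ox beta K g2)).
  tnorm; do 2![apply: eq_tlift => ? ?].
  by apply: (tsum_eta_alpha_beta (f := fun k s => ((k ∙ _) ▷ _) \ox s)); mlin.
transitivity (\tsum_(m \ox p <- z2) \tsum_(g \ox h <- p) \tsum_(h1 \ox h2 <- comul K h)
    (((g ∙ h1) ▷ m) \ox alpha K h2)).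
  apply: (tens_sub_eq z2P) => [||m p pP]; [by mlin|by mlin|].
  symmetry.
  by apply: (tsum_mul_alpha_beta pP (f := fun k s => (k ▷ m) \ox s)); mlin.
tnorm; apply: eq_tlift => k m.
rewrite -(tsum_comulA (f := fun k1 h1 h2 =>
  ((eta K (alpha K k1) ∙ h1) ▷ m) \ox alpha K h2)); last by mlin.
apply: eq_tlift => k1 k2; rewrite -[in RHS](eta_alphaK axK k1).
by symmetry; tnorm.
Qed.

End CanonicalCoaction.

Section Nu.
Variables (F : fieldType) (S : coalgebra F) (K : hopf_coalgebra S).

Lemma nu_tens (k k' : K) : nu (k \ox k') = \tsum_(a \ox b <- comul K k') (bmul k a \ox b).
Proof. by rewrite /nu tlift_tens //; exact: nu_bilinear. Qed.

(** [nuinv] is an extension obtained by choice; injectivity of [nu] on the cotensor product pins it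
    down on these values, the ones at which it gets evaluated. *)
Lemma nuK (z : K ⊗ K) : z \in cotens (rcoS K) (lcoS K) -> nuinv K (nu z) = z.
Proof.
move=> zP; rewrite /nuinv.
have inj : injective
   ([the {linear _ -> _} of @nu _ _ K] \o
     [the {linear subsp (cotens (rcoS K) (lcoS K)) -> K ⊗ K} of val]).
  move=> x y /= E; apply: val_inj.
  have [_ ninj _] := nu_bij K.
  by apply: ninj E; rewrite inE; [exact: (proj2_sig x)|exact: (proj2_sig y)].
exact: (lextE [the {linear subsp (cotens (rcoS K) (lcoS K)) -> K ⊗ K} of val]
  (exist _ z zP : subsp (cotens (rcoS K) (lcoS K))) inj).
Qed.

End Nu.

Section AydModule.
Variables (F : fieldType) (S : coalgebra F) (K : hopf_coalgebra S) (M : ayd_module K).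
Local Notation "k ▷ m" := (bact k m) (at level 41, right associativity).
Local Notation rho := (mc_rco M).
Local Notation lam := (mo_lcoS M).
Implicit Type V : lmodType F.

Lemma tsum_rcoA V (m : M) (f : M -> K -> K -> V) : trilinear_map f ->
  \tsum_(m' \ox k <- rho m) \tsum_(m0 \ox l <- rho m') f m0 l k =
  \tsum_(m0 \ox k <- rho m) \tsum_(a \ox b <- comul K k) f m0 a b.
Proof. exact/tsum_coassoc/(proj1 (mc_right_comodule M)). Qed.
Arguments tsum_rcoA {V m f}.

Lemma tsum_rco_counit V (m : M) (f : M -> V) : linear f ->
  \tsum_(m0 \ox k <- rho m) ((counit K k : F) *: f m0) = f m.
Proof.
move=> hf; rewrite -[in RHS](proj2 (mc_right_comodule M) m) linear_tsum //.
by apply: eq_tlift => a b; rewrite (GRing.scalable_linear hf).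
Qed.

Lemma tsum_induced_rcoS V (m : M) (f : M -> S -> V) : bilinear_map f ->
  tlift f (induced_rcoS M m) = \tsum_(m0 \ox k <- rho m) f m0 (beta K k).
Proof. by move=> hf; rewrite /induced_rcoS /= tlift_tmap. Qed.

Lemma rco_cotens (m : M) : rho m \in cotens (induced_rcoS M) (lcoScop K).
Proof.
apply: cotensI.
transitivity (\tsum_(m' \ox k <- rho m) \tsum_(m0 \ox l <- rho m') (m0 \ox (beta K l \ox k))).
  by apply: eq_tlift => m' k; rewrite tsum_induced_rcoS //; mlin.
rewrite (tsum_rcoA (f := fun m0 l k => m0 \ox (beta K l \ox k))); last by mlin.
by apply: eq_tlift => m0 k; rewrite tsum_lcoScop //; mlin.
Qed.

Lemma rco_cotens_swap (m : M) : tswap (rho m) \in cotens (rcoS K) lam.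
Proof. exact/(ayd_defl (ayd_ax M))/rco_cotens. Qed.

(* Definedness of k |> m on m (x) k = m_<0> (x) m_<1> forces the left S-coaction
   of M to be the flip of the induced right one. *)
Lemma induced_rcoS_swap (m : M) : induced_rcoS M m = tswap (lam m).
Proof.
(* Applying the counit to the K factor leaves one S-coaction of M on each side of the cotensor
   condition. *)
have := cotens_rcoSE (f := fun g s m => (counit K g : F) *: (m \ox s)) (rco_cotens_swap m).
rewrite !tlift_tswap; [|by mlin..]; move=> E.
transitivity (\tsum_(m0 \ox k <- rho m) (m0 \ox beta K k)).
  by rewrite -[LHS]tlift_id tsum_induced_rcoS //; mlin.
transitivity (\tsum_(m0 \ox k <- rho m) \tsum_(k1 \ox k2 <- comul K k)
   ((counit K k2 : F) *: (m0 \ox beta K k1))).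
  by apply: eq_tlift => m0 k; rewrite (tsum_counitr _ (f := fun k => m0 \ox beta K k)) //; mlin.
rewrite E; last by mlin.
transitivity (\tsum_(m0 \ox k <- rho m) ((counit K k : F) *: tswap (lam m0))).
  apply: eq_tlift => m0 k; tens_ext (lam m0) => s y.
  by rewrite tswapE tlift_tens //; mlin.
by rewrite tsum_rco_counit //; mlin.
Qed.

Lemma canonical_rcoS_swap (m : M) : canonical_rcoS m = tswap (lam m).
Proof. by rewrite -(ayd_coactions (ayd_ax M)) induced_rcoS_swap. Qed.

Lemma tsum_lam_beta V (m : M) (f : S -> M -> V) : bilinear_map f ->
  tlift f (lam m) = \tsum_(m0 \ox k <- rho m) f (beta K k) m0.
Proof.
move=> hf; have hf' : bilinear_map (fun u v => f v u) by case: hf.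
by rewrite -(tlift_tswap (f := fun u v => f v u)) // -induced_rcoS_swap tsum_induced_rcoS.
Qed.

Hypothesis M_stable : stable M.

(** Stability writes m as m<1> ▷ m<0>, whose canonical coaction is known by [canonical_rcoS_act];
    coassociativity then isolates a second copy of m<1> ▷ m<0>, and stability contracts it. *)
Lemma tsum_lam_alpha V (m : M) (f : S -> M -> V) : bilinear_map f ->
  tlift f (lam m) = \tsum_(m0 \ox k <- rho m) f (alpha K k) m0.
Proof.
move=> hf; have hf' : bilinear_map (fun u v => f v u) by case: hf.
have stab m' : pact M (tswap (rho m')) = m'.
  by rewrite -pactE tlift_tswap ?M_stable //; mlin.
rewrite -(tlift_tswap (f := fun u v => f v u)) // -canonical_rcoS_swap.
rewrite -[in LHS](stab m) canonical_rcoS_act; last exact: rco_cotens_swap.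
rewrite tlift_tswap; last by mlin.
rewrite -(tsum_rcoA (f := fun m0 l k => (l ▷ m0) \ox alpha K k)); last by mlin.
apply: etrans; [tnf|]; apply: eq_tlift => m' k.
rewrite -[in RHS](M_stable m').
by rewrite (linear_tsum (L := fun y => f (alpha K k) y)) //; mlin.
Qed.

End AydModule.
Arguments tsum_rcoA {F S K M V m f}.
Arguments tsum_lam_alpha {F S K M} M_stable {V m f}.
Arguments tsum_lam_beta {F S K M V m f}.

(** * The rotation of cochains *)

Section Cyclic.
Variables (F : fieldType) (S : coalgebra F) (K : hopf_coalgebra S).
Variables (T : comodule_coalgebra K) (M : ayd_module K).
Hypothesis M_stable : stable M.
Local Notation "g ∙ h" := (bmul g h) (at level 40, left associativity).
Local Notation "k ▷ m" := (bact k m) (at level 41, right associativity).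
Local Notation rho := (mc_rco M).
Local Notation lam := (mo_lcoS M).
Local Notation lco := (cc_lco T).
Local Notation tlco := (tpow_lco T).
Local Notation cotpow n := (@cotpow F S K T n).
Local Notation rot := (tpow_rot T).
Local Hint Extern 1 => first [exact: tpow_lco_rot_linear | exact: tpow_lco_split_linear] : mlin.

(* [act0] acts with the coaction of the first factor; [cyc] is the inverse of
   the cyclic operator: it moves the last factor to the front, then acts. *)
Definition act0 n : M ⊗ tpow T n -> M ⊗ tpow T n :=
  match n return M ⊗ tpow T n -> M ⊗ tpow T n with
  | 0 => fun z => \tsum_(m \ox t <- z) \tsum_(k \ox x <- lco t) ((k ▷ m) \ox x)
  | n'.+1 => fun z => \tsum_(m \ox w <- z) \tsum_(t \ox y <- (w : T ⊗ tpow T n'))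
      \tsum_(k \ox x <- lco t) ((k ▷ m) \ox (x \ox y : tpow T n'.+1))
  end.

Lemma act0_linear n : linear (@act0 n).
Proof. by case: n => [|n] /=; mlin. Qed.

HB.instance Definition _ n := GRing.isLinear.Build F (M ⊗ tpow T n) (M ⊗ tpow T n) _
  (@act0 n) (@act0_linear n).

Definition cyc n : {linear M ⊗ tpow T n -> M ⊗ tpow T n} := @act0 n \o tmap idfun (rot n).

Lemma cycE n (z : M ⊗ tpow T n.+1) : cyc n.+1 z =
  \tsum_(m \ox w <- z) \tsum_(t \ox x <- (rot n.+1 w : T ⊗ tpow T n))
  \tsum_(k \ox t0 <- lco t) ((k ▷ m) \ox (t0 \ox x : tpow T n.+1)).
Proof. by rewrite /cyc /= tlift_tmap //; mlin. Qed.

Section Cochain.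
Variables (n : nat) (z : M ⊗ tpow T n).
Hypothesis zP : z \in @cochain_pred F S K T M n.

Let z1 : z \in tens_sub (cotpow n). Proof. by case/andP: zP. Qed.
Let z2 : z \in cotens rho (tlco n). Proof. by case/andP: zP. Qed.

Lemma cochain_act : \tsum_(m \ox x <- z) \tsum_(k \ox x0 <- tlco n x) ((k ▷ m) \ox x0) = z.
Proof.
rewrite -(cotensE (f := fun m k x => (k ▷ m) \ox x) z2); last by mlin.
rewrite -[RHS]tlift_id; apply: eq_tlift => m x.
rewrite -[in RHS](M_stable m).
by rewrite (linear_tsum (L := fun y => y \ox x)) //; mlin.
Qed.

(** The coaction of M is [alpha] of m<1>, and the cotensor condition over K makes this [alpha] of
    the K factor of the tensor, that is its left S-coaction. With [cochain_rcoS], the analogue for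
    [beta], the module closes the row of factors into a circle over S. *)
Lemma cochain_lcoS :
  \tsum_(m \ox x <- z) \tsum_(s \ox m0 <- lam m) (s \ox (m0 \ox x)) =
  \tsum_(m \ox x <- z) \tsum_(s \ox x' <- tpow_lcoS T n x) (s \ox (m \ox x')).
Proof.
transitivity (\tsum_(m \ox x <- z) \tsum_(m0 \ox k <- rho m) (alpha K k \ox (m0 \ox x))).
  apply: eq_tlift => m x.
  by rewrite (tsum_lam_alpha M_stable (f := fun s m0 => s \ox (m0 \ox x))) //; mlin.
rewrite (cotensE (f := fun m k x => alpha K k \ox (m \ox x)) z2); last by mlin.
apply: (tens_sub_eq z1) => [||m x xP]; [by mlin|by mlin|].
by rewrite -tpow_lcoS_alpha //; tnorm.
Qed.

Lemma cochain_rcoS :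
  \tsum_(m \ox x <- z) \tsum_(s \ox m0 <- lam m) (s \ox (m0 \ox x)) =
  \tsum_(m \ox x <- z) \tsum_(s \ox x' <- tpow_rcoS T n x) (s \ox (m \ox x')).
Proof.
transitivity (\tsum_(m \ox x <- z) \tsum_(m0 \ox k <- rho m) (beta K k \ox (m0 \ox x))).
  apply: eq_tlift => m x.
  by rewrite (tsum_lam_beta (f := fun s m0 => s \ox (m0 \ox x))) //; mlin.
rewrite (cotensE (f := fun m k x => beta K k \ox (m \ox x)) z2); last by mlin.
apply: (tens_sub_eq z1) => [||m x xP]; [by mlin|by mlin|].
by rewrite -tpow_rcoS_beta //; tnorm.
Qed.

End Cochain.

(** * Rotation preserves cochains in positive degree *)

Section Step.
Variables (n : nat) (z : M ⊗ tpow T n.+1).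
Hypothesis zP : z \in @cochain_pred F S K T M n.+1.

Let z1 : z \in tens_sub (cotpow n.+1). Proof. by case/andP: zP. Qed.
Let z2 : z \in cotens rho (tlco n.+1). Proof. by case/andP: zP. Qed.

Let zr : M ⊗ (T ⊗ tpow T n) := \tsum_(m \ox w <- z) (m \ox (rot n.+1 w : T ⊗ tpow T n)).

(** This and the next two facts carry [cochain_rcoS], [cochain_lcoS] and the cotensor condition over
    K through the rotation, before the new head acts. *)
Let zr_rcoS :
  \tsum_(m \ox v <- zr) \tsum_(t \ox x <- v) \tsum_(s \ox m0 <- lam m) (s \ox (m0 \ox (t \ox x))) =
  \tsum_(m \ox v <- zr) \tsum_(t \ox x <- v) \tsum_(k \ox t0 <- lco t)
    (beta K k \ox (m \ox (t0 \ox x))).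
Proof.
transitivity (\tsum_(s \ox p <- \tsum_(m \ox x <- z) \tsum_(s \ox m0 <- lam m)
   (s \ox (m0 \ox x))) \tsum_(m \ox w <- p) (s \ox (m \ox (rot n.+1 w : T ⊗ tpow T n)))).
  tnorm; apply: eq_tlift => m w; rewrite tlift_exchange; apply: eq_tlift => s m0.
  rewrite -[in RHS](tlift_id (rot n.+1 w : T ⊗ tpow T n)); symmetry; tnorm; by [].
rewrite (cochain_rcoS zP).
transitivity (\tsum_(m \ox w <- z) \tsum_(s \ox v <- \tsum_(s \ox v <- tpow_rcoS T n.+1 w)
   (s \ox rot n.+1 v)) (s \ox (m \ox v))).
  by tnorm.
transitivity (\tsum_(m \ox w <- z) \tsum_(s \ox v <-
   \tsum_(t \ox x <- (rot n.+1 w : T ⊗ tpow T n)) \tsum_(k \ox t0 <- lco t)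
     (beta K k \ox (t0 \ox x : tpow T n.+1))) (s \ox (m \ox v))).
  by apply: eq_tlift => m w; rewrite tpow_rot_rcoS.
by rewrite /zr; tnorm.
Qed.

Let zr_lcoS :
  \tsum_(m \ox v <- zr) \tsum_(t \ox x <- v) \tsum_(s \ox m0 <- lam m) (s \ox (m0 \ox (t \ox x))) =
  \tsum_(m \ox v <- zr) \tsum_(t \ox x <- v) \tsum_(s \ox x' <- tpow_lcoS T n x)
    (s \ox (m \ox (t \ox x'))).
Proof.
transitivity (\tsum_(s \ox p <- \tsum_(m \ox x <- z) \tsum_(s \ox m0 <- lam m)
   (s \ox (m0 \ox x))) \tsum_(m \ox w <- p) (s \ox (m \ox (rot n.+1 w : T ⊗ tpow T n)))).
  tnorm; apply: eq_tlift => m w; rewrite tlift_exchange; apply: eq_tlift => s m0.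
  rewrite -[in RHS](tlift_id (rot n.+1 w : T ⊗ tpow T n)); symmetry; tnorm; by [].
rewrite (cochain_lcoS zP).
transitivity (\tsum_(m \ox w <- z) \tsum_(s \ox v <- \tsum_(s \ox v <- tpow_lcoS T n.+1 w)
   (s \ox rot n.+1 v)) (s \ox (m \ox v))).
  by tnorm.
transitivity (\tsum_(m \ox w <- z) \tsum_(s \ox v <-
   \tsum_(t \ox x <- (rot n.+1 w : T ⊗ tpow T n)) \tsum_(s \ox x' <- tpow_lcoS T n x)
     (s \ox (t \ox x' : tpow T n.+1))) (s \ox (m \ox v))).
  by apply: eq_tlift => m w; rewrite tpow_rot_lcoS.
by rewrite /zr; tnorm.
Qed.

Let zr_rco :
  \tsum_(m \ox v <- zr) \tsum_(t \ox x <- v) \tsum_(m0 \ox k <- rho m)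
    (m0 \ox (k \ox (t \ox x))) =
  \tsum_(m \ox v <- zr) \tsum_(t \ox x <- v) \tsum_(a \ox t0 <- lco t)
    \tsum_(b \ox x0 <- tlco n x) (m \ox (b ∙ a \ox (t0 \ox x0))).
Proof.
transitivity (\tsum_(m \ox w <- z) \tsum_(m0 \ox k <- rho m)
   (m0 \ox (k \ox (rot n.+1 w : T ⊗ tpow T n)))).
  rewrite /zr; tnorm; apply: eq_tlift => m w; rewrite tlift_exchange; apply: eq_tlift => s m0.
  rewrite -[in RHS](tlift_id (rot n.+1 w : T ⊗ tpow T n)); symmetry; tnorm; by [].
rewrite (cotensE (f := fun m k w => m \ox (k \ox (rot n.+1 w : T ⊗ tpow T n))) z2); last by mlin.
transitivity (\tsum_(m \ox w <- z) \tsum_(k \ox v <- \tsum_(k \ox v <- tlco n.+1 w)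
   (k \ox rot n.+1 v)) (m \ox (k \ox v))).
  by tnorm.
transitivity (\tsum_(m \ox w <- z) \tsum_(k \ox v <-
  \tsum_(t \ox x <- (rot n.+1 w : T ⊗ tpow T n)) \tsum_(a \ox t0 <- lco t)
    \tsum_(b \ox x0 <- tlco n x) (b ∙ a \ox (t0 \ox x0 : tpow T n.+1))) (m \ox (k \ox v))).
  apply: (tens_sub_eq z1) => [||m w wP]; [by mlin|by mlin|].
  by rewrite tpow_rot_lco.
by rewrite /zr; tnorm.
Qed.

Let zact := \tsum_(m \ox v <- zr) \tsum_(t \ox x <- v) \tsum_(k \ox t0 <- lco t)
  ((t0 \ox x) \ox (k \ox m)).

Let zactP : zact \in tens_sub (cotens (rcoS K) lam).
Proof.
apply: tens_cotens_rcoSI.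
transitivity (\tsum_(m \ox v <- zr) \tsum_(t \ox x <- v) \tsum_(k \ox t' <- lco t)
  \tsum_(a \ox t0 <- lco t') ((t0 \ox x) \ox (a \ox (beta K k \ox m)))).
  rewrite /zact; tnorm; do 2![apply: eq_tlift => ? ?].
  by apply: (tsum_lcoA (f := fun a1 a2 t0 =>
    ((t0 \ox _) \ox (a2 \ox (beta K a1 \ox _))))); mlin.
transitivity (\tsum_(s \ox p <- \tsum_(m \ox v <- zr) \tsum_(t \ox x <- v)
   \tsum_(k \ox t0 <- lco t) (beta K k \ox (m \ox (t0 \ox x))))
   \tsum_(m \ox v <- p) \tsum_(t \ox x <- v) \tsum_(a \ox t0 <- lco t)
    ((t0 \ox x) \ox (a \ox (s \ox m)))).
  by tnorm.
rewrite -zr_rcoS /zact; tnorm; do 2![apply: eq_tlift => ? ?]; exact: tlift_exchange.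
Qed.

(** The acting pair in the order that [ayd_compat] requires; in [zact] it stands in the order of the
    action. *)
Let zcop := \tsum_(m \ox v <- zr) \tsum_(t \ox x <- v) \tsum_(k \ox t0 <- lco t)
  ((t0 \ox x) \ox (m \ox k)).

Let zcopP : zcop \in tens_sub (cotens (induced_rcoS M) (lcoScop K)).
Proof.
apply: tens_cotensI.
transitivity (\tsum_(s \ox p <- \tsum_(m \ox v <- zr) \tsum_(t \ox x <- v)
   \tsum_(s \ox m0 <- lam m) (s \ox (m0 \ox (t \ox x))))
   \tsum_(m \ox v <- p) \tsum_(t \ox x <- v) \tsum_(a \ox t0 <- lco t)
    ((t0 \ox x) \ox (m \ox (s \ox a)))).
  rewrite /zcop; tnorm; do 2![apply: eq_tlift => ? ?].
  rewrite [RHS]tlift_exchange; apply: eq_tlift => ? ?.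
  by rewrite induced_rcoS_swap tlift_tswap //; mlin.
rewrite zr_rcoS /zcop; tnorm; do 2![apply: eq_tlift => ? ?].
rewrite -(tsum_lcoA (f := fun a1 a2 t0 =>
    ((t0 \ox _) \ox (_ \ox (beta K a1 \ox a2))))); last by mlin.
by apply: eq_tlift => a t0; rewrite tsum_lcoScop //; mlin.
Qed.

Let zrP : zr \in tens_sub (tens_sub (cotpow n)).
Proof.
rewrite /zr; apply: (tens_sub_tsum z1); [exact: tens_sub_closed|by mlin|].
by move=> m w wP; apply: tens_sub_tens; exact: tpow_rot_tens_sub.
Qed.

Let cycE' : cyc n.+1 z = \tsum_(m \ox v <- zr) \tsum_(t \ox x <- v)
  \tsum_(k \ox t0 <- lco t) ((k ▷ m) \ox (t0 \ox x : tpow T n.+1)).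
Proof. by rewrite cycE /zr; tnorm. Qed.

(** The new condition is the one between the head and the old first factor. The leg [beta] of the
    head is moved onto M by [tsum_act_beta], and from M to the tail by [zr_lcoS]. *)
Let cyc_tens_sub : cyc n.+1 z \in tens_sub (cotpow n.+1).
Proof.
apply/tens_subP => [|phi]; first exact: cotpow_closed.
have sE : slice phi (cyc n.+1 z) = \tsum_(m \ox v <- zr) \tsum_(t \ox x <- v)
    \tsum_(k \ox t0 <- lco t) (((phi (k ▷ m) : F) *: t0) \ox x : tpow T n.+1).
  rewrite cycE' slice_tsum; apply: eq_tlift => m v; rewrite slice_tsum.
  apply: eq_tlift => t x; rewrite slice_tsum; apply: eq_tlift => k t0.
  by rewrite slice_tens tensZl.
rewrite sE; apply/andP; split.
  apply: (tens_sub_tlift zrP); [exact: tens_sub_closed|by mlin|].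
  move=> m v vP; apply: (tens_sub_tlift vP); [exact: tens_sub_closed|by mlin|].
  move=> t x xP.
  rewrite -(linear_tsum (L := fun t => t \ox x)); last by mlin.
  exact: tens_sub_tens.
apply: cotensI.
transitivity (\tsum_(m \ox v <- zr) \tsum_(t \ox x <- v) \tsum_(k \ox t' <- lco t)
  \tsum_(l \ox t0 <- lco t') ((phi (k ▷ m) : F) *: (t0 \ox (beta K l \ox x)))).
  tnorm; do 3![apply: eq_tlift => ? ?].
  rewrite tsum_cc_rcoS; last by mlin.
  rewrite linearZ (GRing.scalable_linear (tlift_linear _)) /=; last by mlin.
  by rewrite (linear_tsum (L := fun v => _ *: v)) //; mlin.
transitivity (\tsum_(c \ox p <- zact) \tsum_(t0 \ox x <- c) \tsum_(k \ox m <- p)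
  \tsum_(k1 \ox k2 <- comul K k) ((phi (k1 ▷ m) : F) *: (t0 \ox (beta K k2 \ox x)))).
  rewrite /zact; tnorm; do 2![apply: eq_tlift => ? ?]; symmetry.
  by apply: (tsum_lcoA (f := fun a b t0 =>
    ((phi (a ▷ _) : F) *: (t0 \ox (beta K b \ox _))))); mlin.
transitivity (\tsum_(c \ox p <- zact) \tsum_(t0 \ox x <- c) \tsum_(k \ox m <- p)
  \tsum_(s \ox m0 <- lam m) ((phi (k ▷ m0) : F) *: (t0 \ox (s \ox x)))).
  apply: (tens_sub_eq zactP) => [||c p pP]; [by mlin|by mlin|].
  apply: eq_tlift => t0 x; symmetry.
  apply: (tsum_act_beta (f := fun y s => ((phi y : F) *: (t0 \ox (s \ox x))))) => //.
  - exact: canonical_rcoS_swap.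
  - by mlin.
transitivity (\tsum_(s \ox p <- \tsum_(m \ox v <- zr) \tsum_(t \ox x <- v)
   \tsum_(s \ox m0 <- lam m) (s \ox (m0 \ox (t \ox x))))
   \tsum_(m \ox v <- p) \tsum_(t \ox x <- v) \tsum_(k \ox t0 <- lco t)
     ((phi (k ▷ m) : F) *: (t0 \ox (s \ox x)))).
  rewrite /zact; tnorm; do 2![apply: eq_tlift => ? ?]; exact: tlift_exchange.
rewrite zr_lcoS; tnorm; do 2![apply: eq_tlift => ? ?].
rewrite tlift_exchange; do 2![apply: eq_tlift => ? ?].
by rewrite tensZl.
Qed.

(** Once nu^-1 is evaluated, the anti-Yetter-Drinfeld formula reads (a ▷ m) ⊗ (k2 ∙ b): the head
    acts by [a] and puts its other leg [k2] in front of the factor [b] of the tail, which is the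
    coaction of the rotated tensor. *)
Let cyc_cotens : cyc n.+1 z \in cotens rho (tlco n.+1).
Proof.
apply: cotensI; rewrite cycE'.
transitivity (\tsum_(c \ox p <- zcop) \tsum_(m0 \ox k <- rho (pact M (tswap p)))
   (m0 \ox (k \ox c))).
  rewrite /zcop; tnorm; do 3![apply: eq_tlift => ? ?].
  by rewrite tswapE.
transitivity (\tsum_(c \ox p <- zcop) \tsum_(m \ox k <- p)
   \tsum_(m0 \ox m1 <- rho m) \tsum_(k1 \ox k2 <- comul K k)
   \tsum_(q \ox r <- nuinv K (m1 \ox k1)) ((r ▷ m0) \ox (k2 ∙ q \ox c))).
  apply: (tens_sub_eq zcopP) => [||c p pP]; [by mlin|by mlin|].
  rewrite -pactE tlift_tswap; last by mlin.
  rewrite (ayd_compat (ayd_ax M)) //.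
  by tnorm.
transitivity (\tsum_(m0 \ox p <- \tsum_(m \ox v <- zr) \tsum_(t \ox x <- v)
   \tsum_(m0 \ox k <- rho m) (m0 \ox (k \ox (t \ox x))))
   \tsum_(m1 \ox v <- p) \tsum_(t \ox x <- v) \tsum_(k \ox t0 <- lco t)
   \tsum_(k1 \ox k2 <- comul K k)
   \tsum_(q \ox r <- nuinv K (m1 \ox k1)) ((r ▷ m0) \ox (k2 ∙ q \ox (t0 \ox x)))).
  rewrite /zcop; tnorm; do 2![apply: eq_tlift => ? ?]; exact: tlift_exchange.
rewrite zr_rco.
transitivity (\tsum_(m \ox v <- zr) \tsum_(c \ox p <- tpow_lco_rot v)
   \tsum_(t0 \ox x0 <- c) \tsum_(k2 \ox t1 <- lco t0)
   \tsum_(q \ox r <- nuinv K (nu p)) ((r ▷ m) \ox (k2 ∙ q \ox (t1 \ox x0)))).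
  rewrite /tpow_lco_rot; tnorm; apply: eq_tlift => m v; apply: eq_tlift => t x.
  rewrite [LHS]tlift_exchange [RHS]tlift_exchange; apply: eq_tlift => b x0.
  (* The head contributes three legs [a], [k1], [k2]. Coassociativity regroups them so that [a] and
     [k1] are the legs of one [l], which makes [b ∙ a \ox k1] the value of [nu] at [b \ox l]. *)
  rewrite -(tsum_lcoA (f := fun a k t1 => \tsum_(k1 \ox k2 <- comul K k)
    \tsum_(q \ox r <- nuinv K (b ∙ a \ox k1)) ((r ▷ m) \ox (k2 ∙ q \ox (t1 \ox x0)))));
    last by mlin.
  transitivity (\tsum_(k \ox t1 <- lco t) \tsum_(l \ox k2 <- comul K k)
    \tsum_(a \ox k1 <- comul K l) \tsum_(q \ox r <- nuinv K (b ∙ a \ox k1))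
     ((r ▷ m) \ox (k2 ∙ q \ox (t1 \ox x0)))).
    apply: eq_tlift => k t1; symmetry.
    by apply: (tsum_comulA (f := fun a k1 k2 => \tsum_(q \ox r <- nuinv K (b ∙ a \ox k1))
      ((r ▷ m) \ox (k2 ∙ q \ox (t1 \ox x0))))); mlin.
  rewrite (tsum_lcoA (f := fun l k2 t1 => \tsum_(a \ox k1 <- comul K l)
    \tsum_(q \ox r <- nuinv K (b ∙ a \ox k1)) ((r ▷ m) \ox (k2 ∙ q \ox (t1 \ox x0)))));
    last by mlin.
  apply: eq_tlift => l t0; apply: eq_tlift => k2 t1.
  rewrite nu_tens (linear_tsum (L := nuinv K)) ?tlift_tlift //; by mlin.
transitivity (\tsum_(m \ox v <- zr) \tsum_(c \ox p <- tpow_lco_rot v)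
   \tsum_(t0 \ox x0 <- c) \tsum_(k2 \ox t1 <- lco t0)
   \tsum_(q \ox r <- p) ((r ▷ m) \ox (k2 ∙ q \ox (t1 \ox x0)))).
  rewrite /zr !tlift_tlift; [|by mlin..].
  apply: (tens_sub_eq z1) => [||m w wP]; [by mlin|by mlin|].
  rewrite !tlift_tens; [|by mlin..].
  apply: (tens_sub_eq (tpow_lco_rot_cotens wP)) => [||c p pP]; [by mlin|by mlin|].
  by rewrite nuK.
rewrite /tpow_lco_rot; tnorm; do 3![apply: eq_tlift => ? ?].
rewrite tlift_exchange [RHS](tsum_tpow_lco (n := n)); last by mlin.
by rewrite tlift_tens //; mlin.
Qed.

Lemma cyc_cochain_step : cyc n.+1 z \in @cochain_pred F S K T M n.+1.
Proof. exact/andP. Qed.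

End Step.

Lemma cyc0_cochain (z : M ⊗ tpow T 0) : z \in @cochain_pred F S K T M 0 -> cyc 0 z = z.
Proof.
move=> zP; rewrite -[RHS](cochain_act zP) /cyc /= tlift_tmap //; by mlin.
Qed.

Lemma cyc_cochain n (z : M ⊗ tpow T n) :
  z \in @cochain_pred F S K T M n -> cyc n z \in @cochain_pred F S K T M n.
Proof.
case: n z => [|n] z zP; last exact: cyc_cochain_step.
by rewrite cyc0_cochain.
Qed.

Lemma coface0_cochain n (z : M ⊗ tpow T n) :
  z \in @cochain_pred F S K T M n -> coface 0 z \in @cochain_pred F S K T M n.+1.
Proof.
case/andP=> z1 z2; apply/andP; split.
  apply: (tens_sub_tsum z1); [exact: cotpow_closed|by mlin|].
  by move=> m x xP; apply: tens_sub_tens; exact: tpow_comul0_cotpow.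
apply: cotensI; rewrite /coface.
transitivity (\tsum_(m \ox x <- z) \tsum_(m0 \ox k <- rho m)
   (m0 \ox (k \ox (tpow_comul 0 x : tpow T n.+1)))).
  by tnorm.
rewrite (cotensE (f := fun m k x => m \ox (k \ox (tpow_comul 0 x : tpow T n.+1))) z2);
  last by mlin.
rewrite [RHS]tlift_tlift; last by mlin.
apply: (tens_sub_eq z1) => [||m x xP]; [by mlin|by mlin|].
rewrite [RHS]tlift_tens; last by mlin.
by rewrite tpow_comul0_lco //; symmetry; tnorm.
Qed.

Definition extra_codegeneracy n (z : M ⊗ tpow T n.+1) : M ⊗ tpow T n :=
  \tsum_(m \ox x <- z) (m \ox tpow_drop T n x).

Lemma extra_codegeneracy_cochain n (z : M ⊗ tpow T n.+1) :
  z \in @cochain_pred F S K T M n.+1 -> extra_codegeneracy z \in @cochain_pred F S K T M n.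
Proof.
case/andP=> z1 z2; apply/andP; split.
  apply: (tens_sub_tsum z1); [exact: cotpow_closed|by mlin|].
  by move=> m x xP; apply: tens_sub_tens; exact: tpow_drop_cotpow.
apply: cotensI; rewrite /extra_codegeneracy.
transitivity (\tsum_(m \ox x <- z) \tsum_(m0 \ox k <- rho m) (m0 \ox (k \ox tpow_drop T n x))).
  by tnorm.
rewrite (cotensE (f := fun m k x => m \ox (k \ox tpow_drop T n x)) z2); last by mlin.
rewrite [RHS]tlift_tlift; last by mlin.
apply: (tens_sub_eq z1) => [||m x xP]; [by mlin|by mlin|].
rewrite [RHS]tlift_tens; last by mlin.
by rewrite tpow_drop_lco //; symmetry; tnorm.
Qed.

End Cyclic.

(** * Powers of the rotation *)

Section Iterates.
Variables (F : fieldType) (S : coalgebra F) (K : hopf_coalgebra S).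
Variables (T : comodule_coalgebra K) (M : ayd_module K).
Local Notation "k ▷ m" := (bact k m) (at level 41, right associativity).
Local Notation lam := (mo_lcoS M).
Local Notation lco := (cc_lco T).
Local Notation tlco := (tpow_lco T).
Local Notation cotpow n := (@cotpow F S K T n).
Local Notation rot := (tpow_rot T).
Local Notation cyc := (@cyc F S K T M).
Implicit Type V : lmodType F.
Local Hint Extern 1 => first [exact: tpow_lco_rot_linear | exact: tpow_lco_split_linear] : mlin.
Local Hint Resolve tpow_ins_linearl tpow_ins_linearr : mlin.

(** The factors act one after the other, the last one first, with no product in K; this is what a
    full turn does on arbitrary tensors. *)
Fixpoint iter_act_fun n : M ⊗ tpow T n -> M ⊗ tpow T n :=
  match n return M ⊗ tpow T n -> M ⊗ tpow T n with
  | 0 => fun z => \tsum_(m \ox t <- z) \tsum_(k \ox x <- lco t) ((k ▷ m) \ox x)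
  | n'.+1 => fun z => \tsum_(m \ox w <- z) \tsum_(t \ox y <- (w : T ⊗ tpow T n'))
      \tsum_(m' \ox y' <- iter_act_fun (m \ox y))
      \tsum_(k \ox x <- lco t) ((k ▷ m') \ox (x \ox y' : tpow T n'.+1))
  end.

Lemma iter_act_linear n : linear (@iter_act_fun n).
Proof. by elim: n => [|n IHn] /=; mlin. Qed.

HB.instance Definition _ n := GRing.isLinear.Build F (M ⊗ tpow T n) (M ⊗ tpow T n) _
  (@iter_act_fun n) (@iter_act_linear n).
Definition iter_act n : {linear M ⊗ tpow T n -> M ⊗ tpow T n} := @iter_act_fun n.

Lemma iter_actE n (z : M ⊗ tpow T n.+1) : iter_act n.+1 z =
  \tsum_(m \ox w <- z) \tsum_(t \ox y <- (w : T ⊗ tpow T n))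
      \tsum_(m' \ox y' <- iter_act n (m \ox y))
      \tsum_(k \ox x <- lco t) ((k ▷ m') \ox (x \ox y' : tpow T n.+1)).
Proof. by []. Qed.

Lemma tpow_rot_last n t (y : tpow T n) :
  rot n.+1 (tpow_ins n.+1 t y) = (t \ox y : tpow T n.+1).
Proof.
elim: n y => [|n IHn] y; first by rewrite /= tlift_tens //; mlin.
tens_ext y => l y'.
by rewrite tpow_insS tpow_rot_tens IHn tpow_insS tpow_ins0.
Qed.

Lemma cyc_tens n m t (x : tpow T n) (w : tpow T n.+1) :
  rot n.+1 w = (t \ox x : tpow T n.+1) ->
  cyc n.+1 (m \ox w) = \tsum_(k \ox t0 <- lco t) ((k ▷ m) \ox (t0 \ox x : tpow T n.+1)).
Proof. by move=> E; rewrite cycE tlift_tens ?E ?tlift_tens //; mlin. Qed.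

Lemma cyc_ins n k t (z : M ⊗ tpow T n) : (k <= n)%N ->
  cyc n.+1 (\tsum_(m \ox y <- z) (m \ox tpow_ins k t y)) =
  \tsum_(m \ox y <- cyc n z) (m \ox tpow_ins k.+1 t y).
Proof.
move=> kn; tens_ext z => m y; rewrite tlift_tens; last by mlin.
rewrite cycE tlift_tens ?tpow_rot_ins //; last by mlin.
case: n {z} y kn => [|n] y kn.
  rewrite {1}/tpow_ins /= tlift_tens; last by mlin.
  rewrite /cyc /= tmapE /= tlift_tens; last by mlin.
  by symmetry; tnorm.
rewrite cycE tlift_tens; last by mlin.
tens_ext (rot n.+1 y) => l x.
rewrite tpow_insS !tlift_tens; [|by mlin..].
by symmetry; tnorm; apply: eq_tlift => a b; rewrite tpow_insS.
Qed.

(** Until it reaches the end, the factor [t] is a bystander: the rotations only turn the other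
    factors and push [t] one place further. *)
Lemma iter_cyc_ins n k t (z : M ⊗ tpow T n) : (k <= n.+1)%N ->
  iter k (cyc n.+1) (\tsum_(m \ox y <- z) (m \ox (t \ox y : tpow T n.+1))) =
  \tsum_(m \ox y <- iter k (cyc n) z) (m \ox tpow_ins k t y).
Proof.
elim: k => [_|k IHk kn] /=; first by apply: eq_tlift => m y; rewrite tpow_ins0.
by rewrite IHk ?(ltnW kn) //; exact: cyc_ins.
Qed.

Lemma iter_linear V (L : {linear V -> V}) k : linear (iter k L).
Proof. by elim: k => [//|k IHk] a x y; rewrite iterS IHk linearP. Qed.

(** In the induction step the tail makes its own full turn while the head drifts to the end; the one
    rotation left brings the head back to the front and lets it act. *)
Lemma iter_cyc n (z : M ⊗ tpow T n) : iter n.+1 (cyc n) z = iter_act n z.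
Proof.
elim: n z => [|n IHn] z; first by rewrite /= /cyc /= tlift_tmap //; mlin.
have iterL := @iter_linear _ (cyc n.+1).
have H := iterL n.+2.
tens_ext z => m w; tens_ext w => t y.
rewrite iter_actE tlift_tens; last by mlin.
rewrite tlift_tens; last by mlin.
have -> : m \ox (t \ox y : tpow T n.+1) =
    \tsum_(m \ox y <- m \ox y) (m \ox (t \ox y : tpow T n.+1)).
  by rewrite tlift_tens //; mlin.
rewrite iterS iter_cyc_ins // IHn.
rewrite (linear_tsum (L := cyc n.+1)); last by mlin.
by apply: eq_tlift => m' y'; rewrite (cyc_tens _ (tpow_rot_last t y')).
Qed.

Lemma iter_cyc_last n (z : M ⊗ tpow T n.+1) : iter n.+1 (cyc n.+1) z =
  \tsum_(m \ox w <- z) \tsum_(t \ox y <- (w : T ⊗ tpow T n))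
   \tsum_(m' \ox y' <- iter_act n (m \ox y)) (m' \ox tpow_ins n.+1 t y').
Proof.
have iterL := @iter_linear _ (cyc n.+1).
have H := iterL n.+1.
tens_ext z => m w; tens_ext w => t y.
rewrite tlift_tens; last by mlin.
rewrite tlift_tens; last by mlin.
have -> : m \ox (t \ox y : tpow T n.+1) =
    \tsum_(m \ox y <- m \ox y) (m \ox (t \ox y : tpow T n.+1)).
  by rewrite tlift_tens //; mlin.
by rewrite iter_cyc_ins // iter_cyc.
Qed.

(* What remains of the cochain conditions once the first factor has been split off; it
   suffices for all the factors to act. *)
Definition actionable n : {pred M ⊗ tpow T n} := fun z =>
  (z \in tens_sub (cotpow n)) &&
  (\tsum_(m \ox x <- z) \tsum_(s \ox m0 <- lam m) (s \ox (m0 \ox x)) ==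
   \tsum_(m \ox x <- z) \tsum_(s \ox x' <- tpow_rcoS T n x) (s \ox (m \ox x'))).

Lemma actionable_closed n : submod_closed (@actionable n).
Proof.
have [t0 tL] := tens_sub_closed M (cotpow n).
pose f1 := fun z : M ⊗ tpow T n =>
  \tsum_(m \ox x <- z) \tsum_(s \ox m0 <- lam m) (s \ox (m0 \ox x)).
pose f2 := fun z : M ⊗ tpow T n =>
  \tsum_(m \ox x <- z) \tsum_(s \ox x' <- tpow_rcoS T n x) (s \ox (m \ox x')).
have f1L : linear f1 by rewrite /f1; mlin.
have f2L : linear f2 by rewrite /f2; mlin.
have f10 : f1 0 = 0 by have := linear_sum_fun [::] id f1L; rewrite !big_nil.
have f20 : f2 0 = 0 by have := linear_sum_fun [::] id f2L; rewrite !big_nil.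
split=> [|a x y /andP[x1 /eqP x2] /andP[y1 /eqP y2]]; apply/andP; split.
- exact: t0.
- by apply/eqP; rewrite -/(f1 _) -/(f2 _) f10.
- exact: tL.
- by apply/eqP; rewrite -/(f1 _) -/(f2 _) f1L f2L /f1 /f2 x2 y2.
Qed.

Lemma cochain_actionable n (z : M ⊗ tpow T n) :
  z \in @cochain_pred F S K T M n -> z \in @actionable n.
Proof.
move=> zP; have /andP[z1 z2] := zP; apply/andP; split=> //.
by apply/eqP; exact: cochain_rcoS.
Qed.

(** [tpow_rcoS] works through the last factor, so a functional applied to the first one does not
    disturb the condition. *)
Lemma actionable_behead n (z : M ⊗ (T ⊗ tpow T n)) : z \in @actionable n.+1 ->
  \tsum_(m \ox w <- z) \tsum_(t \ox y <- w) (t \ox (m \ox y)) \in tens_sub (@actionable n).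
Proof.
move=> /andP[z1 /eqP z2]; apply/tens_subP => [|phi]; first exact: actionable_closed.
have -> : slice phi (\tsum_(m \ox w <- z) \tsum_(t \ox y <- w) (t \ox (m \ox y))) =
    tmap idfun (@slice F T (tpow T n) phi) z.
  tens_ext z => m w; rewrite tmapE tlift_tens; last by mlin.
  tens_ext w => t y; rewrite tlift_tens; last by mlin.
  by rewrite slice_tens -[RHS]/(m \ox slice phi (t \ox y)) slice_tens tensZr.
apply/andP; split.
  rewrite /tmap; apply: (tens_sub_tsum z1); [exact: cotpow_closed|by mlin|].
  move=> m w wP; apply: tens_sub_tens.
  exact: (elimT (tens_subP _ (cotpow_closed _ _)) (proj1 (cotpowS wP))).
apply/eqP; rewrite !tlift_tmap; [|by mlin..].
transitivity (\tsum_(s \ox p <- \tsum_(m \ox x <- z) \tsum_(s \ox m0 <- lam m)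
    (s \ox (m0 \ox x))) (s \ox tmap idfun (@slice F T (tpow T n) phi) p)).
  tnorm; do 2![apply: eq_tlift => ? ?].
  by rewrite tmapE.
rewrite z2; tnorm; apply: eq_tlift => m w.
rewrite tpow_rcoSE; tens_ext w => t y.
have sl (t0 : T) (y0 : tpow T n) :
    (@slice F T (tpow T n) phi : {linear _ -> _}) (t0 \ox y0) = (phi t0 : F) *: y0.
  exact: slice_tens.
rewrite sl [in LHS]tlift_tens; last by mlin.
rewrite linearZ (GRing.scalable_linear (tlift_linear _)) /=; last by mlin.
rewrite (linear_tsum (L := fun v => (phi t : F) *: v)); last by mlin.
apply: etrans; [tnf|]; apply: eq_tlift => s x'.
by rewrite tmapE sl !tensZr.
Qed.

Lemma iter_act_prod n (z : M ⊗ tpow T n) : z \in @actionable n -> iter_act n z =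
  \tsum_(m \ox x <- z) \tsum_(k \ox x0 <- tlco n x) ((k ▷ m) \ox x0).
Proof.
elim: n z => [//|n IHn] z zP; have zb := actionable_behead zP.
have /andP[z1 /eqP z2] := zP.
transitivity (\tsum_(t \ox p <- \tsum_(m \ox w <- z) \tsum_(t \ox y <- (w : T ⊗ tpow T n))
     (t \ox (m \ox y))) \tsum_(m' \ox y' <- iter_act n p)
      \tsum_(k \ox x <- lco t) ((k ▷ m') \ox (x \ox y' : tpow T n.+1))).
  by rewrite iter_actE; tnorm.
transitivity (\tsum_(t \ox p <- \tsum_(m \ox w <- z) \tsum_(t \ox y <- (w : T ⊗ tpow T n))
     (t \ox (m \ox y))) \tsum_(m' \ox y' <-
      \tsum_(m \ox x <- p) \tsum_(k \ox x0 <- tlco n x) ((k ▷ m) \ox x0))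
      \tsum_(k \ox x <- lco t) ((k ▷ m') \ox (x \ox y' : tpow T n.+1))).
  apply: (tens_sub_eq zb) => [||t p pP]; [by mlin|by mlin|].
  by rewrite IHn.
(* Associativity merges k (b m) into (k b) m. That k b is defined is [tpow_lco_split_cotens]; that b
   m is defined follows from [tpow_lco_beta] and the S-condition in [actionable]. *)
pose a := \tsum_(m \ox w <- z) \tsum_(t \ox y <- (w : T ⊗ tpow T n))
  \tsum_(k \ox x <- lco t) \tsum_(b \ox y0 <- tlco n y)
  ((x \ox y0 : tpow T n.+1) \ox (k \ox (b \ox m))).
have aP : a \in tens_sub (cotens3 (rcoS K) (lcoS K) (rcoS K) lam).
  apply: tens_cotens3I; last first.
    have -> : \tsum_(c \ox p <- a) \tsum_(g \ox q <- p) \tsum_(h \ox l <- q)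
        ((c \ox l) \ox (g \ox h)) =
      \tsum_(m \ox w <- z) \tsum_(c \ox p <- tpow_lco_split w) ((c \ox m) \ox p).
      by rewrite /tpow_lco_split; tnorm.
    apply: (tens_sub_tsum z1); [exact: cotens_closed|by mlin|].
    move=> m w wP; apply: (tens_sub_tsum (tpow_lco_split_cotens wP)).
    - exact: cotens_closed.
    - by mlin.
    - by move=> c p; exact: tens_sub_tens.
  apply: tens_cotens_rcoSI.
  transitivity (\tsum_(m \ox w <- z) \tsum_(t \ox y <- (w : T ⊗ tpow T n))
    \tsum_(k \ox x <- lco t) \tsum_(s \ox p <- \tsum_(b \ox y0 <- tlco n y)
    \tsum_(b1 \ox b2 <- comul K b) (beta K b1 \ox (b2 \ox y0))) \tsum_(b \ox y0 <- p)
    (((x \ox y0 : tpow T n.+1) \ox k) \ox (b \ox (s \ox m)))).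
    by rewrite /a; tnorm.
  transitivity (\tsum_(m \ox w <- z) \tsum_(t \ox y <- (w : T ⊗ tpow T n))
    \tsum_(k \ox x <- lco t) \tsum_(s \ox p <-
     \tsum_(s \ox y' <- tpow_rcoS T n y) \tsum_(b \ox y0 <- tlco n y') (s \ox (b \ox y0)))
    \tsum_(b \ox y0 <- p) (((x \ox y0 : tpow T n.+1) \ox k) \ox (b \ox (s \ox m)))).
    apply: (tens_sub_eq z1) => [||m w wP]; [by mlin|by mlin|].
    apply: (tens_sub_eq (proj1 (cotpowS wP))) => [||t y yP]; [by mlin|by mlin|].
    by rewrite tpow_lco_beta.
  transitivity (\tsum_(s \ox p <- \tsum_(m \ox x <- z) \tsum_(s \ox x' <- tpow_rcoS T n.+1 x)
     (s \ox (m \ox x'))) \tsum_(m \ox w <- p) \tsum_(t \ox y <- (w : T ⊗ tpow T n))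
    \tsum_(k \ox x <- lco t) \tsum_(b \ox y0 <- tlco n y)
    (((x \ox y0 : tpow T n.+1) \ox k) \ox (b \ox (s \ox m)))).
    symmetry; tnorm; symmetry; apply: eq_tlift => m w.
    rewrite tpow_rcoSE; tnorm; apply: eq_tlift => t y; exact: tlift_exchange.
  rewrite -z2 /a; tnorm; apply: eq_tlift => m w; rewrite tlift_exchange.
  apply: eq_tlift => t y; rewrite tlift_exchange.
  apply: eq_tlift => k x; exact: tlift_exchange.
transitivity (\tsum_(c \ox p <- a) \tsum_(g \ox q <- p) \tsum_(h \ox m <- q)
   ((g ▷ (h ▷ m)) \ox c)).
  by rewrite /a; tnorm; do 2![apply: eq_tlift => ? ?]; exact: tlift_exchange.
rewrite -(tsum_act_assoc (f := fun c y => y \ox c) _ aP); last by mlin.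
rewrite /a; tnorm; apply: eq_tlift => m w.
by rewrite [RHS](tsum_tpow_lco (n := n)) //; mlin.
Qed.

Lemma tpow_rconsE n t (y : tpow T n) : tpow_rcons y t = tpow_ins n.+1 t y.
Proof.
elim: n y => [//|n IHn] y /=.
by apply: eq_tlift => l y'; rewrite IHn.
Qed.

Lemma iter_cyc_cyclic_op n (z : M ⊗ tpow T n) :
  z \in @cochain_pred F S K T M n -> iter n (cyc n) z = cyclic_op z.
Proof.
case: n z => [//|n] z zP; rewrite iter_cyc_last.
have zb := actionable_behead (cochain_actionable zP).
transitivity (\tsum_(t \ox p <- \tsum_(m \ox w <- z) \tsum_(t \ox y <- (w : T ⊗ tpow T n))
     (t \ox (m \ox y))) \tsum_(m' \ox y' <- iter_act n p) (m' \ox tpow_ins n.+1 t y')).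
  by tnorm.
transitivity (\tsum_(t \ox p <- \tsum_(m \ox w <- z) \tsum_(t \ox y <- (w : T ⊗ tpow T n))
     (t \ox (m \ox y))) \tsum_(m' \ox y' <-
      \tsum_(m \ox x <- p) \tsum_(k \ox x0 <- tlco n x) ((k ▷ m) \ox x0))
     (m' \ox tpow_ins n.+1 t y')).
  apply: (tens_sub_eq zb) => [||t p pP]; [by mlin|by mlin|].
  by rewrite iter_act_prod.
tnorm; rewrite /cyclic_op; do 3![apply: eq_tlift => ? ?].
by rewrite tpow_rconsE.
Qed.

Lemma iter_cyc_id n (z : M ⊗ tpow T n) : stable M ->
  z \in @cochain_pred F S K T M n -> iter n.+1 (cyc n) z = z.
Proof.
move=> M_stable zP; rewrite iter_cyc iter_act_prod ?cochain_act //.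
exact: cochain_actionable.
Qed.

End Iterates.

(** * Cocyclic identities *)

Section Simplicial.
Variables (F : fieldType) (S : coalgebra F) (K : left_bicoalgebroid S).
Variable T : comodule_coalgebra K.
Local Notation rot := (tpow_rot T).
Local Notation D n := (@tpow_comul F S K T n).
Local Notation E n := (@tpow_counit F S K T n).
Local Notation eps := (counit T).
Local Notation Delta := (comul T).
Local Hint Resolve tpow_ins_linearl tpow_ins_linearr : mlin.

Lemma tpow_counit_linear n i : linear (@tpow_counit F S K T n i).
Proof. by elim: n i => [|n IHn] [|i] /=; mlin. Qed.

HB.instance Definition _ n i := GRing.isLinear.Build F (tpow T n.+1) (tpow T n) _
  (@tpow_counit F S K T n i) (@tpow_counit_linear n i).

Lemma tpow_counitZ n i c (x : tpow T n.+1) : E n i (c *: x) = c *: E n i x.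
Proof. exact: linearZ. Qed.

Lemma tpow_comulZ n i c (x : tpow T n) : D n i (c *: x) = c *: D n i x.
Proof. exact: linearZ. Qed.

Lemma tpow_comul_tens0 n t (y : tpow T n) : D n.+1 0 (t \ox y) =
  \tsum_(t1 \ox t2 <- Delta t) (t1 \ox (t2 \ox y : tpow T n.+1)).
Proof. by rewrite tpow_comulS0 tlift_tens //; mlin. Qed.

Lemma tpow_comul_tensS n i t (y : tpow T n) : D n.+1 i.+1 (t \ox y) = t \ox D n i y.
Proof. by rewrite /= tlift_tens //; mlin. Qed.

Lemma tpow_counit_tens n t (u : T) : E 0 n (t \ox u) = (eps u : F) *: t.
Proof. by rewrite /= tlift_tens //; mlin. Qed.

Lemma tpow_counit_tens0 n t u (y : tpow T n) :
  E n.+1 0 (t \ox (u \ox y)) = (eps u : F) *: (t \ox y : tpow T n.+1).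
Proof. by rewrite /= !tlift_tens ?tensZr //; mlin. Qed.

Lemma tpow_counit_tensS n i t (y : tpow T n.+1) : E n.+1 i.+1 (t \ox y) = t \ox E n i y.
Proof. by rewrite /= tlift_tens //; mlin. Qed.

Lemma tpow_comul_comul n i j (x : tpow T n) : (i < j <= n.+1)%N ->
  D n.+1 j (D n i x) = D n.+1 i (D n j.-1 x).
Proof.
elim: n i j x => [|n IHn] [|i] [|j] // x ij.
- case: j ij => // _; rewrite !tpow_comul0.
  transitivity (\tsum_(a \ox b <- Delta x) \tsum_(b1 \ox b2 <- Delta b)
    (a \ox (b1 \ox b2) : tpow T 2)).
    by rewrite /=; apply: eq_tlift => a b; rewrite -[in LHS](tlift_id (Delta b)); tnorm.
  rewrite -(tsum_comulA (f := fun a b c => a \ox (b \ox c) : tpow T 2)); last by mlin.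
  by rewrite tpow_comulS0.
- tens_ext x => t y; case: j ij => [|j] ij.
    rewrite [_.-1]/= tpow_comul_tens0 [LHS](linear_tsum (L := D n.+2 1)); last by mlin.
    rewrite [RHS](linear_tsum (L := D n.+2 0)); last by mlin.
    transitivity (\tsum_(a \ox b <- Delta t) \tsum_(b1 \ox b2 <- Delta b)
      (a \ox (b1 \ox (b2 \ox y)) : tpow T n.+3)).
      apply: eq_tlift => t1 t2; rewrite tpow_comul_tensS tpow_comul_tens0.
      by rewrite (linear_tsum (L := fun v : tpow T n.+2 => t1 \ox v)) //; mlin.
    rewrite -(tsum_comulA (f := fun a b c => a \ox (b \ox (c \ox y)) : tpow T n.+3)); last by mlin.
    by apply: eq_tlift => t1 t2; rewrite tpow_comul_tens0.
  rewrite [_.-1]/= tpow_comul_tensS !tpow_comul_tens0.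
  rewrite (linear_tsum (L := D n.+2 j.+2)); last by mlin.
  by apply: eq_tlift => t1 t2; rewrite !tpow_comul_tensS.
- case: j ij => [//|j] ij.
  by tens_ext x => t y; rewrite [_.+2.-1]/= !tpow_comul_tensS IHn.
Qed.

Lemma tpow_counit_counit n i j (x : tpow T n.+2) : (i <= j <= n)%N ->
  E n j (E n.+1 i x) = E n i (E n.+1 j.+1 x).
Proof.
elim: n i j x => [|n IHn] [|i] [|j] // x ij; tens_ext x => t y.
- tens_ext y => u v.
  rewrite tpow_counit_tens0 tpow_counit_tensS [LHS]tpow_counitZ !tpow_counit_tens.
  have -> : eps ((eps v : F) *: u) = (eps v : F) * (eps u : F) by exact: linearZ.
  by rewrite mulrC; exact: (scalerA (eps u : F) (eps v : F) (t : T)).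
- tens_ext y => u y'; tens_ext y' => v y''.
  rewrite tpow_counit_tens0 tpow_counit_tensS [LHS]tpow_counitZ !tpow_counit_tens0.
  by rewrite tensZr [RHS]tpow_counitZ tpow_counit_tens0 !scalerA mulrC.
- tens_ext y => u y'.
  rewrite tpow_counit_tens0 !tpow_counit_tensS [LHS]tpow_counitZ.
  by rewrite tpow_counit_tensS tpow_counit_tens0.
- by rewrite !tpow_counit_tensS IHn.
Qed.

Lemma tpow_counit_comul_lt n i j (x : tpow T n.+1) : (i < j <= n.+1)%N ->
  E n.+1 j (D n.+1 i x) = D n i (E n j.-1 x).
Proof.
elim: n i j x => [|n IHn] [|i] [|j] // x ij; tens_ext x => t y; rewrite [_.-1]/=.
- case: j ij => // _; rewrite tpow_comul_tens0 (linear_tsum (L := E 1 1)); last by mlin.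
  rewrite tpow_counit_tens [RHS]tpow_comulZ tpow_comul0.
  rewrite -[in RHS](tlift_id (Delta t)) (linear_tsum (L := fun v => (eps y : F) *: v));
    last by mlin.
  apply: eq_tlift => t1 t2.
  by rewrite tpow_counit_tensS tpow_counit_tens tensZr.
- by case: j ij => [|j]; rewrite ?andbF.
- rewrite tpow_comul_tens0 (linear_tsum (L := E n.+2 j.+1)); last by mlin.
  case: j ij => [|j] ij.
    tens_ext y => v y'; rewrite tpow_counit_tens0 [RHS]tpow_comulZ tpow_comul_tens0.
    rewrite [RHS](linear_tsum (L := fun w => (eps v : F) *: w)); last by mlin.
    apply: eq_tlift => t1 t2.
    by rewrite tpow_counit_tensS tpow_counit_tens0 tensZr.
  rewrite tpow_counit_tensS tpow_comul_tens0.
  by apply: eq_tlift => t1 t2; rewrite !tpow_counit_tensS.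
- case: j ij => [//|j] ij.
  rewrite tpow_comul_tensS !tpow_counit_tensS IHn //.
  by rewrite tpow_comul_tensS.
Qed.

Lemma tpow_counit_comul_id n i j (x : tpow T n) :
  (i <= n)%N -> (i == j) || (i == j.+1) -> E n j (D n i x) = x.
Proof.
elim: n i j x => [|n IHn] [|i] [|j] // x iN ij.
- by rewrite tpow_comul0 /= counitr.
- tens_ext x => t y; rewrite tpow_comul_tens0 (linear_tsum (L := E n.+1 0)); last by mlin.
  rewrite -[in RHS](counitr (c := T) t) (linear_tsum (L := fun v => v \ox y)); last by mlin.
  by apply: eq_tlift => a b; rewrite tpow_counit_tens0 tensZl.
- case: i iN ij => // iN _; tens_ext x => t y; rewrite tpow_comul_tensS.
  case: n {IHn x} iN y => [|n] iN y.
    rewrite tpow_comul0 -[in RHS](counitl (c := T) y).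
    rewrite [RHS](linear_tsum (L := fun v => t \ox v)); last by mlin.
    tens_ext (Delta y) => a b.
    by rewrite tpow_counit_tens0 tlift_tens ?tensZr //; mlin.
  tens_ext y => v y'; rewrite tpow_comul_tens0.
  rewrite (linear_tsum (L := fun v => E n.+2 0 (t \ox v))); last by mlin.
  rewrite -[in RHS](counitl (c := T) v).
  rewrite [RHS](linear_tsum (L := fun v => t \ox (v \ox y' : tpow T n.+1))); last by mlin.
  by apply: eq_tlift => a b; rewrite tpow_counit_tens0 tensZl tensZr.
- tens_ext x => t y; rewrite tpow_comul_tensS tpow_counit_tensS IHn //.
Qed.

Lemma tpow_counit_comul_gt n i j (x : tpow T n.+1) : (j.+1 < i <= n.+1)%N ->
  E n.+1 j (D n.+1 i x) = D n i.-1 (E n j x).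
Proof.
elim: n i j x => [|n IHn] [|i] [|j] // x ij; tens_ext x => t y.
- by case: i ij => [|i]; rewrite ?andbF.
- by case: i ij => [|i]; rewrite ?andbF.
- case: i ij => // i ij; rewrite tpow_comul_tensS.
  tens_ext y => v y'; rewrite tpow_comul_tensS !tpow_counit_tens0.
  by rewrite [RHS]tpow_comulZ tpow_comul_tensS.
- case: i ij => // i ij.
  rewrite tpow_comul_tensS [_.+2.-1]/= !tpow_counit_tensS IHn //.
  by rewrite tpow_comul_tensS.
Qed.

(** For [i = n] the doubled factor would be the one that moves, and rotation would separate its two
    halves. The bound in [tpow_rot_counit] likewise keeps the deleted factor away from the end. *)
Lemma tpow_rot_comul n i (w : tpow T n) : (i < n)%N ->
  rot n.+1 (D n i w) = D n i.+1 (rot n w).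
Proof.
elim: n i w => [//|n IHn] [|i] w iN; tens_ext w => t y.
  rewrite tpow_comul_tens0 (linear_tsum (L := rot n.+2)); last by mlin.
  under eq_tlift => a b do rewrite !tpow_rot_tens.
  rewrite tpow_rot_tens; move: (rot n y) => z; case: n {IHn iN w y} z => [|n] z.
    rewrite -[tpow_ins 1 t z]/(z \ox t) tpow_comul_tensS tpow_comul0.
    rewrite -[in RHS](tlift_id (Delta t)) [RHS](linear_tsum (L := fun v => z \ox v)); last by mlin.
    apply: eq_tlift => a b.
    by rewrite -[tpow_ins 1 b z]/(z \ox b) tpow_insS.
  tens_ext z => l z'; rewrite tpow_insS tpow_ins0 tpow_comul_tensS tpow_comul_tens0.
  rewrite [RHS](linear_tsum (L := fun v : tpow T n.+2 => l \ox v)); last by mlin.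
  by apply: eq_tlift => a b; rewrite !(tpow_insS, tpow_ins0).
rewrite tpow_comul_tensS !tpow_rot_tens IHn //.
case: n {IHn w} y iN => // n y iN.
tens_ext (rot n.+1 y) => l z.
by rewrite tpow_insS tpow_ins0 !tpow_comul_tensS tpow_insS tpow_ins0.
Qed.

Lemma tpow_rot_counit n i (w : tpow T n.+1) : (i < n)%N ->
  rot n (E n i w) = E n i.+1 (rot n.+1 w).
Proof.
elim: n i w => [//|n IHn] [|i] w iN; tens_ext w => t y.
  tens_ext y => u y'; rewrite tpow_counit_tens0 [LHS]linearZ !tpow_rot_tens.
  move: (rot n y') => z; case: n {IHn iN w y y'} z => [|n] z.
    rewrite -[tpow_ins 1 u z]/(z \ox u) tpow_insS tpow_ins0 tpow_counit_tensS tpow_counit_tens.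
    by rewrite tensZr.
  tens_ext z => l z'.
  by rewrite !(tpow_insS, tpow_ins0) tpow_counit_tensS tpow_counit_tens0 tensZr.
rewrite tpow_counit_tensS !tpow_rot_tens IHn //.
case: n {IHn w} y iN => // n y iN.
tens_ext (rot n.+2 y) => l z.
by rewrite !(tpow_insS, tpow_ins0, tpow_counit_tensS).
Qed.

(** After rotation the second place, which [E n 0] deletes, holds the former first factor. *)
Lemma tpow_rot_drop n (w : tpow T n.+1) : E n 0 (rot n.+1 w) = rot n (tpow_drop T n w).
Proof.
tens_ext w => t y; rewrite tpow_rot_tens tpow_drop_tens [RHS]linearZ.
move: (rot n y) => z; case: n {w y} z => [|n] z.
  by rewrite -[tpow_ins 1 t z]/(z \ox t) tpow_counit_tens.
by tens_ext z => l z'; rewrite tpow_insS tpow_ins0 tpow_counit_tens0.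
Qed.

Lemma tpow_drop_comul n (x : tpow T n) : tpow_drop T n (D n 0 x) = x.
Proof.
case: n x => [|n] x.
  rewrite tpow_comul0 -[in RHS](counitl (c := T) x); tens_ext (Delta x) => a b.
  by rewrite tpow_drop_tens tlift_tens //; mlin.
tens_ext x => t y; rewrite tpow_comul_tens0 (linear_tsum (L := tpow_drop T n.+1)); last by mlin.
rewrite -[in RHS](counitl (c := T) t) (linear_tsum (L := fun v => v \ox y)); last by mlin.
by apply: eq_tlift => a b; rewrite tpow_drop_tens tensZl.
Qed.

End Simplicial.

(* The cyclic operator is t_n = u_n^n for a rotation u_n of order n + 1; since d_i u = u d_(i-1)
   and s_i u = u s_(i-1), every relation reduces to the ones between d_i, s_j with i, j
   away from the last coface and to the extra degeneracy e with s_0 u = u e. *)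
Lemma cocyclic_of_rotation (F : fieldType) (C : nat -> lmodType F)
    (d : forall n, nat -> {linear C n -> C n.+1})
    (s : forall n, nat -> {linear C n.+1 -> C n})
    (t u : forall n, {linear C n -> C n}) (e : forall n, C n.+1 -> C n) :
  (forall n x, iter n.+1 (u n) x = x) ->
  (forall n x, t n x = iter n (u n) x) ->
  (forall n x, d n n.+1 x = t n.+1 (d n 0 x)) ->
  (forall n i x, (i < n)%N -> u n.+1 (d n i x) = d n i.+1 (u n x)) ->
  (forall n i x, (i < n)%N -> u n (s n i x) = s n i.+1 (u n.+1 x)) ->
  (forall n x, s n 0 (u n.+1 x) = u n (e n x)) ->
  (forall n x, e n (d n 0 x) = x) ->
  (forall n i j x, (i < j <= n.+1)%N -> d n.+1 j (d n i x) = d n.+1 i (d n j.-1 x)) ->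
  (forall n i j x, (i <= j <= n)%N -> s n j (s n.+1 i x) = s n i (s n.+1 j.+1 x)) ->
  (forall n i j x, (i < j <= n.+1)%N -> s n.+1 j (d n.+1 i x) = d n i (s n j.-1 x)) ->
  (forall n i j x, (i <= n)%N -> (i == j) || (i == j.+1) -> s n j (d n i x) = x) ->
  (forall n i j x, (j.+1 < i <= n.+1)%N -> s n.+1 j (d n.+1 i x) = d n i.-1 (s n j x)) ->
  is_cocyclic d s t.
Proof.
move=> uN tE dlast ud us us0 ed dd ss sdlt sdid sdgt.
have ut n x : u n (t n x) = x by rewrite tE -iterS uN.
have tu n x : t n (u n x) = x by rewrite tE -iterSr uN.
have td n i x : (0 < i <= n)%N -> t n.+1 (d n i x) = d n i.-1 (t n x).
  case: i => // i /andP[_ iN].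
  by rewrite -[in LHS](ut n x) -ud // tu.
have ts n i x : (0 < i <= n)%N -> t n (s n i x) = s n i.-1 (t n.+1 x).
  case: i => // i /andP[_ iN].
  by rewrite -[in LHS](ut n.+1 x) -us // tu.
have dk n k x : (k <= n)%N -> d n k (iter k (u n) x) = iter k (u n.+1) (d n 0 x).
  by elim: k => // k IHk kN; rewrite !iterS -ud // IHk // ltnW.
have sk n k x : (k <= n)%N -> s n k (iter k (u n.+1) x) = iter k (u n) (s n 0 x).
  by elim: k => // k IHk kN; rewrite !iterS -us // IHk // ltnW.
(* In degree n + 1 the rotation has order n + 2, and 2 (n + 1) = n + (n + 2). *)
have tt n x : t n.+1 (t n.+1 x) = iter n (u n.+1) x.
  by rewrite !tE -iterD addSnnS addnC iterD uN.
have tdl n x : t n.+1 (d n n.+1 x) = d n n (t n x).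
  by rewrite dlast tt tE dk.
have td' n i x : (0 < i <= n.+1)%N -> t n.+1 (d n i x) = d n i.-1 (t n x).
  move=> /andP[i0]; rewrite leq_eqVlt => /orP[/eqP ->|iN]; first exact: tdl.
  by rewrite td // i0.
split=> //.
- move=> n i j x /andP[ij]; rewrite leq_eqVlt => /orP[/eqP jE|jN]; last first.
    by rewrite dd // ij.
  move: ij; rewrite jE ltnS leq_eqVlt [LHS]dlast [n.+2.-1]/= => /orP[/eqP ->|iN].
    rewrite !dlast -(td' _ 1%N) // -tdl dlast.
    by rewrite (dd _ 0%N 1%N).
  by rewrite -(dd _ 0%N i.+1) // td' ?dlast //= (leqW iN).
- move=> n i j x jN ij; have [iN|] := leqP i n; first exact: sdid.
  case/orP: ij => /eqP -> => [|jn]; first by rewrite ltnNge jN.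
  have -> : j = n by apply/eqP; rewrite eqn_leq jN.
  (* s_n d_(n+1) = s_n u^(n+1) d_0 = u^n s_0 u d_0 = u^(n+1) e d_0 = 1. *)
  rewrite dlast tE iterSr sk // us0 ed.
  by rewrite -iterSr uN.
- move=> n i j x /andP[ij]; rewrite leq_eqVlt => /orP[/eqP iE|iN]; last first.
    by rewrite sdgt // ij.
  rewrite iE in ij *; rewrite dlast -(ts _ j.+1) //.
  by rewrite (sdlt _ 0%N) // dlast.
- by move=> n x; rewrite tt sk // tE.
- move=> n x.
  (* Since u t = 1, also u^(n+1) t^(n+1) = 1, and u^(n+1) is the identity. *)
  have H k : iter k (u n) (iter k (t n) x) = x.
    by elim: k => // k IHk; rewrite iterSr iterS ut.
  by rewrite -[LHS]uN H.
Qed.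

(** * The operators on M ⊗ T^{⊗(n+1)} and their restriction to cochains *)

Section CochainOperators.
Variables (F : fieldType) (S : coalgebra F) (K : hopf_coalgebra S).
Variables (T : comodule_coalgebra K) (M : ayd_module K).
Hypothesis M_stable : stable M.
Local Notation cyc := (@cyc F S K T M).
Local Notation Cpred n := (@cochain_pred F S K T M n).
Local Notation D n := (@tpow_comul F S K T n).
Local Notation E n := (@tpow_counit F S K T n).

Lemma coface_linear n i : linear (@coface F S K T M n i).
Proof. by rewrite /coface; mlin. Qed.
HB.instance Definition _ n i := GRing.isLinear.Build F (M ⊗ tpow T n) (M ⊗ tpow T n.+1) _
  (@coface F S K T M n i) (@coface_linear n i).

Lemma codegeneracy_linear n i : linear (@codegeneracy F S K T M n i).
Proof. by rewrite /codegeneracy; mlin. Qed.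
HB.instance Definition _ n i := GRing.isLinear.Build F (M ⊗ tpow T n.+1) (M ⊗ tpow T n) _
  (@codegeneracy F S K T M n i) (@codegeneracy_linear n i).

Lemma extra_codegeneracy_linear n : linear (@extra_codegeneracy F S K T M n).
Proof. by rewrite /extra_codegeneracy; mlin. Qed.
HB.instance Definition _ n := GRing.isLinear.Build F (M ⊗ tpow T n.+1) (M ⊗ tpow T n) _
  (@extra_codegeneracy F S K T M n) (@extra_codegeneracy_linear n).

Lemma coface_tens n i (m : M) (x : tpow T n) : coface i (m \ox x) = m \ox D n i x.
Proof. by rewrite /coface tlift_tens //; mlin. Qed.

Lemma codegeneracy_tens n i (m : M) (x : tpow T n.+1) : codegeneracy i (m \ox x) = m \ox E n i x.
Proof. by rewrite /codegeneracy tlift_tens //; mlin. Qed.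

Lemma extra_codegeneracy_tens n (m : M) (x : tpow T n.+1) :
  extra_codegeneracy (m \ox x) = m \ox tpow_drop T n x.
Proof. by rewrite /extra_codegeneracy tlift_tens //; mlin. Qed.

Lemma act0_tens0 (m : M) (t : tpow T 0) :
  act0 (m \ox t) = \tsum_(k \ox x <- cc_lco T t) (bact k m \ox x).
Proof. by rewrite /act0 tlift_tens //; mlin. Qed.

Lemma act0_tensS n (m : M) t (y : tpow T n) : act0 (m \ox (t \ox y : tpow T n.+1)) =
  \tsum_(k \ox x <- cc_lco T t) (bact k m \ox (x \ox y : tpow T n.+1)).
Proof. by rewrite /act0 !tlift_tens //; mlin. Qed.

Lemma act0Z n c (z : M ⊗ tpow T n) : act0 (c *: z) = c *: act0 z.
Proof. exact: linearZ. Qed.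

Lemma act0_comul n i (m : M) (x : tpow T n) : (i < n)%N ->
  act0 (m \ox D n i.+1 x) = coface i.+1 (act0 (m \ox x)).
Proof.
case: n x => // n x iN; tens_ext x => t y.
rewrite tpow_comul_tensS !act0_tensS.
rewrite (linear_tsum (L := @coface F S K T M n.+1 i.+1)); last by mlin.
by apply: eq_tlift => k t0; rewrite coface_tens tpow_comul_tensS.
Qed.

Lemma act0_counit n i (m : M) (x : tpow T n.+1) :
  act0 (m \ox E n i x) = codegeneracy i (act0 (m \ox x)).
Proof.
tens_ext x => t y; rewrite act0_tensS.
rewrite [RHS](linear_tsum (L := @codegeneracy F S K T M n i)); last by mlin.
under [RHS]eq_tlift => k t0 do rewrite codegeneracy_tens.
case: n {x} y => [|n] y.
  rewrite tpow_counit_tens tensZr act0Z act0_tens0.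
  rewrite (linear_tsum (L := fun v => (counit T y : F) *: v)); last by mlin.
  by apply: eq_tlift => k t0; rewrite tpow_counit_tens tensZr.
case: i => [|i].
  tens_ext y => u y'.
  rewrite tpow_counit_tens0 tensZr act0Z act0_tensS.
  rewrite (linear_tsum (L := fun v => (counit T u : F) *: v)); last by mlin.
  by apply: eq_tlift => k t0; rewrite tpow_counit_tens0 tensZr.
rewrite tpow_counit_tensS act0_tensS.
by apply: eq_tlift => k t0; rewrite tpow_counit_tensS.
Qed.

Lemma cyc_act0 n (m : M) (x : tpow T n) : cyc n (m \ox x) = act0 (m \ox tpow_rot T n x).
Proof. by rewrite -[LHS]/(act0 (tmap idfun (tpow_rot T n) (m \ox x))) tmapE. Qed.

Lemma cyc_coface n i (z : M ⊗ tpow T n) : (i < n)%N ->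
  cyc n.+1 (coface i z) = coface i.+1 (cyc n z).
Proof.
move=> iN; tens_ext z => m x.
by rewrite coface_tens !cyc_act0 tpow_rot_comul // act0_comul.
Qed.

Lemma cyc_codegeneracy n i (z : M ⊗ tpow T n.+1) : (i < n)%N ->
  cyc n (codegeneracy i z) = codegeneracy i.+1 (cyc n.+1 z).
Proof.
move=> iN; tens_ext z => m x.
by rewrite codegeneracy_tens !cyc_act0 tpow_rot_counit // act0_counit.
Qed.

Lemma cyc_extra_codegeneracy n (z : M ⊗ tpow T n.+1) :
  codegeneracy 0 (cyc n.+1 z) = cyc n (extra_codegeneracy z).
Proof.
tens_ext z => m x.
by rewrite extra_codegeneracy_tens !cyc_act0 -act0_counit tpow_rot_drop.
Qed.

Lemma extra_codegeneracy_coface n (z : M ⊗ tpow T n) : extra_codegeneracy (coface 0 z) = z.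
Proof. by tens_ext z => m x; rewrite coface_tens extra_codegeneracy_tens tpow_drop_comul. Qed.

Lemma tpow_rcons_bilinear n : bilinear_map (@tpow_rcons F S K T n).
Proof.
by split=> ? ? ? ?; rewrite !tpow_rconsE ?tpow_ins_linearl ?tpow_ins_linearr.
Qed.

Lemma coface_lastE n (z : M ⊗ tpow T n) : coface_last z = cyclic_op (coface 0 z).
Proof.
have [rl rr] := tpow_rcons_bilinear n.
by rewrite /coface_last /cyclic_op /coface; symmetry; tnorm.
Qed.

Lemma iter_cyc_cochain n k (z : M ⊗ tpow T n) : z \in Cpred n -> iter k (cyc n) z \in Cpred n.
Proof. by move=> zP; elim: k => // k IHk; apply: cyc_cochain. Qed.

(* Cochains are stable under d_0 and the extra degeneracy, and the other operators
   are conjugate to these by the rotation. *)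
Lemma coface_cochain n i (z : M ⊗ tpow T n) : (i <= n)%N ->
  z \in Cpred n -> coface i z \in Cpred n.+1.
Proof.
elim: i z => [|i IHi] z iN zP; first exact: coface0_cochain.
rewrite -(iter_cyc_id M_stable zP) iterS -cyc_coface //; apply: cyc_cochain => //.
by apply: IHi; [exact: ltnW|exact: iter_cyc_cochain].
Qed.

Lemma codegeneracy_cochain n i (z : M ⊗ tpow T n.+1) : (i <= n)%N ->
  z \in Cpred n.+1 -> codegeneracy i z \in Cpred n.
Proof.
elim: i z => [|i IHi] z iN zP; rewrite -(iter_cyc_id M_stable zP) iterS.
  rewrite cyc_extra_codegeneracy; apply: cyc_cochain => //.
  by apply: extra_codegeneracy_cochain => //; exact: iter_cyc_cochain.
rewrite -cyc_codegeneracy //; apply: cyc_cochain => //.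
by apply: IHi; [exact: ltnW|exact: iter_cyc_cochain].
Qed.

Lemma linear_restrict (V W : lmodType F) (P : submodClosed V) (Q : submodClosed W) (f : V -> W) :
  linear f -> (forall v, v \in P -> f v \in Q) ->
  exists g : {linear @subsp F V P -> @subsp F W Q}, forall x, val (g x) = f (val x).
Proof.
move=> fL fPQ.
pose g (x : @subsp F V P) : @subsp F W Q := exist _ (f (val x)) (fPQ _ (valP x)).
have gL : linear g by move=> a x y; apply: val_inj; exact: fL.
pose g' : {linear @subsp F V P -> @subsp F W Q} := HB.pack g (GRing.isLinear.Build _ _ _ _ g gL).
by exists g'.
Qed.

End CochainOperators.

Lemma cochains_cocyclic (F : fieldType) (S : coalgebra F)
    (K : hopf_coalgebra S) (T : comodule_coalgebra K) (M : ayd_module K)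
    (M_stable : stable M) :
  exists (d : forall n, nat -> {linear cochain T M n -> cochain T M n.+1})
         (s : forall n, nat -> {linear cochain T M n.+1 -> cochain T M n})
         (t : forall n, {linear cochain T M n -> cochain T M n}),
    (forall n i x, (i <= n)%N ->
       cochain_incl (d n i x) = coface i (cochain_incl x)) /\
    (forall n x, cochain_incl (d n n.+1 x) = coface_last (cochain_incl x)) /\
    (forall n i x, (i <= n)%N ->
       cochain_incl (s n i x) = codegeneracy i (cochain_incl x)) /\
    (forall n x, cochain_incl (t n x) = cyclic_op (cochain_incl x)) /\
    is_cocyclic d s t.
Proof.
pose C n := @cochain_pred _ S K T M n : submodClosed (M ⊗ tpow T n).
have Cval n (x : cochain T M n) : val x \in C n by exact: (proj2_sig x).
have [u uE] : exists u : forall n, {linear cochain T M n -> cochain T M n},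
    forall n x, val (u n x) = cyc T M n (val x).
  suff h n : exists v : {linear cochain T M n -> cochain T M n},
      forall x, val (v x) = cyc T M n (val x).
    by exists (fun n => projT1 (cid (h n))) => n x; case: cid.
  apply: (linear_restrict (P := C n) (Q := C n)); first exact: linearP.
  by move=> v; exact: cyc_cochain.
have iterE n k x : val (iter k (u n) x) = iter k (cyc T M n) (val x).
  by elim: k => // k IHk; rewrite iterS uE IHk.
have [t tE] : exists t : forall n, {linear cochain T M n -> cochain T M n},
    forall n x, t n x = iter n (u n) x.
  have tL n : linear (iter n (u n)) by exact: iter_linear.
  pose t n : {linear cochain T M n -> cochain T M n} :=
    HB.pack (iter n (u n)) (GRing.isLinear.Build _ _ _ _ (iter n (u n)) (tL n)).
  by exists t.
have tval n x : val (t n x) = cyclic_op (val x).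
  by rewrite tE iterE iter_cyc_cyclic_op // Cval.
have [e eE] : exists e : forall n, cochain T M n.+1 -> cochain T M n,
    forall n x, val (e n x) = extra_codegeneracy (val x).
  by exists (fun n x => exist (fun v => v \in C n) _ (extra_codegeneracy_cochain (Cval _ x))).
have [c cE] : exists c : forall n, nat -> {linear cochain T M n -> cochain T M n.+1},
    forall n i x, (i <= n)%N -> val (c n i x) = coface i (val x).
  suff h n i : exists v : {linear cochain T M n -> cochain T M n.+1},
      forall x, (i <= n)%N -> val (v x) = coface i (val x).
    by exists (fun n i => projT1 (cid (h n i))) => n i x; case: cid => v /= vE; exact: vE.
  (* Outside the range of indices preservation of cochains is not asserted, and the zero map serves
     as default value. *)
  have [iN|iN] := boolP (i <= n)%N; last by exists \0.
  have [||v vE] := @linear_restrict _ _ _ (C n) (C n.+1) (@coface _ S K T M n i).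
  - exact: linearP.
  - by move=> v; exact: coface_cochain.
  - by exists v.
(* The last coface is taken to be t ∘ d_0, so that linearity and preservation of cochains come for
   free; [coface_lastE] identifies it with the explicit formula. *)
pose d n i : {linear cochain T M n -> cochain T M n.+1} :=
  if i == n.+1 then [the {linear _ -> _} of t n.+1 \o c n 0] else c n i.
have dE n i x : (i <= n)%N -> val (d n i x) = coface i (val x).
  by move=> iN; rewrite /d ltn_eqF // cE.
have dlast n x : d n n.+1 x = t n.+1 (d n 0 x) by rewrite /d eqxx.
have [s sE] : exists s : forall n, nat -> {linear cochain T M n.+1 -> cochain T M n},
    forall n i x, (i <= n)%N -> val (s n i x) = codegeneracy i (val x).
  suff h n i : exists v : {linear cochain T M n.+1 -> cochain T M n},
      forall x, (i <= n)%N -> val (v x) = codegeneracy i (val x).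
    by exists (fun n i => projT1 (cid (h n i))) => n i x; case: cid => v /= vE; exact: vE.
  have [iN|iN] := boolP (i <= n)%N; last by exists \0.
  have [||v vE] := @linear_restrict _ _ _ (C n.+1) (C n) (@codegeneracy _ S K T M n i).
  - exact: linearP.
  - by move=> v; exact: codegeneracy_cochain.
  - by exists v.
exists d, s, t; split; first exact: dE.
split.
  by move=> n x; rewrite dlast coface_lastE -dE //; exact: tval.
split; first exact: sE.
split; first exact: tval.
apply: (@cocyclic_of_rotation _ _ d s t u e) => //.
- by move=> n x; apply: val_inj; rewrite iterE iter_cyc_id // Cval.
- by move=> n i x iN; apply: val_inj; rewrite uE !dE ?uE ?cyc_coface // ltnW.
- by move=> n i x iN; apply: val_inj; rewrite uE !sE ?uE ?cyc_codegeneracy // ltnW.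
- by move=> n x; apply: val_inj; rewrite sE // !uE eE cyc_extra_codegeneracy.
- by move=> n x; apply: val_inj; rewrite eE dE // extra_codegeneracy_coface.
- move=> n i j x ij; have /andP[lt_ij jN] := ij.
  have iN : (i <= n)%N by rewrite -ltnS (leq_trans lt_ij).
  have j1N : (j.-1 <= n)%N by rewrite -ltnS (ltn_predK lt_ij).
  apply: val_inj; rewrite !dE ?(leqW iN) //.
  by tens_ext (val x) => m y; rewrite !coface_tens tpow_comul_comul.
- move=> n i j x ij; have /andP[le_ij jN] := ij.
  apply: val_inj; rewrite !sE ?(leqW jN) ?(leq_trans le_ij jN) ?(leqW (leq_trans le_ij jN)) //.
  by tens_ext (val x) => m y; rewrite !codegeneracy_tens tpow_counit_counit.
- move=> n i j x ij; have /andP[lt_ij jN] := ij.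
  have iN : (i <= n)%N by rewrite -ltnS (leq_trans lt_ij).
  have j1N : (j.-1 <= n)%N by rewrite -ltnS (ltn_predK lt_ij).
  apply: val_inj; rewrite !(sE, dE) ?(leqW iN) //.
  tens_ext (val x) => m y.
  by rewrite !(coface_tens, codegeneracy_tens) tpow_counit_comul_lt.
- move=> n i j x iN ij.
  have jN : (j <= n)%N by case/orP: ij => /eqP ij; rewrite ij in iN; [|exact: ltnW].
  apply: val_inj; rewrite !(sE, dE) //.
  tens_ext (val x) => m y.
  by rewrite coface_tens codegeneracy_tens tpow_counit_comul_id.
- move=> n i j x ij; have /andP[lt_ij iN] := ij.
  have i1N : (i.-1 <= n)%N by rewrite -ltnS (ltn_predK lt_ij).
  have jN : (j <= n)%N by rewrite -ltnS; exact: leq_trans (ltnW lt_ij) _.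
  apply: val_inj; rewrite !(sE, dE) ?(leqW jN) //.
  tens_ext (val x) => m y.
  by rewrite !(coface_tens, codegeneracy_tens) tpow_counit_comul_gt.
Qed.

Theorem proposition3p1 (R : realType) (S : coalgebra R[i])
    (K : hopf_coalgebra S) (T : comodule_coalgebra K) (M : ayd_module K)
    (M_stable : stable M) :
  exists (d : forall n, nat -> {linear cochain T M n -> cochain T M n.+1})
         (s : forall n, nat -> {linear cochain T M n.+1 -> cochain T M n})
         (t : forall n, {linear cochain T M n -> cochain T M n}),
    (forall n i x, (i <= n)%N ->
       cochain_incl (d n i x) = coface i (cochain_incl x)) /\
    (forall n x, cochain_incl (d n n.+1 x) = coface_last (cochain_incl x)) /\
    (forall n i x, (i <= n)%N ->
       cochain_incl (s n i x) = codegeneracy i (cochain_incl x)) /\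
    (forall n x, cochain_incl (t n x) = cyclic_op (cochain_incl x)) /\
    is_cocyclic d s t.
Proof. exact: cochains_cocyclic. Qed.
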